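(* Let $B$ and $A$ be directed algebras with the same vertex set $\{1,\dots,n\}$ and let $\Lambda=\mathcal{A}(B,A^{\operatorname{op}})$. Put $\Delta=\Delta_\Lambda(1)\oplus\dots\oplus\Delta_\Lambda(n)$ and $\mathbb{L}=L_B(1)\oplus\dots\oplus L_B(n)$. Then there are isomorphisms of graded algebras $$\operatorname{Ext}_\Lambda^\ast(\Delta,\Delta)\cong\mathcal{A}\left(\operatorname{Ext}_B^\ast(\mathbb{L},\mathbb{L}),\operatorname{Hom}_\Lambda(\Delta,\Delta)\right)\cong\mathcal{A}\left(\operatorname{Ext}_B^\ast(\mathbb{L},\mathbb{L}),A\right).$$
   Context: $K$ is an algebraically closed field; paths compose right to left ($\beta\alpha$ means first $\alpha$, then $\beta$); modules are finite-dimensional left modules. An algebra $KQ/I$ with $I$ admissible is directed if $Q$ is finite with vertex set $\{1,\dots,n\}$ and every arrow $i\to j$ satisfies $i<j$. $L_B(i)$, $P_B(i)$ denote the simple and indecomposable projective modules at vertex $i$. Dual extension algebra: for $B=KQ/\langle\rho_i\rangle$ and $A=KQ'/\langle\rho'_j\rangle$ with $Q_0=Q'_0$, $\mathcal{A}(B,A)=KE/J$ where $E_0=Q_0$, $E_1=Q_1\sqcup Q_1'$ and $J=\langle\rho_i,\rho'_j,\alpha\beta'\mid\alpha\in Q_1,\beta'\in Q'_1\rangle$. The standard module $\Delta_\Lambda(i)$ is the quotient of $P_\Lambda(i)$ by the sum of the images of all homomorphisms $P_\Lambda(j)\to P_\Lambda(i)$ with $j>i$. Multiplication in the $\operatorname{Ext}$-algebras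 is the Yoneda product, with $\varepsilon\varphi$ meaning first $\varphi$, then $\varepsilon$. The algebras $\operatorname{Ext}_B^\ast(\mathbb{L},\mathbb{L})$ and $\operatorname{Hom}_\Lambda(\Delta,\Delta)$ are regarded as quotients of path algebras on the vertex set $\{1,\dots,n\}$, the vertex $i$ corresponding to the identity of $L_B(i)$, respectively of $\Delta_\Lambda(i)$, so that $e_j\operatorname{Ext}_B^\ast(\mathbb{L},\mathbb{L})e_i=\operatorname{Ext}_B^\ast(L_B(i),L_B(j))$, and similarly for $\operatorname{Hom}_\Lambda(\Delta,\Delta)$. The $\operatorname{Ext}$-algebras are graded by the degree of extensions, and the gradings are extended to the two dual extension algebras by letting the elements of $\operatorname{Hom}_\Lambda(\Delta,\Delta)$ and of $A$ be homogeneous of degree $0$. *)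

(* Defs.v *)
From HB Require Import structures.
From mathcomp Require Import all_boot all_algebra.
From mathcomp Require Import boolp functions.

Set Implicit Arguments.
Unset Strict Implicit.
Unset Printing Implicit Defensive.

Import GRing.Theory.
Local Open Scope ring_scope.

(* A K-algebra as a ring with a central ring morphism from K.  The library's
   [algType] excludes the zero ring, which may occur here: path algebra of the
   empty quiver, quotient by a non-proper ideal, endomorphisms of 0. *)
HB.mixin Record isPzAlgebra (K : pzRingType) A of GRing.PzRing A := {
  scal : K -> A;
  scal_zmod : zmod_morphism scal;
  scal_monoid : monoid_morphism scal;
  scal_comm : forall c x, scal c * x = x * scal c
}.

#[short(type="pzAlgType")]
HB.structure Definition PzAlgebra (K : pzRingType) :=
  {A of GRing.PzRing A & isPzAlgebra K A}.

HB.instance Definition _ (K : pzRingType) (A : pzAlgType K) :=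
  GRing.isZmodMorphism.Build K A scal scal_zmod.
HB.instance Definition _ (K : pzRingType) (A : pzAlgType K) :=
  GRing.isMonoidMorphism.Build K A scal scal_monoid.

Section QuotientModule.
Variables (R : pzRingType) (M : lmodType R) (G : M -> Prop).

(* The submodule generated by the set G. *)
Inductive spanned : M -> Prop :=
| spanned0 : spanned 0
| spannedG x of G x : spanned x
| spannedD x y of spanned x & spanned y : spanned (x + y)
| spannedZ a x of spanned x : spanned (a *: x).

Definition in_span (x : M) : bool := `[< spanned x >].

Fact in_span_zmod_closed : zmod_closed in_span.
Proof.
split=> [|x y]; first by apply/asboolP; exact: spanned0.
rewrite !unfold_in => /asboolP sx /asboolP sy; apply/asboolP.
by apply: spannedD => //; rewrite -scaleN1r; exact: spannedZ.
Qed.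
HB.instance Definition _ := GRing.isZmodClosed.Build M in_span
  in_span_zmod_closed.
Definition span_closed : zmodClosed M := GRing.ZmodClosed.clone M in_span _.

Definition qmod : Type := Quotient.quot span_closed.
HB.instance Definition _ := GRing.Zmodule.copy qmod (Quotient.quot span_closed).
Definition qmod_pi : M -> qmod := \pi_(Quotient.quot span_closed)%qT.

Fact qmod_pi_zmod : zmod_morphism qmod_pi.
Proof. by move=> x y; rewrite /qmod_pi -raddfB. Qed.
HB.instance Definition _ := GRing.isZmodMorphism.Build M qmod qmod_pi
  qmod_pi_zmod.

Lemma qmod_eqP x y : reflect (qmod_pi x = qmod_pi y) `[< spanned (x - y) >].
Proof.
have -> : `[< spanned (x - y) >] = (x - y \in span_closed) by [].
by rewrite Quotient.idealrBE; exact: eqP.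
Qed.

Definition qmod_repr (u : qmod) : M := repr (u : Quotient.quot span_closed).
Lemma qmod_reprK : cancel qmod_repr qmod_pi. Proof. exact: reprK. Qed.

Lemma qmod_pi_surj u : exists x, qmod_pi x = u.
Proof. by exists (qmod_repr u); rewrite qmod_reprK. Qed.

Definition qmod_scale (a : R) (u : qmod) : qmod := qmod_pi (a *: qmod_repr u).

Lemma qmod_scale_pi a x : qmod_scale a (qmod_pi x) = qmod_pi (a *: x).
Proof.
apply/qmod_eqP/asboolP; rewrite -scalerBr; apply: spannedZ.
by apply/asboolP/qmod_eqP; rewrite qmod_reprK.
Qed.

Fact qmod_scalerA a b u : qmod_scale a (qmod_scale b u) = qmod_scale (a * b) u.
Proof. by case: (qmod_pi_surj u) => x <-; rewrite !qmod_scale_pi scalerA. Qed.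
Fact qmod_scale1r : left_id 1 qmod_scale.
Proof. by move=> u; case: (qmod_pi_surj u) => x <-; rewrite qmod_scale_pi scale1r. Qed.
Fact qmod_scalerDr : right_distributive qmod_scale +%R.
Proof.
move=> a u v; case: (qmod_pi_surj u) (qmod_pi_surj v) => x <- [y <-].
by rewrite -raddfD !qmod_scale_pi -raddfD scalerDr.
Qed.
Fact qmod_scalerDl u : {morph qmod_scale^~ u : a b / a + b}.
Proof.
move=> a b; case: (qmod_pi_surj u) => x <-.
by rewrite !qmod_scale_pi -raddfD scalerDl.
Qed.
HB.instance Definition _ := GRing.Zmodule_isLmodule.Build R qmod
  qmod_scalerA qmod_scale1r qmod_scalerDr qmod_scalerDl.

Fact qmod_pi_scalable : scalable qmod_pi.
Proof. by move=> a x; rewrite -qmod_scale_pi. Qed.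
HB.instance Definition _ := GRing.isScalable.Build R M qmod *:%R qmod_pi
  qmod_pi_scalable.

End QuotientModule.

Section QuotientAlgebra.
Variables (K : pzRingType) (A : pzAlgType K) (G : A -> Prop).

(* The two-sided ideal generated by the set G. *)
Inductive ideal_gen : A -> Prop :=
| ideal_gen0 : ideal_gen 0
| ideal_genG x of G x : ideal_gen x
| ideal_genD x y of ideal_gen x & ideal_gen y : ideal_gen (x + y)
| ideal_genM a x b of ideal_gen x : ideal_gen (a * x * b).

Definition in_ideal (x : A) : bool := `[< ideal_gen x >].

Fact in_ideal_zmod_closed : zmod_closed in_ideal.
Proof.
split=> [|x y]; first by apply/asboolP; exact: ideal_gen0.
rewrite !unfold_in => /asboolP sx /asboolP sy; apply/asboolP.
apply: ideal_genD => //; rewrite -[y]mulr1 -mulN1r mulrA; exact: ideal_genM.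
Qed.
HB.instance Definition _ := GRing.isZmodClosed.Build A in_ideal
  in_ideal_zmod_closed.
Definition ideal_closed : zmodClosed A := GRing.ZmodClosed.clone A in_ideal _.

Definition qalg : Type := Quotient.quot ideal_closed.
HB.instance Definition _ := GRing.Zmodule.copy qalg (Quotient.quot ideal_closed).
Definition qalg_pi : A -> qalg := \pi_(Quotient.quot ideal_closed)%qT.

Fact qalg_pi_zmod : zmod_morphism qalg_pi.
Proof. by move=> x y; rewrite /qalg_pi -raddfB. Qed.
HB.instance Definition _ := GRing.isZmodMorphism.Build A qalg qalg_pi
  qalg_pi_zmod.

Lemma qalg_eqP x y : reflect (qalg_pi x = qalg_pi y) `[< ideal_gen (x - y) >].
Proof.
have -> : `[< ideal_gen (x - y) >] = (x - y \in ideal_closed) by [].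
by rewrite Quotient.idealrBE; exact: eqP.
Qed.

Definition qalg_repr (u : qalg) : A := repr (u : Quotient.quot ideal_closed).
Lemma qalg_reprK : cancel qalg_repr qalg_pi. Proof. exact: reprK. Qed.

Lemma qalg_pi_surj u : exists x, qalg_pi x = u.
Proof. by exists (qalg_repr u); rewrite qalg_reprK. Qed.

Lemma qalg_reprP x : ideal_gen (qalg_repr (qalg_pi x) - x).
Proof. by apply/asboolP/qalg_eqP; rewrite qalg_reprK. Qed.

Definition qalg_mul (u v : qalg) : qalg := qalg_pi (qalg_repr u * qalg_repr v).

Lemma qalg_mul_pi x y : qalg_mul (qalg_pi x) (qalg_pi y) = qalg_pi (x * y).
Proof.
apply/qalg_eqP/asboolP; set x' := qalg_repr _; set y' := qalg_repr _.
have -> : x' * y' - x * y = 1 * (x' - x) * y' + x * (y' - y) * 1.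
  by rewrite mul1r mulr1 mulrBl mulrBr addrA subrK.
by apply: ideal_genD; apply/ideal_genM/qalg_reprP.
Qed.

Fact qalg_mulA : associative qalg_mul.
Proof.
move=> u v w; case: (qalg_pi_surj u) (qalg_pi_surj v) (qalg_pi_surj w).
by move=> x <- [y <-] [z <-]; rewrite !qalg_mul_pi mulrA.
Qed.
Fact qalg_mul1r : left_id (qalg_pi 1) qalg_mul.
Proof. by move=> u; case: (qalg_pi_surj u) => x <-; rewrite qalg_mul_pi mul1r. Qed.
Fact qalg_mulr1 : right_id (qalg_pi 1) qalg_mul.
Proof. by move=> u; case: (qalg_pi_surj u) => x <-; rewrite qalg_mul_pi mulr1. Qed.
Fact qalg_mulDl : left_distributive qalg_mul +%R.
Proof.
move=> u v w; case: (qalg_pi_surj u) (qalg_pi_surj v) (qalg_pi_surj w).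
by move=> x <- [y <-] [z <-]; rewrite -raddfD !qalg_mul_pi -raddfD mulrDl.
Qed.
Fact qalg_mulDr : right_distributive qalg_mul +%R.
Proof.
move=> u v w; case: (qalg_pi_surj u) (qalg_pi_surj v) (qalg_pi_surj w).
by move=> x <- [y <-] [z <-]; rewrite -raddfD !qalg_mul_pi -raddfD mulrDr.
Qed.
HB.instance Definition _ := GRing.Zmodule_isPzRing.Build qalg
  qalg_mulA qalg_mul1r qalg_mulr1 qalg_mulDl qalg_mulDr.

Fact qalg_pi_monoid : monoid_morphism qalg_pi.
Proof. by split=> // x y; rewrite -qalg_mul_pi. Qed.
HB.instance Definition _ := GRing.isMonoidMorphism.Build A qalg qalg_pi
  qalg_pi_monoid.

Fact qalg_scal_zmod : zmod_morphism (fun c : K => qalg_pi (scal c)).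
Proof. by move=> c d; rewrite !raddfB. Qed.
Fact qalg_scal_monoid : monoid_morphism (fun c : K => qalg_pi (scal c)).
Proof. by split=> [|c d]; rewrite ?rmorph1 // !rmorphM. Qed.
Fact qalg_scal_comm (c : K) (u : qalg) :
  qalg_pi (scal c) * u = u * qalg_pi (scal c).
Proof. by case: (qalg_pi_surj u) => x <-; rewrite -!rmorphM scal_comm. Qed.
HB.instance Definition _ := isPzAlgebra.Build K qalg
  qalg_scal_zmod qalg_scal_monoid qalg_scal_comm.

End QuotientAlgebra.

Section DirectSum.
Variables (R : pzRingType) (n : nat) (M : 'I_n -> lmodType R).

Definition dsum : Type := forall i, M i.
HB.instance Definition _ := Choice.copy dsum (forall i, M i).

Implicit Types x y z : dsum.
Definition dsum_zero : dsum := fun=> 0.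
Definition dsum_opp x : dsum := fun i => - x i.
Definition dsum_add x y : dsum := fun i => x i + y i.
Definition dsum_scale (a : R) x : dsum := fun i => a *: x i.

Fact dsum_addA : associative dsum_add.
Proof. by move=> x y z; apply: functional_extensionality_dep => i; rewrite /dsum_add addrA. Qed.
Fact dsum_addC : commutative dsum_add.
Proof. by move=> x y; apply: functional_extensionality_dep => i; rewrite /dsum_add addrC. Qed.
Fact dsum_add0 : left_id dsum_zero dsum_add.
Proof. by move=> x; apply: functional_extensionality_dep => i; rewrite /dsum_add add0r. Qed.
Fact dsum_addN : left_inverse dsum_zero dsum_opp dsum_add.
Proof. by move=> x; apply: functional_extensionality_dep => i; rewrite /dsum_add addNr. Qed.
HB.instance Definition _ := GRing.isZmodule.Build dsum
  dsum_addA dsum_addC dsum_add0 dsum_addN.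

Fact dsum_scalerA a b x : dsum_scale a (dsum_scale b x) = dsum_scale (a * b) x.
Proof. by apply: functional_extensionality_dep => i; rewrite /dsum_scale scalerA. Qed.
Fact dsum_scale1r : left_id 1 dsum_scale.
Proof. by move=> x; apply: functional_extensionality_dep => i; rewrite /dsum_scale scale1r. Qed.
Fact dsum_scalerDr : right_distributive dsum_scale +%R.
Proof. by move=> a x y; apply: functional_extensionality_dep => i; exact: scalerDr. Qed.
Fact dsum_scalerDl x : {morph dsum_scale^~ x : a b / a + b}.
Proof. by move=> a b; apply: functional_extensionality_dep => i; exact: scalerDl. Qed.
HB.instance Definition _ := GRing.Zmodule_isLmodule.Build R dsum
  dsum_scalerA dsum_scale1r dsum_scalerDr dsum_scalerDl.

(* The projection onto the i-th summand followed by its inclusion. *)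
Definition dsum_id (i : 'I_n) : dsum -> dsum :=
  fun x j => if j == i then x j else 0.

End DirectSum.

Section EndAlgebra.
Variables (K : pzRingType) (R : pzAlgType K) (M : lmodType R).

Record endalg := EndAlg {
  end_fun :> M -> M;
  _ : `[< linear end_fun >]
}.
HB.instance Definition _ := [isSub for end_fun].
HB.instance Definition _ := [Choice of endalg by <:].

Implicit Types f g h : endalg.

Lemma end_linear f : linear f.
Proof. by case: f => f /= /asboolP. Qed.
Lemma endP f g : f =1 g -> f = g.
Proof. by move=> fg; apply: val_inj; apply: funext. Qed.
Lemma endD f x y : f (x + y) = f x + f y.
Proof. by have := end_linear f 1 x y; rewrite !scale1r. Qed.
Lemma end0 f : f 0 = 0.
Proof. by apply: (addrI (f 0)); rewrite -endD !addr0. Qed.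
Lemma endZ f (a : R) x : f (a *: x) = a *: f x.
Proof. by have := end_linear f a x 0; rewrite end0 !addr0. Qed.
Lemma endN f x : f (- x) = - f x.
Proof. by rewrite -scaleN1r endZ scaleN1r. Qed.

Definition mkEnd (f : M -> M) (lf : linear f) : endalg := EndAlg (asboolT lf).

Fact end_zero_subproof : linear ((fun=> 0) : M -> M).
Proof. by move=> a x y; rewrite scaler0 addr0. Qed.
Fact end_opp_subproof f : linear ((fun x => - f x) : M -> M).
Proof. by move=> a x y; rewrite end_linear opprD scalerN. Qed.
Fact end_add_subproof f g : linear ((fun x => f x + g x) : M -> M).
Proof. by move=> a x y; rewrite !end_linear scalerDr addrACA. Qed.
Fact end_one_subproof : linear (id : M -> M). Proof. by []. Qed.
Fact end_mul_subproof f g : linear ((fun x => f (g x)) : M -> M).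
Proof. by move=> a x y; rewrite !end_linear. Qed.
Fact end_scal_subproof (c : K) : linear ((fun x => (scal c : R) *: x) : M -> M).
Proof. by move=> a x y; rewrite scalerDr !scalerA scal_comm. Qed.

Definition end_zero := mkEnd end_zero_subproof.
Definition end_opp f := mkEnd (end_opp_subproof f).
Definition end_add f g := mkEnd (end_add_subproof f g).
Definition end_one := mkEnd end_one_subproof.
Definition end_mul f g := mkEnd (end_mul_subproof f g).
Definition end_scal c := mkEnd (end_scal_subproof c).

Fact end_addA : associative end_add.
Proof. by move=> f g h; apply: endP => x /=; rewrite addrA. Qed.
Fact end_addC : commutative end_add.
Proof. by move=> f g; apply: endP => x /=; rewrite addrC. Qed.
Fact end_add0 : left_id end_zero end_add.
Proof. by move=> f; apply: endP => x /=; rewrite add0r. Qed.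
Fact end_addN : left_inverse end_zero end_opp end_add.
Proof. by move=> f; apply: endP => x /=; rewrite addNr. Qed.
HB.instance Definition _ := GRing.isZmodule.Build endalg
  end_addA end_addC end_add0 end_addN.

Fact end_mulA : associative end_mul.
Proof. by move=> f g h; apply: endP. Qed.
Fact end_mul1 : left_id end_one end_mul.
Proof. by move=> f; apply: endP. Qed.
Fact end_1mul : right_id end_one end_mul.
Proof. by move=> f; apply: endP. Qed.
Fact end_mulDl : left_distributive end_mul +%R.
Proof. by move=> f g h; apply: endP. Qed.
Fact end_mulDr : right_distributive end_mul +%R.
Proof. by move=> f g h; apply: endP => x /=; rewrite endD. Qed.
HB.instance Definition _ := GRing.Zmodule_isPzRing.Build endalg
  end_mulA end_mul1 end_1mul end_mulDl end_mulDr.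

Fact end_scal_zmod : zmod_morphism end_scal.
Proof. by move=> c d; apply: endP => x /=; rewrite raddfB scalerBl. Qed.
Fact end_scal_monoid : monoid_morphism end_scal.
Proof.
split=> [|c d]; apply: endP => x /=; first by rewrite rmorph1 scale1r.
by rewrite rmorphM scalerA.
Qed.
Fact end_scal_comm (c : K) f : end_scal c * f = f * end_scal c.
Proof. by apply: endP => x /=; rewrite endZ. Qed.
HB.instance Definition _ := isPzAlgebra.Build K endalg
  end_scal_zmod end_scal_monoid end_scal_comm.

End EndAlgebra.

Record quiver (n : nat) := Quiver {
  arrow : finType;
  src : arrow -> 'I_n;
  tgt : arrow -> 'I_n
}.

Section Paths.
Variables (n : nat) (Q : quiver n).
Implicit Types (i : 'I_n) (s : seq (arrow Q)).

(* A path is given by its starting vertex i and the sequence s of its arrows in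
   the order of traversal, i.e. [:: a_1; ...; a_m] stands for a_m ... a_1. *)
Fixpoint is_path i s : bool :=
  if s is a :: s' then (src a == i) && is_path (tgt a) s' else true.

Definition path_end i s : 'I_n := last i (map (@tgt n Q) s).

Lemma path_end_cat i s1 s2 : path_end i (s1 ++ s2) = path_end (path_end i s1) s2.
Proof. by rewrite /path_end map_cat last_cat. Qed.

Lemma is_path_cat i s1 s2 :
  is_path i (s1 ++ s2) = is_path i s1 && is_path (path_end i s1) s2.
Proof. by elim: s1 i => //= a s1 IH i; rewrite IH andbA. Qed.

End Paths.

Lemma big_triangle (V : nmodType) (N : nat) (F : nat -> nat -> V) :
  \sum_(k < N.+1) \sum_(l < (N - k).+1) F k l
  = \sum_(m < N.+1) \sum_(k < m.+1) F k (m - k)%N.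
Proof.
elim: N F => [|N IH] F; first by rewrite !big_ord1.
rewrite big_ord_recl subn0 /=.
under [in RHS]eq_bigr do rewrite big_ord_recl subn0 /=.
rewrite big_split /=; congr (_ + _).
rewrite [RHS]big_ord_recl big_ord0 add0r -(IH (fun k l => F k.+1 l)).
by apply: eq_bigr.
Qed.

Section PathAlgebra.
Variables (K : fieldType) (n : nat) (Q : quiver n).

(* A formal linear combination of paths, as its coefficient function; since Q
   has finitely many paths of each length, finite support means bounded length. *)
Definition path_comb (p : 'I_n -> seq (arrow Q) -> K) : Prop :=
  (forall i s, ~~ is_path i s -> p i s = 0) /\
  (exists N, forall i s, (N <= size s)%N -> p i s = 0).

Record pathalg := PathAlg {
  coef :> 'I_n -> seq (arrow Q) -> K;
  _ : `[< path_comb coef >]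
}.
HB.instance Definition _ := [isSub for coef].
HB.instance Definition _ := [Choice of pathalg by <:].

Implicit Types p q r : pathalg.
Implicit Types (i : 'I_n) (s : seq (arrow Q)).

Lemma pathalgP p : path_comb p. Proof. by case: p => p /= /asboolP. Qed.
Lemma coef_npath p i s : ~~ is_path i s -> p i s = 0.
Proof. by case: (pathalgP p) => + _; apply. Qed.
Lemma pathP p q : (forall i s, p i s = q i s) -> p = q.
Proof. by move=> pq; apply: val_inj; do 2![apply: funext => ?]; exact: pq. Qed.

Definition mkPath f (hf : path_comb f) : pathalg := PathAlg (asboolT hf).

Fact path_zero_subproof : path_comb (fun _ _ => 0).
Proof. by split=> //; exists 0. Qed.
Fact path_opp_subproof p : path_comb (fun i s => - p i s).
Proof.
case: (pathalgP p) => p0 [N pN].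
by split=> [i s /p0 ->|]; last exists N => i s /pN ->; rewrite oppr0.
Qed.
Fact path_add_subproof p q : path_comb (fun i s => p i s + q i s).
Proof.
case: (pathalgP p) (pathalgP q) => p0 [N pN] [q0 [N' qN]].
split=> [i s ns|]; first by rewrite p0 // q0 // addr0.
exists (maxn N N') => i s; rewrite geq_max => /andP[h h'].
by rewrite pN // qN // addr0.
Qed.
Fact path_scal_subproof (c : K) : path_comb (fun _ s => if s is [::] then c else 0).
Proof. by split=> [i []|]; last by exists 1%N => i []. Qed.

(* pq is "first q, then p": the first k arrows come from q, the others from p. *)
Fact path_mul_subproof p q : path_comb (fun i s =>
  \sum_(k < (size s).+1) p (path_end i (take k s)) (drop k s) * q i (take k s)).
Proof.
case: (pathalgP p) (pathalgP q) => p0 [N pN] [q0 [N' qN]]; split=> [i s|].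
  move=> ns; rewrite big1 // => k _.
  have [h|/q0 ->] := boolP (is_path i (take k s)); last by rewrite mulr0.
  rewrite p0 ?mul0r //; apply: contra ns => h'.
  by rewrite -[s](cat_take_drop k) is_path_cat h h'.
exists (N + N')%N => i s hs; rewrite big1 // => k _.
have hk : (k <= size s)%N by rewrite -ltnS.
have [h|h] := leqP N' k; first by rewrite qN ?mulr0 // size_takel.
rewrite pN ?mul0r // size_drop leq_subRL //; apply: leq_trans hs.
by rewrite addnC leq_add2l ltnW.
Qed.

Definition path_zero := mkPath path_zero_subproof.
Definition path_opp p := mkPath (path_opp_subproof p).
Definition path_add p q := mkPath (path_add_subproof p q).
Definition path_mul p q := mkPath (path_mul_subproof p q).
Definition path_scal c := mkPath (path_scal_subproof c).

Fact path_addA : associative path_add.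
Proof. by move=> p q r; apply: pathP => i s /=; rewrite addrA. Qed.
Fact path_addC : commutative path_add.
Proof. by move=> p q; apply: pathP => i s /=; rewrite addrC. Qed.
Fact path_add0 : left_id path_zero path_add.
Proof. by move=> p; apply: pathP => i s /=; rewrite add0r. Qed.
Fact path_addN : left_inverse path_zero path_opp path_add.
Proof. by move=> p; apply: pathP => i s /=; rewrite addNr. Qed.
HB.instance Definition _ := GRing.isZmodule.Build pathalg
  path_addA path_addC path_add0 path_addN.

Fact path_mulA : associative path_mul.
Proof.
move=> p q r; apply: pathP => i s /=; symmetry.
pose F k l := p (path_end i (take (k + l) s)) (drop (k + l) s)
  * q (path_end i (take k s)) (take l (drop k s)) * r i (take k s).
transitivity (\sum_(k < (size s).+1) \sum_(l < (size s - k).+1) F k l).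
  apply: eq_bigr => k _; rewrite size_drop mulr_suml; apply: eq_bigr => l _.
  by rewrite /F -path_end_cat -takeD drop_drop [(l + k)%N]addnC.
rewrite big_triangle; apply: eq_bigr => m _.
have hm : (m <= size s)%N by rewrite -ltnS.
rewrite size_takel // mulr_sumr; apply: eq_bigr => k _.
have hk : (k <= m)%N by rewrite -ltnS.
by rewrite /F subnKC // take_takel // mulrA take_drop subnK.
Qed.
Lemma path_scal_mul (c : K) p i s : path_mul (path_scal c) p i s = c * p i s.
Proof.
rewrite /= big_ord_recr /= drop_size take_size big1 ?add0r // => k _.
case E: (drop k s) => [|? ?]; last by rewrite mul0r.
by have := ltn_ord k; rewrite -subn_gt0 -size_drop E.
Qed.
Lemma path_mul_scal (c : K) p i s : path_mul p (path_scal c) i s = p i s * c.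
Proof.
rewrite /= big_ord_recl /= drop0 take0 big1 ?addr0 // => k _.
by case: s k => [|a s] k /=; [case: k | rewrite mulr0].
Qed.
Fact path_1mul : left_id (path_scal 1) path_mul.
Proof. by move=> p; apply: pathP => i s; rewrite path_scal_mul mul1r. Qed.
Fact path_mul1 : right_id (path_scal 1) path_mul.
Proof. by move=> p; apply: pathP => i s; rewrite path_mul_scal mulr1. Qed.
Fact path_mulDl : left_distributive path_mul +%R.
Proof.
move=> p q r; apply: pathP => i s /=; rewrite -big_split /=.
by apply: eq_bigr => k _; rewrite mulrDl.
Qed.
Fact path_mulDr : right_distributive path_mul +%R.
Proof.
move=> p q r; apply: pathP => i s /=; rewrite -big_split /=.
by apply: eq_bigr => k _; rewrite mulrDr.
Qed.
HB.instance Definition _ := GRing.Zmodule_isPzRing.Build pathalg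
  path_mulA path_1mul path_mul1 path_mulDl path_mulDr.

Fact path_scal_zmod : zmod_morphism path_scal.
Proof. by move=> c d; apply: pathP => i [|a s] /=; rewrite ?subr0. Qed.
Fact path_scal_monoid : monoid_morphism path_scal.
Proof.
split=> // c d; apply: pathP => i s.
by rewrite [RHS]path_scal_mul; case: s => //= a s; rewrite mulr0.
Qed.
Fact path_scal_comm c p : path_scal c * p = p * path_scal c.
Proof.
by apply: pathP => i s; rewrite [LHS]path_scal_mul [RHS]path_mul_scal mulrC.
Qed.
HB.instance Definition _ := isPzAlgebra.Build K pathalg
  path_scal_zmod path_scal_monoid path_scal_comm.

Fact path_vertex_subproof (i : 'I_n) :
  path_comb (fun j s => ((j == i) && (s == [::]))%:R).
Proof.
split=> [j [|a s]|] //=; first by rewrite andbF.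
by exists 1%N => j [|a s] //; rewrite andbF.
Qed.
Definition path_vertex i : pathalg := mkPath (path_vertex_subproof i).

Fact path_arrow_subproof (a : arrow Q) :
  path_comb (fun i s => ((i == src a) && (s == [:: a]))%:R).
Proof.
split=> [i s|]; last by exists 2%N => i [|b [|c s]] // _; rewrite eqseq_cons andbF andbF.
by have [->|//] := eqVneq i (src a); have [->|//] := eqVneq s [:: a]; rewrite /= eqxx.
Qed.
Definition path_arrow a : pathalg := mkPath (path_arrow_subproof a).

(* The m-th power of the arrow ideal: combinations of paths of length >= m. *)
Definition arrow_ideal_pow (m : nat) p : Prop :=
  forall i s, (size s < m)%N -> p i s = 0.

(* Combinations of paths whose total weight is k, for given arrow weights w. *)
Definition path_homog (w : arrow Q -> nat) (k : nat) p : Prop :=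
  forall i s, p i s != 0 -> \sum_(a <- s) w a = k.

End PathAlgebra.

Record bound_quiver (K : fieldType) (n : nat) := BoundQuiver {
  bq_quiver :> quiver n;
  bq_rel : pathalg K bq_quiver -> Prop
}.

Arguments bq_rel {K n} b p.

Section BoundQuiverAlgebra.
Variables (K : fieldType) (n : nat) (B : bound_quiver K n).

Definition bq_alg : pzAlgType K := qalg (bq_rel B).

Definition bq_vertex (i : 'I_n) : bq_alg := qalg_pi (bq_rel B) (path_vertex K B i).
Definition bq_arrow (a : arrow B) : bq_alg := qalg_pi (bq_rel B) (path_arrow K a).

Definition bq_homog (w : arrow B -> nat) (k : nat) (x : bq_alg) : Prop :=
  exists2 p : pathalg K B, path_homog w k p & x = qalg_pi (bq_rel B) p.

Definition admissible : Prop :=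
  (forall p, ideal_gen (bq_rel B) p -> arrow_ideal_pow 2 p) /\
  (exists2 m, (2 <= m)%N &
    forall p, arrow_ideal_pow m p -> ideal_gen (bq_rel B) p).

(* No relation involves a trivial path; holds for admissible ideals. *)
Definition rel_in_arrow_ideal : Prop :=
  forall p, ideal_gen (bq_rel B) p -> arrow_ideal_pow 1 p.

(* The quiver is finite since its arrows form a finType. *)
Definition directed : Prop :=
  (forall a : arrow B, (src a < tgt a)%N) /\ admissible.

End BoundQuiverAlgebra.

Section Opposite.
Variables (K : fieldType) (n : nat).

Definition op_quiver (Q : quiver n) : quiver n :=
  @Quiver n (arrow Q) (@tgt n Q) (@src n Q).

Fact path_op_subproof (Q : quiver n) (p : pathalg K Q) :
  @path_comb K n (op_quiver Q) (fun i s =>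
    if @is_path n (op_quiver Q) i s
    then p (@path_end n (op_quiver Q) i s) (rev s) else 0).
Proof.
split=> [i s /negbTE -> //|]; case: (pathalgP p) => _ [N pN].
by exists N => i s hs; case: ifP => // _; rewrite pN // size_rev.
Qed.
(* The linear map KQ -> K(Q^op) sending each path to the reversed path. *)
Definition path_op (Q : quiver n) (p : pathalg K Q) : pathalg K (op_quiver Q) :=
  mkPath (path_op_subproof p).

Definition op_bq (A : bound_quiver K n) : bound_quiver K n :=
  @BoundQuiver K n (op_quiver A) (fun r => exists2 p, bq_rel A p & r = path_op p).

End Opposite.

Section DualExtension.
Variables (K : fieldType) (n : nat).

Definition sum_quiver (Q Q' : quiver n) : quiver n :=
  @Quiver n (arrow Q + arrow Q')%type
    (fun a => match a with inl b => src b | inr b => src b end)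
    (fun a => match a with inl b => tgt b | inr b => tgt b end).

Section Embeddings.
Variables Q Q' : quiver n.
Local Notation E := (sum_quiver Q Q').

Definition lefts : seq (arrow E) -> seq (arrow Q) :=
  pmap (fun a => if a is inl b then Some b else None).
Definition rights : seq (arrow E) -> seq (arrow Q') :=
  pmap (fun a => if a is inr b then Some b else None).

Lemma is_path_inl i s : @is_path n E i (map inl s) = is_path i s.
Proof. by elim: s i => //= a s IH i; rewrite IH. Qed.
Lemma is_path_inr i s : @is_path n E i (map inr s) = is_path i s.
Proof. by elim: s i => //= a s IH i; rewrite IH. Qed.

Fact path_inl_subproof (p : pathalg K Q) : @path_comb K n E (fun i s =>
  if s == map inl (lefts s) then p i (lefts s) else 0).
Proof.
split=> [i s|].
  by case: eqP => // -> ; rewrite is_path_inl => h; rewrite -(coef_npath p h);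
     congr (p i _); elim: (lefts s) => //= a t ->.
case: (pathalgP p) => _ [N pN]; exists N => i s.
by case: eqP => // {1}->; rewrite size_map => /pN ->.
Qed.
(* The maps KQ -> KE and KQ' -> KE extending paths of Q, Q' to paths of E. *)
Definition path_inl (p : pathalg K Q) : pathalg K E :=
  mkPath (path_inl_subproof p).

Fact path_inr_subproof (p : pathalg K Q') : @path_comb K n E (fun i s =>
  if s == map inr (rights s) then p i (rights s) else 0).
Proof.
split=> [i s|].
  by case: eqP => // -> ; rewrite is_path_inr => h; rewrite -(coef_npath p h);
     congr (p i _); elim: (rights s) => //= a t ->.
case: (pathalgP p) => _ [N pN]; exists N => i s.
by case: eqP => // {1}->; rewrite size_map => /pN ->.
Qed.
Definition path_inr (p : pathalg K Q') : pathalg K E :=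
  mkPath (path_inr_subproof p).

End Embeddings.

(* The mixed relation is "first b, then a", with b an arrow of A, a one of B. *)
Inductive dual_ext_rel (B A : bound_quiver K n) :
  pathalg K (sum_quiver B A) -> Prop :=
| dual_ext_rel_inl p of bq_rel B p : dual_ext_rel (path_inl A p)
| dual_ext_rel_inr p of bq_rel A p : dual_ext_rel (path_inr B p)
| dual_ext_rel_mix (a : arrow B) (b : arrow A) :
    dual_ext_rel (path_arrow K (inl a : arrow (sum_quiver B A))
                  * path_arrow K (inr b : arrow (sum_quiver B A))).

Definition dual_ext (B A : bound_quiver K n) : bound_quiver K n :=
  @BoundQuiver K n (sum_quiver B A) (@dual_ext_rel B A).

(* The weights of B are kept and the arrows of A get weight 0. *)
Definition dual_ext_weight (B A : bound_quiver K n) (w : arrow B -> nat) :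
    arrow (dual_ext B A) -> nat :=
  fun a => if a is inl b then w b else 0%N.

End DualExtension.
Arguments dual_ext_weight {K n} B A w.

Section LeftIdeal.
Variables (R : pzRingType) (e : R).

(* The left module Re. *)
Definition in_lideal : pred R^o := fun x => (x : R) * e == x.
Record lideal := LIdeal { lideal_val :> R^o; _ : in_lideal lideal_val }.
HB.instance Definition _ := [isSub for lideal_val].
HB.instance Definition _ := [Choice of lideal by <:].

Fact in_lideal_submod_closed : submod_closed in_lideal.
Proof.
split=> [|a x y]; first by rewrite unfold_in /in_lideal mul0r.
rewrite !unfold_in /in_lideal => /eqP hx /eqP hy.
by rewrite mulrDl hy -mulrA hx.
Qed.
HB.instance Definition _ := GRing.isSubmodClosed.Build R R^o in_lideal
  in_lideal_submod_closed.
HB.instance Definition _ := [SubChoice_isSubLmodule of lideal by <:].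
End LeftIdeal.

Section Modules.
Variables (K : fieldType) (n : nat) (B : bound_quiver K n).
Local Notation Lam := (bq_alg B).

Definition proj_mod (i : 'I_n) : lmodType Lam := lideal (bq_vertex B i).

(* L(i) = P(i) / rad P(i), the radical being generated by the arrows. *)
Definition simple_gen (i : 'I_n) (y : proj_mod i) : Prop :=
  exists (a : arrow B) (x : proj_mod i), y = bq_arrow a *: x.
Definition simple_mod (i : 'I_n) : lmodType Lam := qmod (@simple_gen i).

(* D(i) = P(i) / (sum of the images of all maps P(j) -> P(i), j > i). *)
Definition trace_gen (i : 'I_n) (y : proj_mod i) : Prop :=
  exists2 j : 'I_n, (i < j)%N &
    exists (f : {linear proj_mod j -> proj_mod i}) (x : proj_mod j), y = f x.
Definition standard_mod (i : 'I_n) : lmodType Lam := qmod (@trace_gen i).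

Definition simple_sum : lmodType Lam := dsum simple_mod.
Definition standard_sum : lmodType Lam := dsum standard_mod.
End Modules.

Definition projective (R : pzRingType) (P : lmodType R) : Prop :=
  forall (U V : lmodType R) (g : {linear U -> V}) (f : {linear P -> V}),
  (forall v, exists u, g u = v) ->
  exists h : {linear P -> U}, forall x, g (h x) = f x.

Record proj_resolution (R : pzRingType) (M : lmodType R) := ProjResolution {
  res_mod :> nat -> lmodType R;
  res_d : forall k, {linear res_mod k.+1 -> res_mod k};
  res_aug : {linear res_mod 0%N -> M};
  res_proj : forall k, projective (res_mod k);
  res_aug_surj : forall y, exists x, res_aug x = y;
  res_exact0 : forall x, res_aug x = 0 <-> exists y, x = res_d 0 y;
  res_exact : forall k x, res_d k x = 0 <-> exists y, x = res_d k.+1 y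
}.

Section ChainEndomorphisms.
Variables (K : pzRingType) (R : pzAlgType K) (M : lmodType R).
Variable P : proj_resolution M.

(* Finite sums of chain maps P -> P[k], k >= 0: the component f i j : P_i -> P_j
   is the one of degree i - j.  Commutation with the differential is unsigned. *)
Definition is_chain_end (f : forall i j, P i -> P j) : Prop :=
  [/\ forall i j, linear (f i j),
      forall i j x, (i < j)%N -> f i j x = 0,
      exists N, forall i j x, (j + N < i)%N -> f i j x = 0
    & forall i j x, res_d P j (f i.+1 j.+1 x) = f i j (res_d P i x)].

Record chain_end := ChainEnd {
  chain_fun :> forall i j, P i -> P j;
  _ : `[< is_chain_end chain_fun >]
}.
HB.instance Definition _ := [isSub for chain_fun].
HB.instance Definition _ := [Choice of chain_end by <:].

Implicit Types f g h : chain_end.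

Lemma chain_endP f : is_chain_end f. Proof. by case: f => f /= /asboolP. Qed.
Lemma chain_linear f i j : linear (f i j). Proof. by case: (chain_endP f). Qed.
Lemma chain_lt f i j x : (i < j)%N -> f i j x = 0.
Proof. by case: (chain_endP f) => _ + _ _; apply. Qed.
Lemma chain_comm f i j x : res_d P j (f i.+1 j.+1 x) = f i j (res_d P i x).
Proof. by case: (chain_endP f). Qed.
Lemma chain_eqP f g : (forall i j x, f i j x = g i j x) -> f = g.
Proof.
move=> fg; apply: val_inj; do 2![apply: functional_extensionality_dep => ?].
by apply: funext => x; exact: fg.
Qed.
Lemma chainD f i j x y : f i j (x + y) = f i j x + f i j y.
Proof. by have := @chain_linear f i j 1 x y; rewrite !scale1r. Qed.
Lemma chain0 f i j : f i j 0 = 0.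
Proof. by apply: (addrI (f i j 0)); rewrite -chainD !addr0. Qed.
Lemma chainZ f i j (a : R) x : f i j (a *: x) = a *: f i j x.
Proof. by have := @chain_linear f i j a x 0; rewrite chain0 !addr0. Qed.
Lemma chain_sum f i j (I : Type) (r : seq I) (A : pred I) (F : I -> P i) :
  f i j (\sum_(k <- r | A k) F k) = \sum_(k <- r | A k) f i j (F k).
Proof. by apply: (big_morph (f i j)); [exact: chainD | exact: chain0]. Qed.

Definition mkChain (u : forall i j, P i -> P j) (hu : is_chain_end u) : chain_end :=
  ChainEnd (asboolT hu).

Fact chain_zero_subproof : is_chain_end (fun _ _ _ => 0).
Proof.
split=> [i j a x y| | |i j x] //; rewrite ?scaler0 ?addr0 ?raddf0 //.
by exists 0%N.
Qed.
Fact chain_opp_subproof f : is_chain_end (fun i j x => - f i j x).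
Proof.
case: (chain_endP f) => lf tf [N Nf] cf; split.
- by move=> i j a x y; rewrite lf opprD scalerN.
- by move=> i j x /tf ->; rewrite oppr0.
- by exists N => i j x /Nf ->; rewrite oppr0.
by move=> i j x; rewrite linearN cf.
Qed.
Fact chain_add_subproof f g : is_chain_end (fun i j x => f i j x + g i j x).
Proof.
case: (chain_endP f) (chain_endP g) => lf tf [N Nf] cf [lg tg [N' Ng] cg]; split.
- by move=> i j a x y; rewrite lf lg scalerDr addrACA.
- by move=> i j x h; rewrite tf // tg // addr0.
- exists (maxn N N') => i j x h; rewrite Nf ?Ng ?addr0 //; apply: leq_ltn_trans h.
    by rewrite leq_add2l leq_maxr.
  by rewrite leq_add2l leq_maxl.
by move=> i j x; rewrite linearD cf cg.
Qed.

(* The matrix c * identity; the match transports along i = j. *)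
Definition chain_scal_fun (c : K) i j (x : P i) : P j :=
  if @eqP _ i j is ReflectT e then eq_rect i (fun k => P k : Type) ((scal c : R) *: x) j e else 0.

Lemma chain_scal_funE c i (x : P i) :
  @chain_scal_fun c i i x = (scal c : R) *: x.
Proof.
rewrite /chain_scal_fun; case: eqP => // e.
by rewrite (eq_irrelevance e (erefl i)).
Qed.
Lemma chain_scal_fun_neq c i j (x : P i) : i != j -> @chain_scal_fun c i j x = 0.
Proof. by rewrite /chain_scal_fun; case: eqP. Qed.

Fact chain_scal_subproof c : is_chain_end (chain_scal_fun c).
Proof.
split.
- move=> i j a x y; have [<-|ij] := eqVneq i j; last first.
    by rewrite !chain_scal_fun_neq // scaler0 addr0.
  by rewrite !chain_scal_funE scalerDr !scalerA scal_comm.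
- by move=> i j x; rewrite ltn_neqAle => /andP[ij _]; exact: chain_scal_fun_neq.
- exists 0%N => i j x; rewrite addn0 ltn_neqAle eq_sym => /andP[ij _].
  exact: chain_scal_fun_neq.
move=> i j x; have [<-|ij] := eqVneq i j; first by rewrite !chain_scal_funE linearZ.
by rewrite !chain_scal_fun_neq ?raddf0.
Qed.

Fact chain_mul_subproof f g :
  is_chain_end (fun i l x => \sum_(j < i.+1) f j l (g i j x)).
Proof.
case: (chain_endP f) (chain_endP g) => lf tf [N Nf] cf [lg tg [N' Ng] cg]; split.
- move=> i l a x y; rewrite scaler_sumr -big_split /=.
  by apply: eq_bigr => j _; rewrite lg lf.
- by move=> i l x il; rewrite big1 // => j _; rewrite tf //; apply: leq_trans il.
- exists (N + N')%N => i l x h; rewrite big1 // => j _.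
  have [jl|jl] := ltnP (l + N) j; first by rewrite Nf.
  rewrite Ng ?chain0 //; apply: leq_ltn_trans h.
  by rewrite addnA leq_add2r.
move=> i l x; rewrite linear_sum big_ord_recl /= tf // raddf0 add0r.
by apply: eq_bigr => j _; rewrite /= cf cg.
Qed.

Definition chain_zero := mkChain chain_zero_subproof.
Definition chain_opp f := mkChain (chain_opp_subproof f).
Definition chain_add f g := mkChain (chain_add_subproof f g).
Definition chain_mul f g := mkChain (chain_mul_subproof f g).
Definition chain_scal c := mkChain (chain_scal_subproof c).

Fact chain_addA : associative chain_add.
Proof. by move=> f g h; apply: chain_eqP => i j x /=; rewrite addrA. Qed.
Fact chain_addC : commutative chain_add.
Proof. by move=> f g; apply: chain_eqP => i j x /=; rewrite addrC. Qed.
Fact chain_add0 : left_id chain_zero chain_add.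
Proof. by move=> f; apply: chain_eqP => i j x /=; rewrite add0r. Qed.
Fact chain_addN : left_inverse chain_zero chain_opp chain_add.
Proof. by move=> f; apply: chain_eqP => i j x /=; rewrite addNr. Qed.
HB.instance Definition _ := GRing.isZmodule.Build chain_end
  chain_addA chain_addC chain_add0 chain_addN.

Fact chain_mulA : associative chain_mul.
Proof.
move=> f g h; apply: chain_eqP => i l x /=.
under eq_bigr do rewrite chain_sum.
rewrite exchange_big /=; apply: eq_bigr => m _.
rewrite [RHS](big_ord_widen i.+1 (fun j => f j l (g m j (h i m x)))) //.
rewrite [RHS]big_mkcond /=; apply: eq_bigr => j _.
by case: ifP => // /negbT; rewrite -leqNgt => mj; rewrite (chain_lt g) ?chain0.
Qed.
Lemma chain_scal_mul c f i l x :
  chain_mul (chain_scal c) f i l x = (scal c : R) *: f i l x.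
Proof.
rewrite /=; have [li|il] := leqP l i; last first.
  rewrite chain_lt // scaler0 big1 // => j _.
  by rewrite chain_scal_fun_neq // ltn_eqF // (leq_trans (ltn_ord j)).
rewrite (bigD1 (Ordinal (li : (l < i.+1)%N))) //= chain_scal_funE big1 ?addr0 //.
by move=> j jl; rewrite chain_scal_fun_neq.
Qed.
Lemma chain_mul_scal c f i l x :
  chain_mul f (chain_scal c) i l x = (scal c : R) *: f i l x.
Proof.
rewrite /= big_ord_recr /= chain_scal_funE chainZ big1 ?add0r // => j _.
by rewrite chain_scal_fun_neq ?chain0 // gtn_eqF.
Qed.
Fact chain_1mul : left_id (chain_scal 1) chain_mul.
Proof. by move=> f; apply: chain_eqP => i j x; rewrite chain_scal_mul rmorph1 scale1r. Qed.
Fact chain_mul1 : right_id (chain_scal 1) chain_mul.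
Proof. by move=> f; apply: chain_eqP => i j x; rewrite chain_mul_scal rmorph1 scale1r. Qed.
Fact chain_mulDl : left_distributive chain_mul +%R.
Proof. by move=> f g h; apply: chain_eqP => i l x; rewrite /= -big_split. Qed.
Fact chain_mulDr : right_distributive chain_mul +%R.
Proof.
move=> f g h; apply: chain_eqP => i l x; rewrite /= -big_split /=.
by apply: eq_bigr => j _; rewrite chainD.
Qed.
HB.instance Definition _ := GRing.Zmodule_isPzRing.Build chain_end
  chain_mulA chain_1mul chain_mul1 chain_mulDl chain_mulDr.

Fact chain_scal_zmod : zmod_morphism chain_scal.
Proof.
move=> c d; apply: chain_eqP => i j x /=; have [<-|ij] := eqVneq i j.
  by rewrite !chain_scal_funE raddfB scalerBl.
by rewrite !chain_scal_fun_neq // subr0.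
Qed.
Fact chain_scal_monoid : monoid_morphism chain_scal.
Proof.
split=> // c d; apply: chain_eqP => i j x; rewrite [RHS]chain_scal_mul /=.
have [<-|ij] := eqVneq i j; first by rewrite !chain_scal_funE rmorphM scalerA.
by rewrite !chain_scal_fun_neq // scaler0.
Qed.
Fact chain_scal_comm c f : chain_scal c * f = f * chain_scal c.
Proof. by apply: chain_eqP => i j x; rewrite [LHS]chain_scal_mul [RHS]chain_mul_scal. Qed.
HB.instance Definition _ := isPzAlgebra.Build K chain_end
  chain_scal_zmod chain_scal_monoid chain_scal_comm.

(* These already form an ideal; h may have components of every degree. *)
Definition null_homotopic (f : chain_end) : Prop :=
  exists2 h : forall i j, P i -> P j, (forall i j, linear (h i j)) &
  (forall j x, f 0%N j x = res_d P j (h 0%N j.+1 x)) /\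
  (forall i j x, f i.+1 j x = res_d P j (h i.+1 j.+1 x) + h i j (res_d P i x)).

(* Ext_R^*(M, M) computed from P.  In degree k, the class of f corresponds to
   the class of the cocycle aug o f k 0 : P_k -> M, and composition of chain
   maps is the Yoneda product, fg being "first g, then f". *)
Definition ext_alg : pzAlgType K := qalg null_homotopic.

Definition ext_homog (k : nat) (x : ext_alg) : Prop :=
  exists2 f : chain_end, (forall i j y, i != (j + k)%N -> f i j y = 0)
  & x = qalg_pi null_homotopic f.

(* x is the element of Ext^0(M, M) = Hom(M, M) given by the endomorphism u. *)
Definition ext_of_hom (u : M -> M) (x : ext_alg) : Prop :=
  exists f : chain_end,
  [/\ forall i j y, i != j -> f i j y = 0,
      forall y, res_aug P (f 0%N 0%N y) = u (res_aug P y)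
    & x = qalg_pi null_homotopic f].

End ChainEndomorphisms.
Arguments ext_alg {K R M} P.
Arguments ext_homog {K R M} P k x.
Arguments ext_of_hom {K R M} P u x.

Section AlgebraIsomorphisms.
Variables (K : pzRingType) (A B : pzAlgType K).

Definition alg_iso (f : {rmorphism A -> B}) : Prop :=
  bijective f /\ forall c : K, f (scal c) = scal c.

Definition graded_iso (grA : nat -> A -> Prop) (grB : nat -> B -> Prop)
    (f : {rmorphism A -> B}) : Prop :=
  alg_iso f /\ forall k x, grA k x <-> grB k (f x).

End AlgebraIsomorphisms.

(* Main.v *)
From HB Require Import structures.
From mathcomp Require Import all_boot all_algebra.
From mathcomp Require Import boolp.
Require Import Defs.
Set Implicit Arguments.
Unset Strict Implicit.
Unset Printing Implicit Defensive.
Import GRing.Theory.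
Local Open Scope ring_scope.

(** Write D for the opposite of A, S for the semisimple algebra spanned by the
    vertices, J for the arrow ideal of D, and (x) for the tensor product.

    The mixed relations kill every path of Lambda in which an arrow of B comes
    after an arrow of D.  Hence Lambda = D (x)_S B, and induction from B to
    Lambda is the exact functor M |-> D (x)_S M.  The arrows of B ascend and
    those of D descend, so the trace of the later projectives in P(i) is
    generated by the arrows of B, and Delta is D with the arrows of B acting
    by zero: it is the module induced from L ([delta_to_indK],
    [ind_to_deltaK]).  A projective resolution T of L therefore induces one of
    Delta ([ind_resolution]), which gives Shapiro's isomorphism between
    Ext_Lambda(Delta, Delta) and Ext_B(L, Delta) ([shapiro]).

    Over B, the module Delta is semisimple, with one summand L(j) for each
    element x ending at j of a basis of D made of paths.  The inclusion of that
    summand is iota : L -> Delta followed by an endomorphism u_x of Delta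
    ([delta_split], [delta_proj_basis]).  So each class in Ext(Delta, Delta) is
    in a unique way a sum over x of products u_x I(c_x), where I is the map
    Ext_B(L, L) -> Ext_Lambda(Delta, Delta) given by induction and c_x ends at
    the vertex j ([ext_class_decomposition], [h_inj]).

    Both I and the map J : End(Delta) -> Ext(Delta, Delta) are morphisms of
    algebras ([transfer_ex], [hom_ext_ex]).  A radical endomorphism of Delta,
    followed by a class of positive degree, gives zero, since a radical
    endomorphism factors through a projective module
    ([pos_degree_after_radical]).  These are exactly the defining relations of
    the dual extension of Ext_B(L, L) by End(Delta), so I and J induce a
    morphism h from it ([dual_ext_rmorph_ex]).  The dual extension is spanned
    by the products of an element of End(Delta) with one of Ext_B(L, L)
    ([dual_ext_ind]), so the unique decomposition above says that h is
    bijective.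

    For the second isomorphism, an endomorphism of Delta = D is right
    multiplication by an element of D, which identifies End(Delta) with the
    opposite of D, that is with A ([end_of_A_ex]).  The dual extension depends
    only on the algebras and their vertices, not on the presentation by arrows
    ([dual_ext_iso]). *)


(** * Path algebras *)

Definition kalg_morph (K : pzRingType) (A B : pzAlgType K) (f : A -> B) :=
  forall c, f (scal c) = scal c.

Section ScalarMap.
Variables (K : pzRingType) (A : pzAlgType K).
Implicit Types c d : K.
Lemma scalM c d : scal (c * d) = scal c * scal d :> A.
Proof. exact: rmorphM. Qed.
Lemma scalD c d : scal (c + d) = scal c + scal d :> A.
Proof. exact: rmorphD. Qed.
Lemma scalB c d : scal (c - d) = scal c - scal d :> A.
Proof. exact: rmorphB. Qed.
Lemma scal0 : scal (0 : K) = 0 :> A.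
Proof. exact: rmorph0. Qed.
Lemma scal1 : scal (1 : K) = 1 :> A.
Proof. exact: rmorph1. Qed.
Lemma scalN1 : scal (- 1 : K) = - 1 :> A.
Proof. exact: rmorphN1. Qed.
End ScalarMap.

Arguments coef : simpl never.

Section PathElements.
Variables (K : fieldType) (n : nat) (Q : quiver n).
Implicit Types (p q : pathalg K Q) (i j : 'I_n) (s t : seq (arrow Q)).

Fact path_elt_subproof i s :
  path_comb (fun j t => [&& is_path i s, j == i & t == s]%:R : K).
Proof.
split=> [j t|]; last first.
  exists (size s).+1 => j t st; rewrite [t == s](_ : _ = false) ?andbF //.
  by apply/eqP => ts; move: st; rewrite ts ltnn.
by case: and3P => // -[h /eqP-> /eqP->]; rewrite h.
Qed.
Definition path_elt i s : pathalg K Q := mkPath (path_elt_subproof i s).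

Lemma coef_elt i s j t :
  path_elt i s j t = [&& is_path i s, j == i & t == s]%:R.
Proof. by []. Qed.

Lemma coef_scal (c : K) p i s : (scal c * p) i s = c * p i s.
Proof. exact: path_scal_mul. Qed.

Lemma coef_vertex i j s :
  path_vertex K Q i j s = ((j == i) && (s == [::]))%:R.
Proof. by []. Qed.

Lemma coef1 i s : (1 : pathalg K Q) i s = (s == [::])%:R.
Proof. by case: s. Qed.

Lemma coef_sum I (r : seq I) P (F : I -> pathalg K Q) i s :
  (\sum_(k <- r | P k) F k) i s = \sum_(k <- r | P k) F k i s.
Proof. by elim/big_rec2: _ => // k x y _ <-. Qed.

Lemma path_elt0 i s : ~~ is_path i s -> path_elt i s = 0.
Proof. by move=> /negbTE h; apply: pathP => j t; rewrite coef_elt h. Qed.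

Lemma path_elt_nil i : path_elt i [::] = path_vertex K Q i.
Proof. by apply: pathP. Qed.

Lemma path_elt_arrow a : path_elt (src a) [:: a] = path_arrow K a.
Proof. by apply: pathP => i s; rewrite coef_elt /= eqxx. Qed.

Lemma path_eltM j t i s :
  path_elt j t * path_elt i s
  = if path_end i s == j then path_elt i (s ++ t) else 0.
Proof.
apply: pathP => k u.
rewrite [LHS](_ : _ = \sum_(m < (size u).+1)
   path_elt j t (path_end k (take m u)) (drop m u) * path_elt i s k (take m u)) //.
under eq_bigr do rewrite !coef_elt.
case: (eqVneq (path_end i s) j) => [ej|ej]; last first.
  rewrite [RHS](_ : _ = 0) // big1 // => m _.
  case: and3P => [[_ /eqP e1 _]|]; last by rewrite mul0r.
  case: and3P => [[_ /eqP e2 /eqP e3]|]; last by rewrite mulr0.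
  by move: ej; rewrite -e1 e2 e3 eqxx.
rewrite coef_elt is_path_cat ej.
case: and3P => [[/andP[pi pj] /eqP-> /eqP->]|h].
  have sz : (size s < (size (s ++ t)).+1)%N by rewrite ltnS size_cat leq_addr.
  rewrite (bigD1 (Ordinal sz)) //= big1 ?addr0.
    by rewrite take_size_cat // drop_size_cat // ej !eqxx pi pj mulr1.
  move=> m /eqP hm; case: and3P => [_|]; last by rewrite mul0r.
  case: and3P => [[_ _ /eqP e]|]; last by rewrite mulr0.
  case: hm; apply: val_inj => /=; rewrite -[LHS](@size_takel m _ (s ++ t)) ?e //.
  by rewrite -ltnS.
rewrite big1 // => m _.
case: and3P => [[pj _ /eqP e1]|]; last by rewrite mul0r.
case: and3P => [[pi e2 /eqP e3]|]; last by rewrite mulr0.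
by case: h; split=> //; rewrite ?pi ?pj // -e1 -e3 cat_take_drop.
Qed.

Lemma path_bounded p : exists N, forall i s, (N <= size s)%N -> p i s = 0.
Proof. by case: (pathalgP p). Qed.

Lemma path_expand p N : (forall i s, (N <= size s)%N -> p i s = 0) ->
  p = \sum_i \sum_(m < N) \sum_(t : m.-tuple (arrow Q))
        scal (p i t) * path_elt i t.
Proof.
move=> pN; apply: pathP => j s; rewrite coef_sum (bigD1 j) //= [X in _ + X]big1 ?addr0.
  rewrite coef_sum; have [sN|/pN p0] := ltnP (size s) N; last first.
    rewrite p0 big1 // => m _; rewrite coef_sum big1 // => t _.
    rewrite coef_scal coef_elt; case: and3P => [[_ _ /eqP e]|]; rewrite ?mulr0 //.
    by rewrite -e p0 mul0r.
  rewrite (bigD1 (Ordinal sN)) //= [X in _ + X]big1 ?addr0.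
    rewrite coef_sum (bigD1 (in_tuple s)) //= [X in _ + X]big1 ?addr0.
      rewrite coef_scal coef_elt !eqxx; case: (boolP (is_path j s)) => h.
        by rewrite mulr1.
      by rewrite mulr0 coef_npath.
    move=> t /eqP ht; rewrite coef_scal coef_elt; case: and3P => [[_ _ /eqP e]|].
      by case: ht; apply: val_inj; exact: esym e.
    by rewrite mulr0.
  move=> m /eqP hm; rewrite coef_sum big1 // => t _.
  rewrite coef_scal coef_elt; case: and3P => [[_ _ /eqP e]|]; rewrite ?mulr0 //.
  by case: hm; apply: val_inj; rewrite /= e size_tuple.
move=> i /negbTE ij; rewrite coef_sum big1 // => m _; rewrite coef_sum big1 // => t _.
by rewrite coef_scal coef_elt eq_sym ij andbF mulr0.
Qed.

(** Only the paths that occur in p are visited, with their coefficients, so the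
    step may use what is known of p, for instance that it is homogeneous. *)
Lemma path_span_ind (Pr : pathalg K Q -> Prop) :
  Pr 0 -> (forall p q, Pr p -> Pr q -> Pr (p + q)) ->
  forall p, (forall i s, is_path i s -> p i s != 0 ->
              Pr (scal (p i s) * path_elt i s)) -> Pr p.
Proof.
move=> P0 PD p Pp; have [N /path_expand ->] := path_bounded p.
do 3![apply: (big_ind Pr) => // ? _].
set i := (X in Pr (_ * path_elt X _)); set s := tval _.
have [h|h] := boolP (is_path i s); last by rewrite path_elt0 // mulr0.
by have [->|nz] := eqVneq (p i s) 0; [rewrite raddf0 mul0r | exact: Pp].
Qed.

Lemma path_elt_rcons i s a :
  is_path i (rcons s a) -> path_elt i (rcons s a) = path_arrow K a * path_elt i s.
Proof.
rewrite -cats1 is_path_cat /= andbT => /andP[_ /eqP sa].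
by rewrite -path_elt_arrow path_eltM sa eqxx.
Qed.

Lemma path_alg_ind (Pr : pathalg K Q -> Prop) :
  Pr 0 -> (forall p q, Pr p -> Pr q -> Pr (p + q)) ->
  (forall c p, Pr p -> Pr (scal c * p)) ->
  (forall i, Pr (path_vertex K Q i)) ->
  (forall a p, Pr p -> Pr (path_arrow K a * p)) -> forall p, Pr p.
Proof.
move=> P0 PD PZ Pv Pa p; apply: path_span_ind => // i s hs _; apply: PZ.
elim/last_ind: s hs => [|s a IH] hs; first by rewrite path_elt_nil.
rewrite path_elt_rcons //; apply/Pa/IH.
by move: hs; rewrite -cats1 is_path_cat => /andP[].
Qed.

Lemma path_vertexM i j :
  path_vertex K Q i * path_vertex K Q j = if i == j then path_vertex K Q i else 0.
Proof. by rewrite -!path_elt_nil path_eltM eq_sym; case: eqP => [->|]. Qed.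

Lemma path_vertex_arrow i a :
  path_vertex K Q i * path_arrow K a = if i == tgt a then path_arrow K a else 0.
Proof. by rewrite -path_elt_nil -path_elt_arrow path_eltM eq_sym. Qed.

Lemma path_arrow_vertex i a :
  path_arrow K a * path_vertex K Q i = if i == src a then path_arrow K a else 0.
Proof.
by rewrite -path_elt_nil -path_elt_arrow path_eltM /path_end /=; case: eqP => // ->.
Qed.

Lemma path_vertex_sum : \sum_i path_vertex K Q i = 1.
Proof.
apply: pathP => i s; rewrite coef_sum coef1 (bigD1 i) //= big1 => [|j /negbTE ji].
  by rewrite addr0 coef_vertex eqxx.
by rewrite coef_vertex eq_sym ji.
Qed.

(** Both sides are bilinear, so it is enough to compare them on paths. *)
Lemma path_mul_morph (R : pzAlgType K) (f : pathalg K Q -> R) :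
  {morph f : p q / p + q} -> (forall c p, f (scal c * p) = scal c * f p) ->
  (forall i s j t, is_path i s -> is_path j t ->
    f (path_elt i s * path_elt j t) = f (path_elt i s) * f (path_elt j t)) ->
  {morph f : p q / p * q}.
Proof.
move=> fD fZ fM p q.
have f0 : f 0 = 0 by apply: (addrI (f 0)); rewrite -fD !addr0.
apply: (@path_span_ind (fun p => f (p * q) = f p * f q)) => [|{}p p' IH IH'|i s hs _].
- by rewrite mul0r f0 mul0r.
- by rewrite mulrDl !fD mulrDl IH IH'.
rewrite -mulrA !fZ -mulrA; congr (_ * _).
apply: (@path_span_ind (fun q => f (path_elt i s * q) = f (path_elt i s) * f q))
  => [|{}q q' IH IH'|j t ht _].
- by rewrite mulr0 f0 mulr0.
- by rewrite mulrDr !fD mulrDr IH IH'.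
by rewrite mulrA -scal_comm -mulrA !fZ mulrA -scal_comm -mulrA fM.
Qed.

End PathElements.

(** * The universal property of a path algebra *)

Section PathUniversal.
Variables (K : fieldType) (n : nat) (Q : quiver n) (R : pzAlgType K).
Variables (e : 'I_n -> R) (x : arrow Q -> R).
Implicit Types (p q : pathalg K Q) (i j : 'I_n) (s t : seq (arrow Q)).
Hypothesis e_orth : forall i j, e i * e j = if i == j then e i else 0.
Hypothesis e_sum : \sum_i e i = 1.
Hypothesis xl : forall a, e (tgt a) * x a = x a.
Hypothesis xr : forall a, x a * e (src a) = x a.

Fixpoint path_ev i s : R :=
  if s is a :: s' then path_ev (tgt a) s' * x a else e i.

Lemma path_ev_r i s : is_path i s -> path_ev i s * e i = path_ev i s.
Proof.
by case: s => [|a s] /=; rewrite ?e_orth ?eqxx // => /andP[/eqP <- _]; rewrite -mulrA xr.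
Qed.

Lemma path_ev_l i s : e (path_end i s) * path_ev i s = path_ev i s.
Proof.
elim: s i => [|a s IH] i /=; first by rewrite /path_end /= e_orth eqxx.
by rewrite mulrA /path_end /= IH.
Qed.

Lemma path_evM j t i s : is_path i s -> is_path j t ->
  path_ev j t * path_ev i s = if path_end i s == j then path_ev i (s ++ t) else 0.
Proof.
move=> hs ht; case: eqP => [<-{j}|/eqP ej] in ht *; last first.
  rewrite -(path_ev_r ht) -(path_ev_l i s) mulrA -[_ * e j * _]mulrA e_orth.
  by rewrite eq_sym (negbTE ej) mulr0 mul0r.
elim: s i hs ht => [|a s IH] i /=; first by move=> _; rewrite /path_end /= => /path_ev_r.
by case/andP=> _ hs ht; rewrite mulrA IH.
Qed.

Definition path_sum N p : R :=
  \sum_i \sum_(m < N) \sum_(t : m.-tuple (arrow Q)) scal (p i t) * path_ev i t.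

Lemma path_sum_widen N M p : (N <= M)%N ->
  (forall i s, (N <= size s)%N -> p i s = 0) -> path_sum N p = path_sum M p.
Proof.
move=> NM pN; apply: eq_bigr => i _.
rewrite (big_ord_widen M (fun m => \sum_(t : m.-tuple (arrow Q)) scal (p i t) * path_ev i t)) //.
rewrite [RHS](bigID (fun m : 'I_M => (m < N)%N)) /= [X in _ = _ + X]big1 ?addr0 // => m.
rewrite -leqNgt => Nm; rewrite big1 // => t _.
by rewrite pN ?raddf0 ?mul0r // size_tuple.
Qed.

Definition path_bound p := projT1 (cid (path_bounded p)).

Definition path_eval p := path_sum (path_bound p) p.

(** The sum does not depend on the truncation length, which makes it additive:
    two elements can be truncated at a common length. *)
Lemma path_evalE N p :
  (forall i s, (N <= size s)%N -> p i s = 0) -> path_eval p = path_sum N p.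
Proof.
move=> pN; rewrite /path_eval /path_bound; case: cid => M pM /=.
rewrite (path_sum_widen (leq_maxl M N)) // (path_sum_widen (leq_maxr M N)) //.
Qed.

Lemma path_evalD p q : path_eval (p + q) = path_eval p + path_eval q.
Proof.
have [N pN] := path_bounded p; have [M qM] := path_bounded q.
have pN' i s : (maxn N M <= size s)%N -> p i s = 0.
  by rewrite geq_max => /andP[/pN].
have qM' i s : (maxn N M <= size s)%N -> q i s = 0.
  by rewrite geq_max => /andP[_ /qM].
rewrite !(@path_evalE (maxn N M)) // => [|i s h]; last first.
  by rewrite [LHS](_ : _ = p i s + q i s) // pN' ?qM' ?addr0.
rewrite -big_split; apply: eq_bigr => i _; rewrite -big_split; apply: eq_bigr => m _.
rewrite -big_split; apply: eq_bigr => t _ /=.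
by rewrite [LHS](_ : _ = scal (p i t + q i t) * path_ev i t) // raddfD mulrDl.
Qed.

Lemma path_evalZ c p : path_eval (scal c * p) = scal c * path_eval p.
Proof.
have [N pN] := path_bounded p.
rewrite !(@path_evalE N) // => [|i s h]; last by rewrite coef_scal pN ?mulr0.
do 3![rewrite mulr_sumr; apply: eq_bigr => ? _].
by rewrite coef_scal rmorphM mulrA.
Qed.

Lemma path_eval_elt i s : is_path i s -> path_eval (path_elt K i s) = path_ev i s.
Proof.
move=> h; rewrite (@path_evalE (size s).+1) => [|j t st]; last first.
  by rewrite coef_elt; case: and3P => // -[_ _ /eqP e1]; rewrite e1 ltnn in st.
rewrite /path_sum (bigD1 i) //= [X in _ + X]big1 ?addr0; last first.
  by move=> j /negbTE ij; do 2!rewrite big1 // => ? _; rewrite coef_elt ij andbF raddf0 mul0r.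
rewrite big_ord_recr /= big1 ?add0r; last first.
  move=> m _; rewrite big1 // => t _; rewrite coef_elt; case: and3P => [[_ _ /eqP e1]|].
    by have := ltn_ord m; rewrite -[X in (X < _)%N](size_tuple t) e1 ltnn.
  by rewrite raddf0 mul0r.
rewrite (bigD1 (in_tuple s)) //= [X in _ + X]big1 ?addr0.
  by rewrite coef_elt h !eqxx rmorph1 mul1r.
move=> t /eqP ht; rewrite coef_elt; case: and3P => [[_ _ /eqP e1]|].
  by case: ht; apply: val_inj.
by rewrite raddf0 mul0r.
Qed.

Lemma path_eval0 : path_eval 0 = 0.
Proof. by apply: (addrI (path_eval 0)); rewrite -path_evalD !addr0. Qed.

Lemma path_evalM p q : path_eval (p * q) = path_eval p * path_eval q.
Proof.
apply: path_mul_morph => [||j t i s ht hs]; [exact: path_evalD | exact: path_evalZ |].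
rewrite !path_eval_elt // path_evM // path_eltM; case: eqP => [E|_]; last first.
  exact: path_eval0.
by rewrite path_eval_elt // is_path_cat hs E.
Qed.

Lemma path_rmorph_ex : exists F : {rmorphism pathalg K Q -> R},
  [/\ kalg_morph F, forall i, F (path_vertex K Q i) = e i
    & forall a, F (path_arrow K a) = x a].
Proof.
have Fv i : path_eval (path_vertex K Q i) = e i.
  by rewrite -path_elt_nil path_eval_elt.
have F1 : path_eval 1 = 1.
  rewrite -path_vertex_sum -e_sum (big_morph _ path_evalD path_eval0).
  by apply: eq_bigr.
have FB : zmod_morphism path_eval.
  move=> p q; apply: (addIr (path_eval q)); rewrite subrK -path_evalD subrK //.
have FM : monoid_morphism path_eval by split=> // p q; exact: path_evalM.
pose mB := GRing.isZmodMorphism.Build _ _ path_eval FB.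
pose mM := GRing.isMonoidMorphism.Build _ _ path_eval FM.
pose F : {rmorphism pathalg K Q -> R} := HB.pack path_eval mB mM.
exists F; split=> [c|//|a] /=; last by rewrite -path_elt_arrow path_eval_elt /= ?eqxx ?xl.
by rewrite -[scal c]mulr1 path_evalZ F1 mulr1.
Qed.

End PathUniversal.

Lemma path_rmorph_eq (K : fieldType) n (Q : quiver n) (R : pzAlgType K)
    (F G : {rmorphism pathalg K Q -> R}) :
  kalg_morph F -> kalg_morph G ->
  (forall i, F (path_vertex K Q i) = G (path_vertex K Q i)) ->
  (forall a, F (path_arrow K a) = G (path_arrow K a)) -> F =1 G.
Proof.
move=> Fs Gs FGv FGa; elim/path_alg_ind => [|p q Ep Eq|c p Ep|//|a p Ep].
- by rewrite !raddf0.
- by rewrite !rmorphD Ep Eq.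
- by rewrite !rmorphM Fs Gs Ep.
by rewrite !rmorphM FGa Ep.
Qed.


(** * Algebras of bound quivers *)

Section QuotientAlgebraMaps.
Variables (K : pzRingType) (A : pzAlgType K) (G : A -> Prop).

Lemma qalg_pi_eq0 x : qalg_pi G x = 0 <-> ideal_gen G x.
Proof.
rewrite -[0](raddf0 (qalg_pi G)); split.
  by move/qalg_eqP/asboolP; rewrite subr0.
by move=> h; apply/qalg_eqP/asboolP; rewrite subr0.
Qed.

Lemma qalg_piD x y : qalg_pi G (x + y) = qalg_pi G x + qalg_pi G y.
Proof. exact: raddfD. Qed.

Lemma qalg_piM x y : qalg_pi G (x * y) = qalg_pi G x * qalg_pi G y.
Proof. exact: rmorphM. Qed.

Lemma qalg_pi_sum I (r : seq I) P (F : I -> A) :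
  qalg_pi G (\sum_(k <- r | P k) F k) = \sum_(k <- r | P k) qalg_pi G (F k).
Proof. exact: raddf_sum. Qed.

Lemma ideal_gen_rmorph (R : pzRingType) (F : {rmorphism A -> R}) :
  (forall x, G x -> F x = 0) -> forall x, ideal_gen G x -> F x = 0.
Proof.
move=> FG x; elim=> {x} [|//|x y _ Fx _ Fy|a x b _ Fx]; first exact: rmorph0.
  by rewrite rmorphD Fx Fy addr0.
by rewrite !rmorphM Fx mulr0 mul0r.
Qed.

Lemma qalg_rmorph_ex (R : pzRingType) (F : {rmorphism A -> R}) :
  (forall x, G x -> F x = 0) ->
  exists F' : {rmorphism qalg G -> R}, forall x, F' (qalg_pi G x) = F x.
Proof.
move=> FG; pose f (u : qalg G) := F (qalg_repr u).
have fE x : f (qalg_pi G x) = F x.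
  apply/eqP; rewrite -subr_eq0 -rmorphB; apply/eqP.
  by apply: (ideal_gen_rmorph FG); exact: qalg_reprP.
have fB : zmod_morphism f.
  move=> u v; case: (qalg_pi_surj u) (qalg_pi_surj v) => x <- [y <-].
  by rewrite -raddfB !fE rmorphB.
have fM : monoid_morphism f.
  split; first by rewrite -(rmorph1 (qalg_pi G)) fE rmorph1.
  move=> u v; case: (qalg_pi_surj u) (qalg_pi_surj v) => x <- [y <-].
  by rewrite -rmorphM !fE rmorphM.
pose mB := GRing.isZmodMorphism.Build _ _ f fB.
pose mM := GRing.isMonoidMorphism.Build _ _ f fM.
by exists (HB.pack f mB mM : {rmorphism qalg G -> R}).
Qed.

End QuotientAlgebraMaps.

Section BoundQuiverBasics.
Variables (K : fieldType) (n : nat) (B : bound_quiver K n).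
Local Notation pi := (qalg_pi (bq_rel B)).

Lemma bq_scal c : scal c = pi (scal c) :> bq_alg B. Proof. by []. Qed.

Lemma bq_vertexM i j :
  bq_vertex B i * bq_vertex B j = if i == j then bq_vertex B i else 0.
Proof. by rewrite -rmorphM path_vertexM; case: ifP; rewrite ?raddf0. Qed.

Lemma bq_vertex_sum : \sum_i bq_vertex B i = 1.
Proof. by rewrite -(rmorph1 pi) -path_vertex_sum rmorph_sum. Qed.

Lemma bq_vertex_arrow i (a : arrow B) :
  bq_vertex B i * bq_arrow a = if i == tgt a then bq_arrow a else 0.
Proof. by rewrite -rmorphM path_vertex_arrow; case: ifP; rewrite ?raddf0. Qed.

Lemma bq_arrow_vertex i (a : arrow B) :
  bq_arrow a * bq_vertex B i = if i == src a then bq_arrow a else 0.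
Proof. by rewrite -rmorphM path_arrow_vertex; case: ifP; rewrite ?raddf0. Qed.

Lemma bq_alg_ind (Pr : bq_alg B -> Prop) :
  Pr 0 -> (forall p q, Pr p -> Pr q -> Pr (p + q)) ->
  (forall c p, Pr p -> Pr (scal c * p)) ->
  (forall i, Pr (bq_vertex B i)) ->
  (forall a p, Pr p -> Pr (bq_arrow a * p)) -> forall p, Pr p.
Proof.
move=> P0 PD PZ Pv Pa x; have [p <-] := qalg_pi_surj x; move: p => {x}.
apply: path_alg_ind => [|p q Ep Eq|c p Ep|i|a p Ep].
- by rewrite raddf0.
- by rewrite rmorphD; apply: PD.
- by rewrite rmorphM; apply: PZ.
- exact: Pv.
by rewrite rmorphM; apply: Pa.
Qed.

Lemma bq_rmorph_eq (R : pzAlgType K) (F G : {rmorphism bq_alg B -> R}) :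
  kalg_morph F -> kalg_morph G ->
  (forall i, F (bq_vertex B i) = G (bq_vertex B i)) ->
  (forall a, F (bq_arrow a) = G (bq_arrow a)) -> F =1 G.
Proof.
move=> Fs Gs FGv FGa; elim/bq_alg_ind => [|p q Ep Eq|c p Ep|//|a p Ep].
- by rewrite !rmorph0.
- by rewrite !rmorphD Ep Eq.
- by rewrite !rmorphM Fs Gs Ep.
by rewrite !rmorphM FGa Ep.
Qed.

End BoundQuiverBasics.

(** * Coefficients at the vertices *)

Section VertexCoefficients.
Variables (K : fieldType) (n : nat) (B : bound_quiver K n).
Local Notation pi := (qalg_pi (bq_rel B)).

(** The value at i of the quotient by the arrow ideal.  When no relation involves
    a trivial path it does not depend on the representative, and it is then a
    morphism of algebras to K. *)
Definition vcoef (i : 'I_n) (x : bq_alg B) : K := (qalg_repr x) i [::].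

Hypothesis arB : rel_in_arrow_ideal B.

Lemma vcoef_pi i p : vcoef i (pi p) = p i [::].
Proof.
have /arB /(_ i [::] isT) := qalg_reprP (bq_rel B) p.
by move/eqP; rewrite [_ == 0]subr_eq0 => /eqP.
Qed.

Lemma vcoefD i : {morph vcoef i : x y / x + y}.
Proof.
move=> x y; case: (qalg_pi_surj x) (qalg_pi_surj y) => p <- [q <-].
by rewrite -rmorphD !vcoef_pi.
Qed.

Lemma vcoefB i : {morph vcoef i : x y / x - y}.
Proof.
move=> x y; case: (qalg_pi_surj x) (qalg_pi_surj y) => p <- [q <-].
by rewrite -rmorphB !vcoef_pi.
Qed.

Lemma vcoefM i : {morph vcoef i : x y / x * y}.
Proof.
move=> x y; case: (qalg_pi_surj x) (qalg_pi_surj y) => p <- [q <-].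
by rewrite -rmorphM !vcoef_pi [LHS]big_ord1.
Qed.

Lemma vcoef_scal i c : vcoef i (scal c) = c.
Proof. by rewrite bq_scal vcoef_pi. Qed.

Lemma vcoef0 i : vcoef i 0 = 0.
Proof. by rewrite -(rmorph0 pi) vcoef_pi. Qed.

Lemma vcoef_vertex i j : vcoef i (bq_vertex B j) = (i == j)%:R.
Proof. by rewrite vcoef_pi coef_vertex andbT. Qed.

Lemma vcoef_arrow i a : vcoef i (bq_arrow a) = 0.
Proof. by rewrite vcoef_pi [LHS](_ : _ = ((i == src a) && ([::] == [:: a]))%:R) // andbF. Qed.

(** Such a vector spans a copy of the simple module at i, on which the algebra
    acts through its quotient by the arrow ideal. *)
Lemma act_killed (S : pzAlgType K) (th : {rmorphism bq_alg B -> S})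
    (U : lmodType S) (u : U) i :
  kalg_morph th -> (forall a, th (bq_arrow a) *: u = 0) ->
  th (bq_vertex B i) *: u = u ->
  forall b, th b *: u = (scal (vcoef i b) : S) *: u.
Proof.
move=> ths ua ui; elim/bq_alg_ind => [|p q Ep Eq|c p Ep|j|a p Ep].
- by rewrite vcoef0 !rmorph0.
- by rewrite vcoefD !rmorphD !scalerDl Ep Eq.
- by rewrite vcoefM vcoef_scal !rmorphM -scalerA Ep ths scalerA.
- rewrite vcoef_vertex -[in LHS]ui scalerA -rmorphM bq_vertexM eq_sym.
  by case: eqP => [<-|_]; rewrite ?ui ?rmorph1 ?rmorph0 ?scale1r ?scale0r.
by rewrite vcoefM vcoef_arrow mul0r rmorphM -scalerA Ep scalerA -scal_comm -scalerA ua
  scaler0 rmorph0 scale0r.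
Qed.

End VertexCoefficients.

(** * The two path algebras inside that of the joint quiver *)

Section PathEmbeddings.
Variables (K : fieldType) (n : nat) (Q Q' : quiver n).
Local Notation E := (sum_quiver Q Q').

Lemma lefts_inl s : @lefts n Q Q' (map inl s) = s.
Proof. by elim: s => //= a s ->. Qed.
Lemma rights_inr s : @rights n Q Q' (map inr s) = s.
Proof. by elim: s => //= a s ->. Qed.

Lemma path_inl_elt i s :
  path_inl Q' (path_elt K i s) = @path_elt K n E i (map inl s).
Proof.
apply: pathP => j t; rewrite [LHS](_ : _ = if t == map inl (lefts t)
  then path_elt K i s j (lefts t) else 0) //.
rewrite !coef_elt is_path_inl; case: eqP => [->|h].
  rewrite lefts_inl; congr (nat_of_bool [&& _, _ & _])%:R.
  by apply/eqP/eqP => [->//|/(congr1 (@lefts n Q Q'))]; rewrite !lefts_inl.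
by case: and3P => // -[_ _ /eqP e]; case: h; rewrite e lefts_inl.
Qed.

Lemma path_inr_elt i s :
  path_inr Q (path_elt K i s) = @path_elt K n E i (map inr s).
Proof.
apply: pathP => j t; rewrite [LHS](_ : _ = if t == map inr (rights t)
  then path_elt K i s j (rights t) else 0) //.
rewrite !coef_elt is_path_inr; case: eqP => [->|h].
  rewrite rights_inr; congr (nat_of_bool [&& _, _ & _])%:R.
  by apply/eqP/eqP => [->//|/(congr1 (@rights n Q Q'))]; rewrite !rights_inr.
by case: and3P => // -[_ _ /eqP e]; case: h; rewrite e rights_inr.
Qed.

Lemma path_end_inl i s : @path_end n E i (map inl s) = path_end i s.
Proof. by rewrite /path_end -map_comp. Qed.
Lemma path_end_inr i s : @path_end n E i (map inr s) = path_end i s.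
Proof. by rewrite /path_end -map_comp. Qed.

Fact path_inl_zmod : zmod_morphism (@path_inl K n Q Q').
Proof.
move=> p q; apply: pathP => i s; pose F (p : pathalg K Q) :=
  if s == map inl (lefts s) then p i (lefts s) else 0.
rewrite [LHS](_ : _ = F (p - q)) // [RHS](_ : _ = F p - F q) // /F.
by case: ifP; rewrite ?subr0.
Qed.
Fact path_inr_zmod : zmod_morphism (@path_inr K n Q Q').
Proof.
move=> p q; apply: pathP => i s; pose F (p : pathalg K Q') :=
  if s == map inr (rights s) then p i (rights s) else 0.
rewrite [LHS](_ : _ = F (p - q)) // [RHS](_ : _ = F p - F q) // /F.
by case: ifP; rewrite ?subr0.
Qed.
HB.instance Definition _ := GRing.isZmodMorphism.Build _ _ (@path_inl K n Q Q')
  path_inl_zmod.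
HB.instance Definition _ := GRing.isZmodMorphism.Build _ _ (@path_inr K n Q Q')
  path_inr_zmod.

Lemma path_inlZ c (p : pathalg K Q) : path_inl Q' (scal c * p) = scal c * path_inl Q' p.
Proof.
apply: pathP => i s; rewrite coef_scal.
rewrite [LHS](_ : _ = if s == map inl (lefts s) then (scal c * p) i (lefts s) else 0) //.
by rewrite coef_scal [in RHS]/coef /=; case: ifP; rewrite ?mulr0.
Qed.
Lemma path_inrZ c (p : pathalg K Q') : path_inr Q (scal c * p) = scal c * path_inr Q p.
Proof.
apply: pathP => i s; rewrite coef_scal.
rewrite [LHS](_ : _ = if s == map inr (rights s) then (scal c * p) i (rights s) else 0) //.
by rewrite coef_scal [in RHS]/coef /=; case: ifP; rewrite ?mulr0.
Qed.

Lemma path_inl_vertex i : path_inl Q' (path_vertex K Q i) = path_vertex K E i.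
Proof. by rewrite -path_elt_nil path_inl_elt -path_elt_nil. Qed.
Lemma path_inr_vertex i : path_inr Q (path_vertex K Q' i) = path_vertex K E i.
Proof. by rewrite -path_elt_nil path_inr_elt -path_elt_nil. Qed.
Lemma path_inl_arrow a : path_inl Q' (path_arrow K a) = path_arrow K (inl a : arrow E).
Proof. by rewrite -path_elt_arrow path_inl_elt -path_elt_arrow. Qed.
Lemma path_inr_arrow a : path_inr Q (path_arrow K a) = path_arrow K (inr a : arrow E).
Proof. by rewrite -path_elt_arrow path_inr_elt -path_elt_arrow. Qed.

Fact path_inl_monoid : monoid_morphism (@path_inl K n Q Q').
Proof.
split.
  rewrite -(path_vertex_sum K Q) raddf_sum -(path_vertex_sum K E).
  by apply: eq_bigr => i _; exact: path_inl_vertex.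
apply: path_mul_morph => [p q|c p|j t i s ht hs]; [exact: raddfD | exact: path_inlZ |].
rewrite !path_inl_elt !path_eltM path_end_inl; case: eqP => _; last exact: raddf0.
by rewrite path_inl_elt map_cat.
Qed.
Fact path_inr_monoid : monoid_morphism (@path_inr K n Q Q').
Proof.
split.
  rewrite -(path_vertex_sum K Q') raddf_sum -(path_vertex_sum K E).
  by apply: eq_bigr => i _; exact: path_inr_vertex.
apply: path_mul_morph => [p q|c p|j t i s ht hs]; [exact: raddfD | exact: path_inrZ |].
rewrite !path_inr_elt !path_eltM path_end_inr; case: eqP => _; last exact: raddf0.
by rewrite path_inr_elt map_cat.
Qed.
HB.instance Definition _ := GRing.isMonoidMorphism.Build _ _ (@path_inl K n Q Q')
  path_inl_monoid.
HB.instance Definition _ := GRing.isMonoidMorphism.Build _ _ (@path_inr K n Q Q')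
  path_inr_monoid.

Lemma path_inl_scal : kalg_morph (@path_inl K n Q Q').
Proof. by move=> c; rewrite -[scal c]mulr1 path_inlZ rmorph1 mulr1. Qed.
Lemma path_inr_scal : kalg_morph (@path_inr K n Q Q').
Proof. by move=> c; rewrite -[scal c]mulr1 path_inrZ rmorph1 mulr1. Qed.

End PathEmbeddings.


(** * Dual extension algebras *)

Section DualExtensionMaps.
Variables (K : fieldType) (n : nat) (B A : bound_quiver K n).
Local Notation BA := (dual_ext B A).
Local Notation pi := (qalg_pi (bq_rel BA)).

Definition bq_inl (x : bq_alg B) : bq_alg BA := pi (path_inl A (qalg_repr x)).
Definition bq_inr (x : bq_alg A) : bq_alg BA := pi (path_inr B (qalg_repr x)).

Lemma bq_inl_pi p : bq_inl (qalg_pi (bq_rel B) p) = pi (path_inl A p).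
Proof.
apply/eqP; rewrite -subr_eq0 -!rmorphB; apply/eqP.
pose F : {rmorphism _ -> _} := pi \o @path_inl K n B A.
apply: (ideal_gen_rmorph (F := F)) (qalg_reprP _ p) => q Bq /=.
by apply/qalg_pi_eq0/ideal_genG/dual_ext_rel_inl.
Qed.

Lemma bq_inr_pi p : bq_inr (qalg_pi (bq_rel A) p) = pi (path_inr B p).
Proof.
apply/eqP; rewrite -subr_eq0 -!rmorphB; apply/eqP.
pose F : {rmorphism _ -> _} := pi \o @path_inr K n B A.
apply: (ideal_gen_rmorph (F := F)) (qalg_reprP _ p) => q Bq /=.
by apply/qalg_pi_eq0/ideal_genG/dual_ext_rel_inr.
Qed.

Fact bq_inl_zmod : zmod_morphism bq_inl.
Proof.
move=> u v; case: (qalg_pi_surj u) (qalg_pi_surj v) => x <- [y <-].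
by rewrite -rmorphB !bq_inl_pi !rmorphB.
Qed.
Fact bq_inr_zmod : zmod_morphism bq_inr.
Proof.
move=> u v; case: (qalg_pi_surj u) (qalg_pi_surj v) => x <- [y <-].
by rewrite -rmorphB !bq_inr_pi !rmorphB.
Qed.
Fact bq_inl_monoid : monoid_morphism bq_inl.
Proof.
split; first by rewrite -(rmorph1 (qalg_pi (bq_rel B))) bq_inl_pi !rmorph1.
move=> u v; case: (qalg_pi_surj u) (qalg_pi_surj v) => x <- [y <-].
by rewrite -rmorphM !bq_inl_pi !rmorphM.
Qed.
Fact bq_inr_monoid : monoid_morphism bq_inr.
Proof.
split; first by rewrite -(rmorph1 (qalg_pi (bq_rel A))) bq_inr_pi !rmorph1.
move=> u v; case: (qalg_pi_surj u) (qalg_pi_surj v) => x <- [y <-].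
by rewrite -rmorphM !bq_inr_pi !rmorphM.
Qed.
HB.instance Definition _ := GRing.isZmodMorphism.Build _ _ bq_inl bq_inl_zmod.
HB.instance Definition _ := GRing.isMonoidMorphism.Build _ _ bq_inl bq_inl_monoid.
HB.instance Definition _ := GRing.isZmodMorphism.Build _ _ bq_inr bq_inr_zmod.
HB.instance Definition _ := GRing.isMonoidMorphism.Build _ _ bq_inr bq_inr_monoid.

Lemma bq_inlM x y : bq_inl (x * y) = bq_inl x * bq_inl y.
Proof. exact: rmorphM. Qed.
Lemma bq_inrM x y : bq_inr (x * y) = bq_inr x * bq_inr y.
Proof. exact: rmorphM. Qed.
Lemma bq_inr_sum J (r : seq J) P (F : J -> bq_alg A) :
  bq_inr (\sum_(k <- r | P k) F k) = \sum_(k <- r | P k) bq_inr (F k).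
Proof. exact: rmorph_sum. Qed.
Lemma bq_inl_scal : kalg_morph bq_inl.
Proof. by move=> c; rewrite bq_scal bq_inl_pi path_inl_scal. Qed.
Lemma bq_inr_scal : kalg_morph bq_inr.
Proof. by move=> c; rewrite bq_scal bq_inr_pi path_inr_scal. Qed.
Lemma bq_inl_vertex i : bq_inl (bq_vertex B i) = bq_vertex BA i.
Proof. by rewrite bq_inl_pi path_inl_vertex. Qed.
Lemma bq_inr_vertex i : bq_inr (bq_vertex A i) = bq_vertex BA i.
Proof. by rewrite bq_inr_pi path_inr_vertex. Qed.
Lemma bq_inl_arrow a : bq_inl (bq_arrow a) = bq_arrow (inl a : arrow BA).
Proof. by rewrite bq_inl_pi path_inl_arrow. Qed.
Lemma bq_inr_arrow a : bq_inr (bq_arrow a) = bq_arrow (inr a : arrow BA).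
Proof. by rewrite bq_inr_pi path_inr_arrow. Qed.

Lemma bq_inl_inr_arrow (a : arrow B) (b : arrow A) :
  bq_inl (bq_arrow a) * bq_inr (bq_arrow b) = 0.
Proof.
rewrite bq_inl_arrow bq_inr_arrow -rmorphM; apply/qalg_pi_eq0/ideal_genG.
exact: dual_ext_rel_mix.
Qed.

(** The universal property of the dual extension: the relations of B and of A
    hold because f and g factor through the two algebras, and the products in the
    last hypothesis are the images of the mixed relations. *)
Lemma dual_ext_rmorph_ex (R : pzAlgType K)
    (f : {rmorphism bq_alg B -> R}) (g : {rmorphism bq_alg A -> R}) :
  kalg_morph f -> kalg_morph g ->
  (forall i, f (bq_vertex B i) = g (bq_vertex A i)) ->
  (forall a b, f (bq_arrow a) * g (bq_arrow b) = 0) ->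
  exists h : {rmorphism bq_alg BA -> R},
    [/\ kalg_morph h, forall x, h (bq_inl x) = f x & forall x, h (bq_inr x) = g x].
Proof.
move=> fs gs fg fg0.
pose x (a : arrow BA) := match a with inl b => f (bq_arrow b) | inr b => g (bq_arrow b) end.
have [|||| F [Fs Fv Fa]] := @path_rmorph_ex K n BA R (fun i => f (bq_vertex B i)) x.
- by move=> i j; rewrite -rmorphM bq_vertexM; case: ifP; rewrite ?rmorph0.
- by rewrite -rmorph_sum bq_vertex_sum rmorph1.
- by case=> a /=; [|rewrite fg]; rewrite -rmorphM bq_vertex_arrow eqxx.
- by case=> a /=; [|rewrite fg]; rewrite -rmorphM bq_arrow_vertex eqxx.
pose Fl : {rmorphism _ -> _} := F \o @path_inl K n B A.
pose Fr : {rmorphism _ -> _} := F \o @path_inr K n B A.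
pose fl : {rmorphism _ -> _} := f \o qalg_pi (bq_rel B).
pose gr : {rmorphism _ -> _} := g \o qalg_pi (bq_rel A).
have FlE : Fl =1 fl.
  apply: path_rmorph_eq => [c|c|i|a] /=; rewrite ?path_inl_scal ?Fs ?fs //.
  - by rewrite path_inl_vertex Fv.
  - by rewrite path_inl_arrow Fa.
have FrE : Fr =1 gr.
  apply: path_rmorph_eq => [c|c|i|a] /=; rewrite ?path_inr_scal ?Fs ?gs //.
  - by rewrite path_inr_vertex Fv fg.
  - by rewrite path_inr_arrow Fa.
have [|h hE] := @qalg_rmorph_ex K _ (bq_rel BA) R F.
  move=> _ [p Bp|p Ap|a b].
  - by have := FlE p; rewrite /= => ->; rewrite (proj2 (qalg_pi_eq0 _ _)) ?rmorph0 //; exact: ideal_genG.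
  - by have := FrE p; rewrite /= => ->; rewrite (proj2 (qalg_pi_eq0 _ _)) ?rmorph0 //; exact: ideal_genG.
  by rewrite rmorphM !Fa fg0.
exists h; split=> [c|u|u].
- by rewrite bq_scal hE Fs.
- by have [p <-] := qalg_pi_surj u; rewrite bq_inl_pi hE; exact: FlE.
- by have [p <-] := qalg_pi_surj u; rewrite bq_inr_pi hE; exact: FrE.
Qed.

Lemma dual_ext_rmorph_eq (R : pzAlgType K) (F G : {rmorphism bq_alg BA -> R}) :
  kalg_morph F -> kalg_morph G ->
  (forall x, F (bq_inl x) = G (bq_inl x)) -> (forall x, F (bq_inr x) = G (bq_inr x)) ->
  F =1 G.
Proof.
move=> Fs Gs FGl FGr; apply: bq_rmorph_eq => // [i|[a|a]].
- by rewrite -bq_inl_vertex.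
- by rewrite -bq_inl_arrow.
- by rewrite -bq_inr_arrow.
Qed.

(** A path that returns from A to B contains a mixed relation; the others run
    first in B and then in A. *)
Lemma dual_ext_elt i (s : seq (arrow BA)) : is_path i s ->
  exists x y, pi (path_elt K i s) = bq_inr x * bq_inl y.
Proof.
(* The shape is refined so that it survives an arrow of B on the left: either
   no arrow of A has been used, or the last arrow is one of A. *)
pose good u := (exists y, u = bq_inl y) \/
  (exists b x y, u = bq_inr (bq_arrow b * x) * bq_inl y).
suff H : is_path i s -> good (pi (path_elt K i s)).
  move/H => [[y ->]|[b [x [y ->]]]]; last by exists (bq_arrow b * x), y.
  by exists 1, y; rewrite rmorph1 mul1r.
elim/last_ind: s => [|s a IH] hs.
  by left; exists (bq_vertex B i); rewrite path_elt_nil bq_inl_vertex.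
rewrite path_elt_rcons // rmorphM.
move: hs; rewrite -cats1 is_path_cat => /andP[/IH {}IH _].
change (good (bq_arrow a * pi (path_elt K i s))).
case: a => a; case: IH => [[y ->]|[b [x [y ->]]]].
- by left; exists (bq_arrow a * y); rewrite -bq_inl_arrow -rmorphM.
- left; exists 0; rewrite rmorph0 mulrA -bq_inl_arrow rmorphM mulrA.
  by rewrite bq_inl_inr_arrow !mul0r.
- by right; exists a, 1, y; rewrite mulr1 bq_inr_arrow.
right; exists a, (bq_arrow b * x), y; rewrite -bq_inr_arrow mulrA.
by congr (_ * _); rewrite [RHS]rmorphM.
Qed.

Lemma dual_ext_ind (Pr : bq_alg BA -> Prop) :
  Pr 0 -> (forall u v, Pr u -> Pr v -> Pr (u + v)) ->
  (forall x y, Pr (bq_inr x * bq_inl y)) -> forall u, Pr u.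
Proof.
move=> P0 PD PM u; have [p <-] := qalg_pi_surj u.
apply: (@path_span_ind _ _ _ (fun p => Pr (pi p))) => [|{}p q Pp Pq|i s hs _].
- by rewrite rmorph0.
- by rewrite rmorphD; exact: PD.
rewrite rmorphM; change (Pr (scal (p i s) * pi (path_elt K i s))).
have [x [y ->]] := dual_ext_elt hs.
by rewrite mulrA -bq_inr_scal -(rmorphM bq_inr).
Qed.

End DualExtensionMaps.
Arguments bq_inl {K n B} A x.
Arguments bq_inr {K n} B {A} x.

(** * Homogeneous elements *)

(** What a grading must satisfy for homogeneous elements to be carried along a
    morphism of algebras by looking at the generators only. *)
Record graded_pred (K : pzRingType) (R : pzAlgType K) (gr : nat -> R -> Prop) : Prop := GradedPred {
  gr0 : forall k, gr k 0;
  grD : forall k x y, gr k x -> gr k y -> gr k (x + y);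
  grZ : forall k c x, gr k x -> gr k (scal c * x);
  grM : forall k l x y, gr k x -> gr l y -> gr (k + l)%N (x * y)
}.

Section Homogeneous.
Variables (K : fieldType) (n : nat).

Variables (B : bound_quiver K n) (w : arrow B -> nat).
Local Notation pi := (qalg_pi (bq_rel B)).

Lemma bq_homog_graded : graded_pred (bq_homog w).
Proof.
split=> [k|k _ _ [p hp ->] [q hq ->]|k c _ [p hp ->]|k l _ _ [p hp ->] [q hq ->]].
- by exists 0; rewrite ?rmorph0 // => i s /eqP[].
- exists (p + q); rewrite ?rmorphD // => i s; rewrite [(p + q) i s](_ : _ = p i s + q i s) //.
  by have [->|/hp//] := eqVneq (p i s) 0; rewrite add0r => /hq.
- exists (scal c * p); rewrite ?rmorphM // => i s; rewrite coef_scal.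
  by have [->|/hp//] := eqVneq (p i s) 0; rewrite mulr0 eqxx.
exists (p * q); rewrite ?rmorphM // => i s nz; apply/eqP; apply: contraNT nz => /eqP ne.
rewrite [(p * q) i s](_ : _ = \sum_(k < (size s).+1)
  p (path_end i (take k s)) (drop k s) * q i (take k s)) //.
rewrite big1 // => m _; have [->|/hp ep] := eqVneq (p (path_end i (take m s)) (drop m s)) 0.
  by rewrite mul0r.
have [->|/hq eq] := eqVneq (q i (take m s)) 0; first by rewrite mulr0.
by case: ne; rewrite -[s](cat_take_drop m) big_cat /= ep eq addnC.
Qed.

Lemma bq_homog_vertex i : bq_homog w 0 (bq_vertex B i).
Proof.
exists (path_vertex K B i) => // j s; rewrite coef_vertex.
by case: s => [|a s]; rewrite ?big_nil // andbF eqxx.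
Qed.

Lemma bq_homog_arrow a : bq_homog w (w a) (bq_arrow a).
Proof.
exists (path_arrow K a) => // j s.
rewrite -path_elt_arrow coef_elt; case: and3P => [[_ _ /eqP ->] _|]; last by rewrite eqxx.
by rewrite big_seq1.
Qed.

Lemma bq_homog_map (R : pzAlgType K) (gr : nat -> R -> Prop)
    (F : {rmorphism bq_alg B -> R}) :
  graded_pred gr -> kalg_morph F -> (forall i, gr 0%N (F (bq_vertex B i))) ->
  (forall a, gr (w a) (F (bq_arrow a))) ->
  forall k x, bq_homog w k x -> gr k (F x).
Proof.
move=> [g0 gD gZ gM] Fs Fv Fa k _ [p hp ->].
apply: (@path_span_ind _ _ _ (fun p => gr k (F (pi p)))) => [|{}p' q Pp Pq|i s hs nz].
- by rewrite !rmorph0.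
- by rewrite !rmorphD; exact: gD.
rewrite 2!rmorphM; change (gr k (F (scal (p i s)) * F (pi (path_elt K i s)))).
rewrite Fs; apply: gZ; rewrite -(hp _ _ nz) {nz}.
elim/last_ind: s hs => [|s a IH] hs; first by rewrite path_elt_nil big_nil; exact: Fv.
rewrite path_elt_rcons // -cats1 big_cat big_seq1 /= addrC !rmorphM; apply: gM; first exact: Fa.
by apply: IH; move: hs; rewrite -cats1 is_path_cat => /andP[].
Qed.

End Homogeneous.


Definition mklin (R : pzRingType) (U V : lmodType R) (f : U -> V) (lf : linear f) :
  {linear U -> V} := HB.pack f (GRing.isLinear.Build R U V *:%R f lf).

(** * Comparison of resolutions *)

Section KernelModule.
Variables (R : pzRingType) (V W : lmodType R) (g : {linear V -> W}).

Definition in_ker : pred V := fun v => g v == 0.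
(** Projectivity is stated for surjections only; cutting the target down to a
    kernel turns exactness into surjectivity. *)
Record kermod := KerMod { kermod_val :> V; _ : in_ker kermod_val }.
HB.instance Definition _ := [isSub for kermod_val].
HB.instance Definition _ := [Choice of kermod by <:].

Fact in_ker_submod_closed : submod_closed in_ker.
Proof.
split=> [|a x y]; first by rewrite unfold_in /in_ker raddf0.
rewrite !unfold_in /in_ker => /eqP hx /eqP hy.
by rewrite linearP hx hy scaler0 addr0.
Qed.
HB.instance Definition _ := GRing.isSubmodClosed.Build R V in_ker
  in_ker_submod_closed.
HB.instance Definition _ := [SubChoice_isSubLmodule of kermod by <:].
End KernelModule.

(** The lift of a zero map is chosen to be zero, which is what keeps the lifted
    chain maps bounded and homogeneous. *)
Lemma proj_lift (R : pzRingType) (P U V W : lmodType R) (d : {linear U -> V})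
    (d' : {linear V -> W}) (f : {linear P -> V}) :
  projective P -> (forall v, d' v = 0 <-> exists u, v = d u) ->
  (forall x, d' (f x) = 0) ->
  exists2 h : {linear P -> U}, (forall x, d (h x) = f x)
    & ((forall x, f x = 0) -> forall x, h x = 0).
Proof.
move=> hP ex fz; have [f0|/existsNP[x0 fx0]] := pselect (forall x, f x = 0).
  by exists \0 => x; rewrite ?f0 ?raddf0.
pose Z := kermod d'.
have dZ u : in_ker d' (d u) by apply/eqP/ex; exists u.
have fZ x : in_ker d' (f x) by apply/eqP.
have ld : linear (fun u => KerMod (dZ u) : Z).
  by move=> a u v; apply: val_inj; rewrite /= linearP.
have lf : linear (fun x => KerMod (fZ x) : Z).
  by move=> a u v; apply: val_inj; rewrite /= linearP.
have [|h hE] := hP _ _ (mklin ld) (mklin lf).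
  by case=> v kv; have [/(_ (eqP kv))[u vE] _] := ex v; exists u; apply: val_inj.
exists h => [x|f0]; last by case: fx0; exact: f0.
by have /(congr1 (@kermod_val _ _ _ _)) := hE x.
Qed.

Section PickLinear.
Variables (R : pzRingType) (U V : lmodType R) (Pr : {linear U -> V} -> Prop).
(** The default value makes the choice total, so that a row of lifts can be
    defined by recursion before its existence is proved. *)
Definition pick_lin : {linear U -> V} :=
  match pselect (exists h, Pr h) with left e => projT1 (cid e) | right _ => \0 end.
Lemma pick_linP : (exists h, Pr h) -> Pr pick_lin.
Proof. by rewrite /pick_lin; case: pselect => // e _; case: cid. Qed.
End PickLinear.

(** The restriction of a projective resolution to a subalgebra need not consist
    of projective modules, but it can still be the target of a comparison. *)
Record resolution (R : pzRingType) (M : lmodType R) := Resolution {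
  rs_mod :> nat -> lmodType R;
  rs_d : forall k, {linear rs_mod k.+1 -> rs_mod k};
  rs_aug : {linear rs_mod 0%N -> M};
  rs_aug_surj : forall y, exists x, rs_aug x = y;
  rs_exact0 : forall x, rs_aug x = 0 <-> exists y, x = rs_d 0 y;
  rs_exact : forall k x, rs_d k x = 0 <-> exists y, x = rs_d k.+1 y
}.

Definition res_of (R : pzRingType) (M : lmodType R) (P : proj_resolution M) :
  resolution M :=
  Resolution (@res_aug_surj _ _ P) (@res_exact0 _ _ P) (@res_exact _ _ P).

Section Comparison.
Variables (R : pzRingType) (L M : lmodType R).
Variables (T : proj_resolution L) (X : resolution M).

Fact resP i : projective (T i). Proof. exact: res_proj. Qed.
Arguments resP : clear implicits.

Lemma res_dd k x : res_d T k (res_d T k.+1 x) = 0.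
Proof. by apply/res_exact; exists x. Qed.

Lemma res_augd x : res_aug T (res_d T 0 x) = 0.
Proof. by apply/res_exact0; exists x. Qed.

Definition is_cycle j : X j -> Prop :=
  match j with 0 => fun x => rs_aug X x = 0 | j'.+1 => fun x => rs_d X j' x = 0 end.

Lemma is_cycle0 j : is_cycle (0 : X j).
Proof. by case: j => [|j]; exact: raddf0. Qed.

Lemma lift_cycle (C : lmodType R) j (f : {linear C -> X j}) : projective C ->
  (forall x, is_cycle (f x)) ->
  exists2 h : {linear C -> X j.+1}, (forall x, rs_d X j (h x) = f x)
    & ((forall x, f x = 0) -> forall x, h x = 0).
Proof.
move=> hC; case: j f => [|j] f fc; apply: (proj_lift hC) fc.
  exact: rs_exact0.
exact: rs_exact.
Qed.

Definition next_row j (g : forall i, {linear T i -> X j}) (i : nat) :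
  {linear T i -> X j.+1} :=
  match i with
  | 0 => \0
  | i'.+1 => pick_lin (fun h : {linear T i'.+1 -> X j.+1} =>
      (forall x, rs_d X j (h x) = g i' (res_d T i' x)) /\
      ((forall x, g i' (res_d T i' x) = 0) -> forall x, h x = 0))
  end.

(** The component T_i -> X_j is built by recursion on j, from the component
    T_(i-1) -> X_(j-1); it depends only on the cochain of degree i - j, and
    vanishes with it. *)
Lemma lift_ex (c : forall i, {linear T i -> M}) :
  (forall i x, c i (res_d T i x) = 0) ->
  exists f : forall i j, {linear T i -> X j},
  [/\ forall i x, rs_aug X (f i 0%N x) = c i x,
      forall i j x, rs_d X j (f i.+1 j.+1 x) = f i j (res_d T i x),
      forall i j x, (i < j)%N -> f i j x = 0
    & forall i j, (forall x, c i x = 0) -> forall x, f (i + j)%N j x = 0].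
Proof.
move=> cd.
pose row0 i := pick_lin (fun h : {linear T i -> X 0%N} =>
  (forall x, rs_aug X (h x) = c i x) /\ ((forall x, c i x = 0) -> forall x, h x = 0)).
have row0P i : (forall x, rs_aug X (row0 i x) = c i x) /\
    ((forall x, c i x = 0) -> forall x, row0 i x = 0).
  apply: (@pick_linP _ _ _ (fun h : {linear T i -> X 0%N} =>
    (forall x, rs_aug X (h x) = c i x) /\ ((forall x, c i x = 0) -> forall x, h x = 0))).
  have ex v : (\0 : {linear M -> M}) v = 0 <-> exists u, v = rs_aug X u.
    by split=> // _; have [u <-] := rs_aug_surj X v; exists u.
  by have [//|h h1 h2] := proj_lift (resP i) ex (f := c i); exists h.
pose row := fix row j : forall i, {linear T i -> X j} :=
  match j with 0 => row0 | j'.+1 => next_row (row j') end.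
have rowS j : (forall i x, is_cycle (row j i (res_d T i x))) /\ (forall i x,
    (rs_d X j (row j.+1 i.+1 x) = row j i (res_d T i x)) /\
    ((forall x, row j i (res_d T i x) = 0) -> row j.+1 i.+1 x = 0)).
  suff cyc : forall i x, is_cycle (row j i (res_d T i x)).
    split=> // i.
    pose g : {linear T i.+1 -> X j} := row j i \o res_d T i.
    have [h h1 h2] := lift_cycle (f := g) (resP i.+1) (cyc i).
    have [|e1 e2] := @pick_linP _ _ _ (fun h : {linear T i.+1 -> X j.+1} =>
      (forall x, rs_d X j (h x) = row j i (res_d T i x)) /\
      ((forall x, row j i (res_d T i x) = 0) -> forall x, h x = 0)).
      by exists h.
    by move=> x; split; [exact: e1|move=> z; apply: e2].
  elim: j => [|j IH] i x; first by rewrite /= (row0P i).1 cd.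
  change (rs_d X j (row j.+1 i (res_d T i x)) = 0).
  case: i x => [|i] x; first by rewrite /= raddf0.
  pose g : {linear T i.+1 -> X j} := row j i \o res_d T i.
  have [h h1 h2] := lift_cycle (f := g) (resP i.+1) (IH i).
  have [|e1 _] := @pick_linP _ _ _ (fun h : {linear T i.+1 -> X j.+1} =>
    (forall x, rs_d X j (h x) = row j i (res_d T i x)) /\
    ((forall x, row j i (res_d T i x) = 0) -> forall x, h x = 0)).
    by exists h.
  by rewrite [LHS]e1 res_dd raddf0.
exists (fun i j => row j i); split=> [i x|i j x|i j x|i j c0].
- exact: (row0P i).1.
- exact: ((rowS j).2 i x).1.
- elim: j i x => [//|j IH] [//|i] x ij; apply: ((rowS j).2 i x).2 => y.
  exact: IH.
elim: j => [|j IH].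
  by rewrite addn0 => x; apply: (row0P i).2.
rewrite addnS => x; apply: ((rowS j).2 _ x).2 => y; exact: IH.
Qed.

Definition next_homotopy (f : forall i j, {linear T i -> X j}) j
    (g : forall i, {linear T i -> X j}) (i : nat) : {linear T i -> X j.+1} :=
  match i with
  | 0 => pick_lin (fun h : {linear T 0%N -> X j.+1} =>
      forall x, rs_d X j (h x) = f 0%N j x)
  | i'.+1 => pick_lin (fun h : {linear T i'.+1 -> X j.+1} =>
      forall x, rs_d X j (h x) = f i'.+1 j x - g i' (res_d T i' x))
  end.

(** The homotopy starts, in degree -1 of the target, with the cochains b that
    make the cocycle of f a coboundary; its next row corrects f by the previous
    one, and the result is a cycle because f commutes with the differentials. *)
Lemma homotopy_ex (f : forall i j, {linear T i -> X j})
    (b : forall i, {linear T i -> M}) :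
  (forall i j x, (i < j)%N -> f i j x = 0) ->
  (forall i j x, rs_d X j (f i.+1 j.+1 x) = f i j (res_d T i x)) ->
  (forall x, rs_aug X (f 0%N 0%N x) = 0) ->
  (forall i x, rs_aug X (f i.+1 0%N x) = b i (res_d T i x)) ->
  exists h : forall i j, {linear T i -> X j},
  [/\ forall i x, rs_aug X (h i 0%N x) = b i x,
      forall j x, f 0%N j x = rs_d X j (h 0%N j.+1 x)
    & forall i j x, f i.+1 j x = rs_d X j (h i.+1 j.+1 x) + h i j (res_d T i x)].
Proof.
move=> ft fd f00 fb.
pose row0 i := pick_lin (fun h : {linear T i -> X 0%N} =>
  forall x, rs_aug X (h x) = b i x).
have row0P i : forall x, rs_aug X (row0 i x) = b i x.
  apply: (@pick_linP _ _ _ (fun h : {linear T i -> X 0%N} =>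
    forall x, rs_aug X (h x) = b i x)).
  exact: (resP i) (@rs_aug_surj _ _ X).
pose row := fix row j : forall i, {linear T i -> X j} :=
  match j with 0 => row0 | j'.+1 => next_homotopy f (row j') end.
have cyc0 j x : is_cycle (f 0%N j x).
  by case: j x => [|j] x; [exact: f00|rewrite ft //; exact: is_cycle0].
have next0 j x : rs_d X j (row j.+1 0%N x) = f 0%N j x.
  apply: (@pick_linP _ _ _ (fun h : {linear T 0%N -> X j.+1} =>
    forall x, rs_d X j (h x) = f 0%N j x)).
  by have [h h1 _] := lift_cycle (f := f 0%N j) (resP 0) (cyc0 j); exists h.
have nextS j i : (forall x, is_cycle (f i.+1 j x - row j i (res_d T i x))) ->
  forall x, rs_d X j (row j.+1 i.+1 x) = f i.+1 j x - row j i (res_d T i x).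
  move=> cyc; apply: (@pick_linP _ _ _ (fun h : {linear T i.+1 -> X j.+1} =>
    forall x, rs_d X j (h x) = f i.+1 j x - row j i (res_d T i x))).
  have lg : linear (fun x => f i.+1 j x - row j i (res_d T i x)).
    by move=> a x y; rewrite !linearP scalerDr addrACA.
  by have [h h1 _] := lift_cycle (f := mklin lg) (resP i.+1) cyc; exists h.
have cycS j i x : is_cycle (f i.+1 j x - row j i (res_d T i x)).
  elim: j i x => [|j IH] i x; first by rewrite /= linearB fb row0P subrr.
  change (rs_d X j (f i.+1 j.+1 x - row j.+1 i (res_d T i x)) = 0); rewrite linearB fd.
  case: i x => [|i] x; first by rewrite next0 subrr.
  by rewrite nextS // res_dd raddf0 subr0 subrr.
exists (fun i j => row j i); split=> [i x|j x|i j x]; first exact: row0P.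
  by rewrite next0.
by rewrite nextS // subrK.
Qed.

End Comparison.


Arguments chain_fun : simpl never.
Arguments end_fun : simpl never.

(** Subtraction makes such a relation single valued modulo the ideal: two values
    at x differ by a value at 0. *)
Lemma rel_rmorph_ex (K : pzRingType) (A A' : pzAlgType K) (G : A' -> Prop)
    (Rel : A -> A' -> Prop) :
  (forall x, exists y, Rel x y) ->
  (forall c, Rel (scal c) (scal c)) ->
  (forall x y x' y', Rel x x' -> Rel y y' -> Rel (x - y) (x' - y')) ->
  (forall x y x' y', Rel x x' -> Rel y y' -> Rel (x * y) (x' * y')) ->
  (forall y, Rel 0 y -> ideal_gen G y) ->
  exists F : {rmorphism A -> qalg G},
    kalg_morph F /\ forall x y, Rel x y -> F x = qalg_pi G y.
Proof.
move=> tot rZ rB rM r0.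
pose f x := qalg_pi G (projT1 (cid (tot x))).
have fE x y : Rel x y -> f x = qalg_pi G y.
  rewrite /f; case: cid => y' /= xy' xy; apply/eqP; rewrite -subr_eq0 -rmorphB.
  by apply/eqP/qalg_pi_eq0/r0; rewrite -(subrr x); exact: rB.
have fP x : Rel x (projT1 (cid (tot x))) by case: cid.
have fB : zmod_morphism f.
  by move=> x y; rewrite (fE _ _ (rB _ _ _ _ (fP x) (fP y))) rmorphB.
have fZ c : f (scal c) = scal c by rewrite (fE _ _ (rZ c)).
have fM : monoid_morphism f.
  split; first by rewrite -[1 in LHS](rmorph1 (@scal K A)) fZ rmorph1.
  by move=> x y; rewrite (fE _ _ (rM _ _ _ _ (fP x) (fP y))) rmorphM.
pose mB := GRing.isZmodMorphism.Build _ _ f fB.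
pose mM := GRing.isMonoidMorphism.Build _ _ f fM.
by exists (HB.pack f mB mM : {rmorphism A -> qalg G}).
Qed.

(** * Ext classes as cocycles *)

Section Cochains.
Variables (R : pzRingType) (L : lmodType R) (T : proj_resolution L).

(** All degrees are treated at once: c is a family of cochains, and the
    component of degree i + 1 comes from b_i, which has degree i. *)
Definition coboundary (N : lmodType R) (c : forall i, T i -> N) : Prop :=
  exists b : forall i, {linear T i -> N},
    (forall x, c 0%N x = 0) /\ (forall i x, c i.+1 x = b i (res_d T i x)).

Definition cocycle (N : lmodType R) (c : forall i, T i -> N) : Prop :=
  forall i x, c i (res_d T i x) = 0.

Lemma coboundary_ext (N : lmodType R) (c c' : forall i, T i -> N) :
  (forall i x, c i x = c' i x) -> coboundary c -> coboundary c'.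
Proof. by move=> E [b [b0 bS]]; exists b; split=> *; rewrite -E. Qed.

Lemma coboundary0 (N : lmodType R) (c : forall i, T i -> N) :
  (forall i x, c i x = 0) -> coboundary c.
Proof. by move=> c0; exists (fun _ => \0); split=> *; rewrite c0. Qed.

Lemma coboundaryD (N : lmodType R) (c c' : forall i, T i -> N) :
  coboundary c -> coboundary c' -> coboundary (fun i x => c i x + c' i x).
Proof.
move=> [b [b0 bS]] [b' [b0' bS']].
have lb i : linear (fun x => b i x + b' i x).
  by move=> a x y; rewrite !linearP scalerDr addrACA.
exists (fun i => mklin (lb i)); split=> *; first by rewrite b0 b0' addr0.
by rewrite bS bS'.
Qed.

Lemma coboundary_comp (N N' : lmodType R) (f : {linear N -> N'})
    (c : forall i, T i -> N) :
  coboundary c -> coboundary (fun i x => f (c i x)).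
Proof.
move=> [b [b0 bS]]; exists (fun i => f \o b i).
by split=> *; rewrite ?b0 ?raddf0 // bS.
Qed.

Lemma coboundaryN (N : lmodType R) (c : forall i, T i -> N) :
  coboundary c -> coboundary (fun i x => - c i x).
Proof.
move=> [b [b0 bS]].
have lb i : linear (fun x => - b i x).
  by move=> a x y; rewrite linearP opprD scalerN.
by exists (fun i => mklin (lb i)); split=> *; rewrite ?b0 ?oppr0 // bS.
Qed.

Lemma coboundaryB (N : lmodType R) (c c' : forall i, T i -> N) :
  coboundary c -> coboundary c' -> coboundary (fun i x => c i x - c' i x).
Proof. by move=> cb cb'; apply: coboundaryD cb (coboundaryN cb'). Qed.

Lemma coboundary_sum J (r : seq J) (N : lmodType R) (c : J -> forall i, T i -> N) :
  (forall k, coboundary (c k)) -> coboundary (fun i x => \sum_(k <- r) c k i x).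
Proof.
move=> cc; elim: r => [|k r IH].
  by apply: coboundary0 => i x; rewrite big_nil.
by apply: coboundary_ext (coboundaryD (cc k) IH) => i x; rewrite big_cons.
Qed.

Lemma linear_bigsum (U N : lmodType R) m (f : 'I_m -> {linear U -> N}) :
  linear (fun x => \sum_i f i x).
Proof.
by move=> a x y; rewrite scaler_sumr -big_split; apply: eq_bigr => i _; rewrite linearP.
Qed.

Variables (M : lmodType R) (X : resolution M) (N : lmodType R).

(** Composition with a chain map, in the matrix form of chain maps with several
    degrees: the term j = 0 disappears, and the others have b_(j-1) as
    coefficient. *)
Lemma coboundary_precomp (c : forall j, X j -> N) (b : forall j, {linear X j -> N})
    (g : forall i j, {linear T i -> X j}) :
  (forall x, c 0%N x = 0) -> (forall j x, c j.+1 x = b j (rs_d X j x)) ->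
  (forall i j x, rs_d X j (g i.+1 j.+1 x) = g i j (res_d T i x)) ->
  coboundary (fun i y => \sum_(j < i.+1) c j (g i j y)).
Proof.
move=> c0 cS gd.
exists (fun i => mklin (linear_bigsum (fun j : 'I_i.+1 => b j \o g i j))).
split=> [x|i x]; first by rewrite big_ord1.
rewrite big_ord_recl c0 add0r; apply: eq_bigr => j _.
by rewrite cS [LHS]/= gd.
Qed.

(** A cocycle kills the part d h of a null homotopic map, and the part h d is a
    coboundary by itself. *)
Lemma coboundary_homotopic (c : forall j, {linear X j -> N})
    (g h : forall i j, {linear T i -> X j}) :
  (forall j x, c j (rs_d X j x) = 0) ->
  (forall j x, g 0%N j x = rs_d X j (h 0%N j.+1 x)) ->
  (forall i j x, g i.+1 j x = rs_d X j (h i.+1 j.+1 x) + h i j (res_d T i x)) ->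
  coboundary (fun i y => \sum_(j < i.+1) c j (g i j y)).
Proof.
move=> cd g0 gS.
exists (fun i => mklin (linear_bigsum (fun j : 'I_i.+2 => c j \o h i j))).
split=> [x|i x]; first by rewrite big_ord1 g0 cd.
by apply: eq_bigr => j _; rewrite gS linearD cd add0r.
Qed.

End Cochains.

Section ExtClasses.
Variables (K : pzRingType) (R : pzAlgType K) (M : lmodType R).
Variable P : proj_resolution M.
Implicit Types f g : chain_end P.
Local Notation pi := (qalg_pi (@null_homotopic K R M P)).

Lemma chain_mulE f g i l x : (f * g) i l x = \sum_(j < i.+1) f j l (g i j x).
Proof. by []. Qed.
Lemma chain_addE f g i l x : (f + g) i l x = f i l x + g i l x.
Proof. by []. Qed.
Lemma chain_subE f g i l x : (f - g) i l x = f i l x - g i l x.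
Proof. by []. Qed.
Lemma chain_zeroE i l x : (0 : chain_end P) i l x = 0.
Proof. by []. Qed.
Lemma chain_scalE c f i l x : (scal c * f) i l x = (scal c : R) *: f i l x.
Proof. exact: chain_scal_mul. Qed.

Definition chain_lin f i j : {linear P i -> P j} := mklin (@chain_linear _ _ _ _ f i j).

Lemma aug_sumE J (r : seq J) Q (F : J -> chain_end P) i x :
  res_aug P ((\sum_(k <- r | Q k) F k) i 0%N x)
  = \sum_(k <- r | Q k) res_aug P (F k i 0%N x).
Proof.
elim/big_rec2: _ => [|k _ f _ <-]; first exact: linear0.
by rewrite chain_addE linearD.
Qed.

Definition aug_cocycle f i : {linear P i -> M} := res_aug P \o chain_lin f i 0.

Lemma aug_cocycleE f i x : aug_cocycle f i x = res_aug P (f i 0%N x).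
Proof. by []. Qed.

Lemma aug_cocycleP f : cocycle (fun i => aug_cocycle f i).
Proof. by move=> i x; rewrite aug_cocycleE -chain_comm res_augd. Qed.

(** Up to homotopy, a chain endomorphism is determined by the cocycle obtained
    by composing it with the augmentation. *)
Lemma null_homotopicP f :
  null_homotopic f <-> coboundary (fun i => aug_cocycle f i).
Proof.
split=> [[h lh [f0 fS]]|[b [b0 bS]]].
  exists (fun i => res_aug P \o mklin (lh i 0%N)); split=> [x|i x].
    by rewrite aug_cocycleE f0 res_augd.
  by rewrite aug_cocycleE fS linearD res_augd add0r.
have [h [_ h0 hS]] := @homotopy_ex _ _ _ P (res_of P) (chain_lin f) b
  (@chain_lt _ _ _ _ f) (@chain_comm _ _ _ _ f) b0 bS.
exists (fun i j => h i j); last by split.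
by move=> i j a x y; rewrite linearP.
Qed.

Lemma null_mulr f g : null_homotopic f -> null_homotopic (f * g).
Proof.
move/null_homotopicP => [b [b0 bS]]; apply/null_homotopicP.
have := @coboundary_precomp _ _ P _ (res_of P) M (fun i => aug_cocycle f i) b
  (chain_lin g) b0 bS (@chain_comm _ _ _ _ g).
by apply: coboundary_ext => i x; rewrite !aug_cocycleE chain_mulE linear_sum.
Qed.

Lemma null_mull f g : null_homotopic g -> null_homotopic (f * g).
Proof.
move=> [h lh [g0 gS]]; apply/null_homotopicP.
have := @coboundary_homotopic _ _ P _ (res_of P) M (aug_cocycle f)
  (chain_lin g) (fun i j => mklin (lh i j)) (@aug_cocycleP f) g0 gS.
by apply: coboundary_ext => i x; rewrite !aug_cocycleE chain_mulE linear_sum.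
Qed.

Lemma ideal_null f : ideal_gen (@null_homotopic K R M P) f -> null_homotopic f.
Proof.
elim=> {f} [|//|f g _ nf _ ng|a f b _ nf].
- by apply/null_homotopicP/coboundary0 => i x; rewrite aug_cocycleE chain_zeroE raddf0.
- apply/null_homotopicP; move/null_homotopicP: nf => nf; move/null_homotopicP: ng => ng.
  apply: coboundary_ext (coboundaryD nf ng) => i x.
  by rewrite !aug_cocycleE chain_addE linearD.
by apply/null_mulr/null_mull.
Qed.

Lemma ext_eq0 f : pi f = 0 <-> coboundary (fun i => aug_cocycle f i).
Proof.
rewrite qalg_pi_eq0 -null_homotopicP; split; first exact: ideal_null.
exact: ideal_genG.
Qed.

Lemma ext_eq f g :
  (forall i x, res_aug P (f i 0%N x) = res_aug P (g i 0%N x)) -> pi f = pi g.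
Proof.
move=> fg; apply/eqP; rewrite -subr_eq0 -rmorphB; apply/eqP/ext_eq0/coboundary0 => i x.
by rewrite aug_cocycleE chain_subE linearB fg subrr.
Qed.

Definition chain_homog k f := forall i j y, i != (j + k)%N -> f i j y = 0.

Lemma chain_homogM k l f g :
  chain_homog k f -> chain_homog l g -> chain_homog (k + l) (f * g).
Proof.
move=> hf hg i j y ne; rewrite chain_mulE big1 // => m _.
have [em|nm] := eqVneq (nat_of_ord m) (j + k)%N; last by rewrite hf.
by rewrite hg ?chain0 // em -addnA.
Qed.

Lemma chain_homog_scal c : chain_homog 0 (scal c).
Proof.
by move=> i j y; rewrite addn0 => ij; rewrite [LHS](chain_scal_fun_neq _ _ ij).
Qed.

Lemma ext_homog_graded : graded_pred (ext_homog P).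
Proof.
split=> [k|k _ _ [f hf ->] [g hg ->]|k c _ [f hf ->]|k l _ _ [f hf ->] [g hg ->]].
- by exists 0; rewrite ?rmorph0.
- by exists (f + g); rewrite ?rmorphD // => i j y ne; rewrite chain_addE hf ?hg ?addr0.
- exists (scal c * f); rewrite ?rmorphM // => i j y ne.
  by rewrite chain_scalE hf ?scaler0.
by exists (f * g); rewrite ?rmorphM //; exact: chain_homogM.
Qed.

Lemma chain_of_cocycle (c : forall i, {linear P i -> M}) :
  cocycle (fun i => c i) -> (exists N, forall i x, (N < i)%N -> c i x = 0) ->
  exists f, (forall i x, res_aug P (f i 0%N x) = c i x) /\
    forall k, (forall i x, i != k -> c i x = 0) -> chain_homog k f.
Proof.
move=> cd [N cN]; have [f [f0 fd ft fc]] := @lift_ex _ _ _ P (res_of P) c cd.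
have fe i j x : (j <= i)%N -> (forall y, c (i - j)%N y = 0) -> f i j x = 0.
  move=> ji; move: (fc (i - j)%N j); rewrite subnK // => H /H; exact.
have hf : is_chain_end (fun i j => f i j).
  split=> // [i j a x y|]; first by rewrite linearP.
  exists N => i j x h; apply: fe => [|y].
    by apply: ltnW; apply: leq_ltn_trans h; exact: leq_addr.
  by rewrite cN // ltn_subRL.
exists (mkChain hf); split=> [//|k ck i j y ne].
have [ij|ji] := ltnP i j; first exact: ft.
apply: fe => // z; rewrite ck //; apply: contra ne => /eqP <-.
by rewrite subnKC.
Qed.

Lemma hom_ext_total (u : endalg M) : exists x, ext_of_hom P u x.
Proof.
pose c i : {linear P i -> M} :=
  match i with 0 => mklin (end_linear u) \o res_aug P | _ => \0 end.
have [||f [f0 fh]] := @chain_of_cocycle c.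
- by case=> [|i] x //=; rewrite res_augd [LHS](end0 u).
- by exists 0%N; case.
exists (pi f), f; split=> [i j y ne|y|//]; last by rewrite f0.
by apply: (fh 0%N); rewrite ?addn0 // => -[].
Qed.

(** The isomorphism of Hom with Ext in degree 0, as a map of algebras: a lift of
    an endomorphism to a chain map of degree 0 is unique up to homotopy. *)
Lemma hom_ext_ex : exists J : {rmorphism endalg M -> ext_alg P},
  kalg_morph J /\ forall u x, ext_of_hom P (end_fun u) x -> J u = x.
Proof.
pose Rel (u : endalg M) (f : chain_end P) :=
  chain_homog 0 f /\ forall y, res_aug P (f 0%N 0%N y) = u (res_aug P y).
have h0 f : (forall i j y, i != j -> f i j y = 0) <-> chain_homog 0 f.
  by split=> H i j y; have := H i j y; rewrite addn0.
have [| | | | |J [Js JE]] := @rel_rmorph_ex K _ _ (@null_homotopic K R M P) Rel.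
- move=> u; have [_ [f [hf fu _]]] := hom_ext_total u.
  by exists f; split=> //; apply/h0.
- move=> c; split=> [|y]; first exact: chain_homog_scal.
  by rewrite [X in res_aug P X](chain_scal_funE _ y) linearZ.
- move=> u v f g [hf fu] [hg gv]; split=> [i j y ne|y].
    by rewrite chain_subE hf ?hg ?subr0.
  by rewrite chain_subE linearB fu gv.
- move=> u v f g [hf fu] [hg gv]; split=> [|y]; first exact: (chain_homogM hf hg).
  by rewrite chain_mulE big_ord1 fu gv.
- move=> f [hf fu]; apply: ideal_genG; apply/null_homotopicP/coboundary0 => -[|i] x.
    by rewrite aug_cocycleE fu.
  by rewrite aug_cocycleE hf ?raddf0.
exists J; split=> // u _ [f [hf fu ->]]; apply: JE; split=> //; exact/h0.
Qed.

End ExtClasses.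
Arguments aug_cocycle : simpl never.


(** * Restriction of scalars *)

Section Restriction.
Variables (R S : pzRingType) (th : {rmorphism R -> S}).

Section Module.
Variable U : lmodType S.
(** The local definition records th in the type, so that the module structure
    can be inferred from the type alone. *)
Definition resm : Type := let _ := th in U.
HB.instance Definition _ := GRing.Zmodule.copy resm U.
Definition resm_scale (r : R) (u : resm) : resm := th r *: (u : U).
Fact resm_scalerA a b u : resm_scale a (resm_scale b u) = resm_scale (a * b) u.
Proof. by rewrite /resm_scale scalerA rmorphM. Qed.
Fact resm_scale1r : left_id 1 resm_scale.
Proof. by move=> u; rewrite /resm_scale rmorph1 scale1r. Qed.
Fact resm_scalerDr : right_distributive resm_scale +%R.
Proof. by move=> a u v; rewrite /resm_scale scalerDr. Qed.
Fact resm_scalerDl u : {morph resm_scale^~ u : a b / a + b}.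
Proof. by move=> a b; rewrite /resm_scale rmorphD scalerDl. Qed.
HB.instance Definition _ := GRing.Zmodule_isLmodule.Build R resm
  resm_scalerA resm_scale1r resm_scalerDr resm_scalerDl.

Lemma resm_scaleE r (u : resm) : r *: u = (th r *: (u : U) : U).
Proof. by []. Qed.
End Module.

Lemma res_linear (U V : lmodType S) (f : {linear U -> V}) :
  linear (f : resm U -> resm V).
Proof. by move=> a x y; rewrite resm_scaleE [LHS]linearP. Qed.

Definition res_lin (U V : lmodType S) (f : {linear U -> V}) :
  {linear resm U -> resm V} := mklin (res_linear f).

Definition res_resolution (M : lmodType S) (X : resolution M) : resolution (resm M) :=
  @Resolution R (resm M) (fun k => resm (X k)) (fun k => res_lin (rs_d X k))
    (res_lin (rs_aug X)) (@rs_aug_surj _ _ X) (@rs_exact0 _ _ X) (@rs_exact _ _ X).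

End Restriction.

(** * Transfer of Ext algebras along Shapiro's isomorphism *)

Section Transfer.
Variables (K : pzRingType) (R S : pzAlgType K) (th : {rmorphism R -> S}).
Hypothesis thK : kalg_morph th.
Variables (L : lmodType R) (D : lmodType S).
Variables (T : proj_resolution L) (P : proj_resolution D).
Variables (sg : forall i, {linear T i -> resm th (P i)}) (io : {linear L -> resm th D}).
Hypothesis sg_d : forall i x, res_d P i (sg i.+1 x) = sg i (res_d T i x).
Hypothesis sg_aug : forall x, res_aug P (sg 0%N x) = io (res_aug T x).

Hypothesis shapiro_inj : forall c : forall i, {linear P i -> D},
  cocycle (fun i => c i) ->
  @coboundary _ _ T (resm th D) (fun i x => c i (sg i x)) -> coboundary (fun i => c i).
Hypothesis shapiro_surj : forall c : forall i, {linear T i -> resm th D},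
  cocycle (fun i => c i) ->
  exists c' : forall i, {linear P i -> D},
  [/\ cocycle (fun i => c' i),
      forall i, (forall x, c i x = 0) -> forall x, c' i x = 0
    & @coboundary _ _ T (resm th D) (fun i x => (c' i (sg i x) : resm th D) - c i x)].

(** By uniqueness of liftings, this says that g sg and sg f are homotopic, i.e.
    that the class of g corresponds to that of f; stated on cocycles, it can be
    obtained from Shapiro's isomorphism. *)
Definition transfers (f : chain_end T) (g : chain_end P) : Prop :=
  @coboundary _ _ T (resm th D) (fun i x =>
    (res_aug P (g i 0%N (sg i x)) : resm th D) - io (res_aug T (f i 0%N x))).

Lemma transfers_total f : exists g, transfers f g /\
  forall k, chain_homog k f -> chain_homog k g.
Proof.
pose c i : {linear T i -> resm th D} := io \o aug_cocycle f i.
have cE i x : c i x = io (res_aug T (f i 0%N x)) by [].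
have [|c' [c'd c'0 c'c]] := @shapiro_surj c.
  by move=> i x; rewrite [LHS](congr1 io (aug_cocycleP f x)) raddf0.
have cz k : chain_homog k f -> forall i, i != k -> forall x, c' i x = 0.
  move=> hf i ik; apply: c'0 => x; rewrite cE hf ?raddf0 //.
have [|g [g0 gh]] := @chain_of_cocycle _ _ _ P c' c'd.
  have [_ _ [N fN] _] := chain_endP f.
  by exists N => i x Ni; apply: c'0 => y; rewrite cE fN ?raddf0.
exists g; split=> [|k hf].
  by apply: coboundary_ext c'c => i x; rewrite g0.
by apply: gh => i x ik; exact: (cz k).
Qed.

Lemma transfersB f f' g g' :
  transfers f f' -> transfers g g' -> transfers (f - g) (f' - g').
Proof.
move=> tf tg; apply: coboundary_ext (coboundaryB tf tg) => i x.
rewrite !chain_subE [res_aug P (_ - _)]linearB [res_aug T (_ - _)]linearB [io (_ - _)]linearB.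
by rewrite !opprB addrACA [RHS]addrACA [X in _ = _ + X]addrC.
Qed.

Lemma transfers_scal c : transfers (scal c) (scal c).
Proof.
apply: coboundary0 => -[|i] x; last first.
  rewrite [X in io (res_aug T X)](@chain_scal_fun_neq _ _ _ T c i.+1 0 x) //.
  rewrite [X in res_aug P X](@chain_scal_fun_neq _ _ _ P c i.+1 0 _) //.
  by rewrite !raddf0 addr0.
rewrite [X in io (res_aug T X)](@chain_scal_funE _ _ _ T c 0 x).
rewrite [X in res_aug P X](@chain_scal_funE _ _ _ P c 0 _).
rewrite [res_aug P (_ *: _)]linearZ_LR [res_aug T (_ *: _)]linearZ_LR [io (_ *: _)]linearZ_LR.
by rewrite sg_aug resm_scaleE thK subrr.
Qed.

Lemma transfers_null f g :
  null_homotopic f -> transfers f g -> null_homotopic g.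
Proof.
move=> /null_homotopicP nf tg; apply/null_homotopicP/shapiro_inj.
  exact: aug_cocycleP.
apply: coboundary_ext (coboundaryD tg (coboundary_comp io nf)) => i x.
by rewrite /= subrK.
Qed.

(** Write f' g' sg - sg f g = f' (g' sg - sg g) + (f' sg - sg f) g.  The first
    bracket is null homotopic, so f' turns it into a coboundary; the second one is
    a coboundary by assumption, and remains one after composition with g. *)
Lemma transfersM f f' g g' :
  transfers f f' -> transfers g g' -> transfers (f * g) (f' * g').
Proof.
move=> [b [b0 bS]] [b' [b0' bS']].
have lG i j : linear (fun x : T i => (g' i j (sg i x) : resm th (P j)) - sg j (g i j x)).
  move=> a x y; rewrite linearP chain_linear [g' i j _](chain_linear g') linearP.
  by rewrite scalerBr opprD addrACA.
pose G i j : {linear T i -> resm th (P j)} := mklin (lG i j).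
pose X := res_resolution th (res_of P).
have Gt i j x : (i < j)%N -> G i j x = 0.
  by move=> ij; rewrite /= !chain_lt // raddf0 subr0.
have Gd i j x : rs_d X j (G i.+1 j.+1 x) = G i j (res_d T i x).
  rewrite linearB [X in X - _]chain_comm [X in _ - X]sg_d /=.
  by rewrite sg_d chain_comm.
have G0 x : rs_aug X (G 0%N 0%N x) = 0.
  by rewrite -(b0' x) linearB; congr (_ - _); exact: sg_aug.
have GS i x : rs_aug X (G i.+1 0%N x) = b' i (res_d T i x).
  by rewrite -bS' linearB; congr (_ - _); exact: sg_aug.
have [h [_ h0 hS]] := @homotopy_ex _ _ _ T X G b' Gt Gd G0 GS.
have H1 := @coboundary_homotopic _ _ T _ X _ (fun j => res_lin th (aug_cocycle f' j))
  G h (@aug_cocycleP _ _ _ _ f') h0 hS.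
have H2 := @coboundary_precomp _ _ T _ (res_of T) (resm th D)
  (fun i x => (res_aug P (f' i 0%N (sg i x)) : resm th D) - io (res_aug T (f i 0%N x)))
  b (chain_lin g)
  b0 bS (@chain_comm _ _ _ _ g).
apply: coboundary_ext (coboundaryD H1 H2) => i x.
rewrite !chain_mulE !linear_sum -!big_split; apply: eq_bigr => j _.
pose u : P j := g' i j (sg i x); pose v : P j := sg j (g i j x).
change (res_aug P (f' j 0%N (u - v)) + (res_aug P (f' j 0%N v)
  - (io (res_aug T (f j 0%N (g i j x))) : D))
  = res_aug P (f' j 0%N u) - (io (res_aug T (f j 0%N (g i j x))) : D)).
by rewrite addrA -linearD -chainD subrK.
Qed.

(** Induction of modules, on the level of Ext classes.  Going through the relation
    [transfers] rather than a functor on complexes lets P be arbitrary. *)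
Lemma transfer_ex : exists I : {rmorphism ext_alg T -> ext_alg P},
  kalg_morph I /\ forall f g, transfers f g ->
    I (qalg_pi (@null_homotopic K R L T) f) = qalg_pi (@null_homotopic K S D P) g.
Proof.
have [| | | | |F [FK FE]] := @rel_rmorph_ex K _ _ (@null_homotopic K S D P) transfers.
- by move=> f; have [g [tg _]] := transfers_total f; exists g.
- exact: transfers_scal.
- by move=> f g f' g'; exact: transfersB.
- by move=> f g f' g'; exact: transfersM.
- move=> g tg; apply/ideal_genG/(transfers_null _ tg).
  by apply/null_homotopicP/coboundary0 => i x; rewrite aug_cocycleE raddf0.
have [|I IE] := @qalg_rmorph_ex K _ (@null_homotopic K R L T) _ F.
  move=> f nf; have [g [tg _]] := transfers_total f.
  by rewrite (FE _ _ tg); apply/qalg_pi_eq0/ideal_genG/(transfers_null nf).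
exists I; split=> [c|f g /FE <-]; last exact: IE.
by rewrite -(FK c) -IE.
Qed.

End Transfer.


(** * Simple modules *)

Section DirectSumBasics.
Variables (R : pzRingType) (n : nat) (M : 'I_n -> lmodType R).
Implicit Types (m : dsum M) (i j : 'I_n).

Lemma dsum_eqP m m' : (forall i, m i = m' i) -> m = m'.
Proof. by move=> E; apply: functional_extensionality_dep. Qed.

Lemma dsum_sumE I (r : seq I) P (F : I -> dsum M) i :
  (\sum_(k <- r | P k) F k) i = \sum_(k <- r | P k) F k i.
Proof. by elim/big_rec2: _ => // k x y _ <-. Qed.

Lemma dsum_id_linear i : linear (@dsum_id R n M i).
Proof.
move=> a x y; apply: dsum_eqP => j; rewrite /dsum_id.
rewrite [RHS](_ : _ = a *: (if j == i then x j else 0) + (if j == i then y j else 0)) //.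
by case: eqP => _ //; rewrite scaler0 addr0.
Qed.

Lemma dsum_expand m : m = \sum_i dsum_id i m.
Proof.
apply: dsum_eqP => j; rewrite dsum_sumE (bigD1 j) //= big1 /dsum_id ?eqxx ?addr0 //.
by move=> i /negbTE ij; rewrite eq_sym ij.
Qed.

End DirectSumBasics.

Section ProjTop.
Variables (K : fieldType) (n : nat) (B : bound_quiver K n).

Fact proj_top_subproof i : in_lideal (bq_vertex B i) (bq_vertex B i).
Proof. by rewrite /in_lideal bq_vertexM eqxx. Qed.
Definition proj_top i : proj_mod B i := LIdeal (proj_top_subproof i).

Lemma proj_mod_top i (x : proj_mod B i) : x = (lideal_val x : bq_alg B) *: proj_top i.
Proof. by apply: val_inj; case: x => x /= /eqP E; rewrite -[LHS]E. Qed.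

End ProjTop.

Section SimpleModules.
Variables (K : fieldType) (n : nat) (B : bound_quiver K n).
Hypothesis arB : rel_in_arrow_ideal B.
Local Notation L := (simple_sum B).

Definition simple_top i : simple_mod B i := qmod_pi _ (proj_top B i).

Lemma simple_top_arrow i a : bq_arrow a *: simple_top i = 0.
Proof.
rewrite -linearZ -[RHS](linear0 (qmod_pi (@simple_gen K n B i))).
apply/qmod_eqP/asboolP; rewrite subr0; apply: spannedG.
by exists a, (proj_top B i).
Qed.

Lemma simple_top_vertex i : bq_vertex B i *: simple_top i = simple_top i.
Proof.
rewrite -linearZ; congr qmod_pi; apply: val_inj => /=.
by rewrite [LHS]bq_vertexM eqxx.
Qed.

Lemma simple_top_act i b : b *: simple_top i = scal (vcoef i b) *: simple_top i.
Proof.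
apply: (act_killed arB (th := (idfun : {rmorphism bq_alg B -> bq_alg B}))) => //.
  exact: simple_top_arrow.
exact: simple_top_vertex.
Qed.

(** The coordinate of m at the simple module L(i), which is one-dimensional. *)
Definition scoef i (m : L) : K := vcoef i (lideal_val (qmod_repr (m i)) : bq_alg B).

Lemma scoef_repr i (x : proj_mod B i) (m : L) : m i = qmod_pi _ x ->
  scoef i m = vcoef i (lideal_val x : bq_alg B).
Proof.
move=> mi; have : spanned (@simple_gen K n B i) (qmod_repr (m i) - x).
  by apply/asboolP/qmod_eqP; rewrite qmod_reprK.
have H y : spanned (@simple_gen K n B i) y -> vcoef i (lideal_val y : bq_alg B) = 0.
  elim=> {y} [|y [a [x' ->]]|y z _ Ey _ Ez|b y _ Ey].
  - exact: vcoef0.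
  - by rewrite [LHS](vcoefM arB) vcoef_arrow // mul0r.
  - by rewrite [LHS](vcoefD arB) Ey Ez addr0.
  by rewrite [LHS](vcoefM arB) Ey mulr0.
by move/H; rewrite [LHS](vcoefB arB) => /eqP; rewrite subr_eq0 => /eqP.
Qed.

Lemma scoef_pi i (m : L) : exists2 x : proj_mod B i,
  m i = qmod_pi _ x & scoef i m = vcoef i (lideal_val x : bq_alg B).
Proof. by have [x mi] := qmod_pi_surj (m i); exists x => //; apply: scoef_repr. Qed.

Lemma scoefD i : {morph scoef i : x y / x + y}.
Proof.
move=> x y; have [u xi ->] := scoef_pi i x; have [v yi ->] := scoef_pi i y.
rewrite (@scoef_repr i (u + v)); first by rewrite [LHS](vcoefD arB).
by rewrite [LHS](_ : _ = x i + y i) // xi yi -linearD.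
Qed.

Lemma scoefZ i b m : scoef i (b *: m) = vcoef i b * scoef i m.
Proof.
have [u mi ->] := scoef_pi i m.
rewrite (@scoef_repr i (b *: u)); first by rewrite [LHS](vcoefM arB).
by rewrite [LHS](_ : _ = b *: m i) // mi -linearZ.
Qed.

Lemma simple_mod_expand i (m : L) : m i = scal (scoef i m) *: simple_top i.
Proof.
have [u mi ->] := scoef_pi i m.
by rewrite mi {1}[u]proj_mod_top linearZ [LHS]simple_top_act.
Qed.

Lemma scoef0 i : scoef i 0 = 0.
Proof. by have := scoefZ i 0 0; rewrite vcoef0 // mul0r scale0r. Qed.

Lemma scoef_sum i I (r : seq I) P (F : I -> L) :
  scoef i (\sum_(k <- r | P k) F k) = \sum_(k <- r | P k) scoef i (F k).
Proof. by elim/big_rec2: _ => [|k x y _ <-]; rewrite ?scoef0 ?scoefD. Qed.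

Definition svec i : L := dsum_id i (fun j => simple_top j).

Lemma svec_act i b : b *: svec i = scal (vcoef i b) *: svec i.
Proof.
apply: dsum_eqP => j.
rewrite [LHS](_ : _ = b *: (if j == i then simple_top j else 0)) //.
rewrite [RHS](_ : _ = scal (vcoef i b) *: (if j == i then simple_top j else 0)) //.
by case: eqP => [->|_]; [exact: simple_top_act | rewrite !scaler0].
Qed.

Lemma scoef_svec i j : scoef i (svec j) = (i == j)%:R.
Proof.
case: (eqVneq i j) => [<-|/negbTE ij].
  rewrite (@scoef_repr i (proj_top B i)); first by rewrite vcoef_vertex // eqxx.
  by rewrite /svec /dsum_id eqxx.
rewrite (@scoef_repr i 0) /=; first exact: vcoef0.
by rewrite /svec /dsum_id ij linear0.
Qed.

Lemma simple_expand (m : L) : m = \sum_i scal (scoef i m) *: svec i.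
Proof.
apply: dsum_eqP => j; rewrite dsum_sumE (bigD1 j) //= big1 ?addr0.
  rewrite simple_mod_expand; congr (_ *: _).
  by rewrite /svec /dsum_id eqxx.
move=> i /negbTE ij.
rewrite [LHS](_ : _ = scal (scoef i m) *: (if j == i then simple_top j else 0)) //.
by rewrite eq_sym ij scaler0.
Qed.

Lemma simple_eqP (m m' : L) : (forall i, scoef i m = scoef i m') -> m = m'.
Proof.
by move=> E; rewrite [m]simple_expand [m']simple_expand; apply: eq_bigr => i _; rewrite E.
Qed.

Lemma scoef_dsum_id i j (m : L) : scoef i (dsum_id j m) = (i == j)%:R * scoef i m.
Proof.
have [u mi ->] := scoef_pi i m; case: (eqVneq i j) => [<-|/negbTE ij].
  by rewrite mul1r; apply: scoef_repr; rewrite /dsum_id eqxx.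
rewrite mul0r (@scoef_repr i 0) /=; first exact: vcoef0.
by rewrite /dsum_id ij linear0.
Qed.

End SimpleModules.


(** * Bases of paths *)

(** A basis of D consisting of the vertices and of some classes of nontrivial
    paths.  The inequality in [pb_lt] records that the arrows of D descend. *)
Record path_basis (K : fieldType) (n : nat) (D : bound_quiver K n) := PathBasis {
  pb_size : nat;
  pb_vec : 'I_n + 'I_pb_size -> bq_alg D;
  pb_src : 'I_n + 'I_pb_size -> 'I_n;
  pb_tgt : 'I_n + 'I_pb_size -> 'I_n;
  pb_coef : 'I_n + 'I_pb_size -> bq_alg D -> K;
  pb_vecl : forall i, pb_vec (inl i) = bq_vertex D i;
  pb_srcl : forall i, pb_src (inl i) = i;
  pb_tgtl : forall i, pb_tgt (inl i) = i;
  pb_lt : forall k, (pb_tgt (inr k) < pb_src (inr k))%N;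
  pb_arrow : forall k, exists a y, pb_vec (inr k) = bq_arrow a * y;
  pb_vec_src : forall x, pb_vec x * bq_vertex D (pb_src x) = pb_vec x;
  pb_vec_tgt : forall x, bq_vertex D (pb_tgt x) * pb_vec x = pb_vec x;
  pb_expand : forall d, d = \sum_x scal (pb_coef x d) * pb_vec x;
  pb_uniq : forall c : 'I_n + 'I_pb_size -> K,
    \sum_x scal (c x) * pb_vec x = 0 -> forall x, c x = 0
}.

Arguments pb_vec {K n D} p x.
Arguments pb_src {K n D} p x.
Arguments pb_tgt {K n D} p x.
Arguments pb_coef {K n D} p x d.
Arguments pb_vecl {K n D} p i.
Arguments pb_srcl {K n D} p i.
Arguments pb_tgtl {K n D} p i.
Arguments pb_lt {K n D} p k.
Arguments pb_arrow {K n D} p k.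
Arguments pb_vec_src {K n D} p x.
Arguments pb_vec_tgt {K n D} p x.
Arguments pb_expand {K n D} p d.
Arguments pb_uniq {K n D} p c.

Section PathBasisExists.
Variables (K : fieldType) (n : nat) (D : bound_quiver K n).
Hypothesis arD : rel_in_arrow_ideal D.
Hypothesis decD : forall a : arrow D, (tgt a < src a)%N.
Local Notation pi := (qalg_pi (bq_rel D)).
Local Notation J := ('I_n * n.-bseq (arrow D))%type.

Lemma dec_path i (s : seq (arrow D)) : is_path i s ->
  (size s + path_end i s <= i)%N.
Proof.
elim: s i => [|a s IH] i //= /andP[/eqP <- /IH h].
by apply: leq_ltn_trans (decD a).
Qed.

Definition pvec (p : J) : bq_alg D := pi (path_elt K p.1 (p.2 : seq (arrow D))).
Definition nontriv (p : J) :=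
  is_path p.1 (p.2 : seq (arrow D)) && ((p.2 : seq (arrow D)) != [::]).

Definition indep (E : {set J}) : bool := `[< forall (c : 'I_n -> K) (d : J -> K),
  \sum_i scal (c i) * bq_vertex D i + \sum_(p in E) scal (d p) * pvec p = 0 ->
  (forall i, c i = 0) /\ (forall p, p \in E -> d p = 0) >].

Lemma indep0 : indep set0.
Proof.
apply/asboolP => c d; rewrite big_set0 addr0 => E; split=> [i|p]; last by rewrite inE.
have := vcoef0 arD i; rewrite -E.
rewrite (big_morph _ (vcoefD arD i) (vcoef0 arD i)) (bigD1 i) //= big1 ?addr0.
  by rewrite vcoefM // vcoef_scal // vcoef_vertex // eqxx mulr1.
by move=> j /negbTE ji; rewrite vcoefM // vcoef_vertex // eq_sym ji mulr0.
Qed.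

(** The vertices are independent modulo the arrow ideal, so a set of paths that
    is independent together with them exists, and a maximal one spans. *)
Lemma indep_max : exists E : {set J}, [/\ indep E, forall p, p \in E -> nontriv p
  & forall p, nontriv p -> exists c d,
      pvec p = \sum_i scal (c i) * bq_vertex D i + \sum_(q in E) scal (d q) * pvec q].
Proof.
pose Pr (E : {set J}) := indep E && [forall p in E, nontriv p].
have P0 : Pr set0 by rewrite /Pr indep0; apply/forall_inP => p; rewrite inE.
case: (arg_maxnP (fun E : {set J} => #|E|) P0) => E /andP[iE nE] maxE.
exists E; split=> // [p|p np]; first exact: (forall_inP nE).
have [pE|pE] := boolP (p \in E).
  exists (fun=> 0), (fun q => (q == p)%:R); rewrite big1 ?add0r => [|i _]; last first.
    by rewrite rmorph0 mul0r.
  rewrite (bigD1 p) //= big1 ?addr0 ?eqxx ?rmorph1 ?mul1r // => q /andP[_ /negbTE ->].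
  by rewrite rmorph0 mul0r.
have : ~~ indep (p |: E).
  apply/negP => ipE; have := maxE (p |: E); rewrite /Pr ipE /= cardsU1 pE ltnn.
  move=> H; suff /H : [forall q in p |: E, nontriv q] by [].
  apply/forall_inP => q.
  by rewrite in_setU1 => /orP[/eqP->//|qE]; apply: (forall_inP nE).
case/asboolPn/existsNP => c /existsNP[d /not_implyP[]].
rewrite big_setU1 //= => sum0 nz.
have dp : d p != 0.
  apply/eqP => dp; case: nz; move: sum0; rewrite dp rmorph0 mul0r add0r.
  move/(asboolP _ iE) => [c0 d0]; split=> // q.
  by rewrite in_setU1 => /orP[/eqP->//|/d0].
pose u := - (d p)^-1.
exists (fun i => u * c i), (fun q => u * d q).
transitivity (scal u * (\sum_i scal (c i) * bq_vertex D i + \sum_(q in E) scal (d q) * pvec q)).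
  have -> : \sum_i scal (c i) * bq_vertex D i + \sum_(q in E) scal (d q) * pvec q
    = - (scal (d p) * pvec p).
    by apply/eqP; rewrite -addr_eq0 -addrA [X in _ + X]addrC sum0.
  by rewrite mulrN mulrA -scalM mulNr mulVf // scalN1 mulN1r opprK.
rewrite mulrDr !mulr_sumr; congr (_ + _); apply: eq_bigr => q _;
by rewrite mulrA -scalM.
Qed.

(** Descending arrows bound the length of a path by n, so finitely many paths
    span D. *)
Lemma path_basis_ex : inhabited (path_basis D).
Proof.
have [E [iE nE sE]] := indep_max.
pose I := ('I_n + 'I_#|E|)%type.
pose path (k : 'I_#|E|) : J := enum_val k.
pose vec (x : I) : bq_alg D :=
  match x with inl i => bq_vertex D i | inr k => pvec (path k) end.
pose st (x : I) : 'I_n := match x with inl i => i | inr k => (path k).1 end.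
pose en (x : I) : 'I_n :=
  match x with inl i => i | inr k => path_end (path k).1 (path k).2 end.
have pathE k : nontriv (path k) by apply/nE/enum_valP.
have sumE (c : I -> K) : \sum_x scal (c x) * vec x =
    \sum_i scal (c (inl i)) * bq_vertex D i
    + \sum_k scal (c (inr k)) * pvec (path k) by rewrite big_sumType.
have span d : exists c : I -> K, d = \sum_x scal (c x) * vec x.
  have [p <-] := qalg_pi_surj d.
  apply: (@path_span_ind _ _ _ (fun p => exists c : I -> K, pi p = _)).
  - by exists (fun=> 0); rewrite rmorph0 big1 // => x _; rewrite rmorph0 mul0r.
  - move=> q q' [c cE] [c' c'E]; exists (fun x => c x + c' x).
    rewrite qalg_piD cE c'E -big_split; apply: eq_bigr => x _.
    by rewrite rmorphD mulrDl.
  move=> i s hs _.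
  suff [c cE] : exists c : I -> K, pi (path_elt K i s) = \sum_x scal (c x) * vec x.
    exists (fun x => p i s * c x); rewrite qalg_piM cE mulr_sumr.
    by apply: eq_bigr => x _; rewrite mulrA scalM.
  have [->|s0] := eqVneq s [::].
    exists (fun x => if x is inl j then (j == i)%:R else 0); rewrite sumE /=.
    rewrite [X in _ + X]big1 ?addr0 => [|k _]; last by rewrite rmorph0 mul0r.
    rewrite (bigD1 i) //= big1 ?addr0 ?eqxx ?rmorph1 ?mul1r ?path_elt_nil //.
    by move=> j /negbTE ->; rewrite rmorph0 mul0r.
  have sn : (size s <= n)%N.
    apply: leq_trans (ltnW (ltn_ord i)); apply: leq_trans (dec_path hs).
    exact: leq_addr.
  have [|c [e pE]] := sE (i, Bseq sn); first by rewrite /nontriv /= hs.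
  exists (fun x => match x with inl j => c j | inr k => e (path k) end).
  rewrite sumE [LHS]pE; congr (_ + _).
  by rewrite big_enum_val.
have uniq (c : I -> K) : \sum_x scal (c x) * vec x = 0 -> forall x, c x = 0.
  rewrite sumE => c0.
  pose d q := if [pick k | path k == q] is Some k then c (inr k) else 0.
  have dE k : d (path k) = c (inr k).
    rewrite /d; case: pickP => [k' /eqP/enum_val_inj-> //|/(_ k)].
    by rewrite eqxx.
  move/asboolP: iE => /(_ (fun i => c (inl i)) d) [].
    rewrite -[RHS]c0 [\sum_(p in E) _]big_enum_val; congr (_ + _).
    by apply: eq_bigr => k _; rewrite dE.
  by move=> c1 d1 [i|k]; [exact: c1 | rewrite -dE; apply/d1/enum_valP].
pose coef x d := projT1 (cid (span d)) x.
apply: inhabits; apply: (@PathBasis K n D _ vec st en coef) => //.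
- move=> k; have /andP[hp hs] := pathE k; apply: leq_trans (dec_path hp).
  by rewrite -addn1 addnC leq_add2r lt0n size_eq0.
- move=> k; have /andP[] := pathE k; rewrite /vec /pvec.
  move: (path k).1 ((path k).2 : seq (arrow D)) => i s.
  case/lastP: s => // s a hs _; exists a, (pi (path_elt K i s)).
  by rewrite path_elt_rcons // qalg_piM.
- case=> [i|k]; first by rewrite bq_vertexM eqxx.
  have /andP[hs _] := pathE k.
  by rewrite -rmorphM -path_elt_nil path_eltM eqxx.
- case=> [i|k]; first by rewrite bq_vertexM eqxx.
  have /andP[hs _] := pathE k.
  by rewrite -rmorphM -path_elt_nil path_eltM eqxx cats0.
- by move=> d; rewrite /coef; case: cid.
Qed.

End PathBasisExists.


Lemma sum_sumE (V : nmodType) (I J : finType) (F : I + J -> V) :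
  \sum_x F x = \sum_i F (inl i) + \sum_j F (inr j).
Proof. exact: big_sumType. Qed.

(** * Coordinates in a basis of paths *)

Section PathBasisTheory.
Variables (K : fieldType) (n : nat) (D : bound_quiver K n) (b : path_basis D).
Local Notation I := ('I_n + 'I_(pb_size b))%type.
Implicit Types (x y : I) (d : bq_alg D).

Lemma pb_coefE (c : I -> K) d : d = \sum_x scal (c x) * pb_vec b x ->
  forall x, pb_coef b x d = c x.
Proof.
move=> dE x; apply/eqP; rewrite -subr_eq0; apply/eqP.
apply: (pb_uniq b (fun x => pb_coef b x d - c x)).
rewrite -[RHS](subrr d) {3}dE [in RHS](pb_expand b d) -sumrB.
by apply: eq_bigr => y _; rewrite scalB mulrBl.
Qed.

Lemma pb_coefD x : {morph pb_coef b x : d d' / d + d'}.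
Proof.
move=> d d'; apply: (pb_coefE (c := fun x => pb_coef b x d + pb_coef b x d')).
rewrite {1}(pb_expand b d) {1}(pb_expand b d') -big_split; apply: eq_bigr => y _.
by rewrite scalD mulrDl.
Qed.

Lemma pb_coefZ x c d : pb_coef b x (scal c * d) = c * pb_coef b x d.
Proof.
apply: (pb_coefE (c := fun x => c * pb_coef b x d)).
rewrite {1}(pb_expand b d) mulr_sumr; apply: eq_bigr => y _.
by rewrite mulrA scalM.
Qed.

Lemma pb_coef0 x : pb_coef b x 0 = 0.
Proof. by rewrite -[0](mul0r 0) -[X in X * _]scal0 pb_coefZ mul0r. Qed.

Lemma pb_coef_sum x J (r : seq J) P (F : J -> bq_alg D) :
  pb_coef b x (\sum_(k <- r | P k) F k) = \sum_(k <- r | P k) pb_coef b x (F k).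
Proof. exact: (big_morph _ (pb_coefD x) (pb_coef0 x)). Qed.

Lemma pb_coef_vec x y : pb_coef b x (pb_vec b y) = (x == y)%:R.
Proof.
apply: (pb_coefE (c := fun x => (x == y)%:R)).
rewrite (bigD1 y) //= eqxx scal1 mul1r big1 ?addr0 //.
by move=> z /negbTE ->; rewrite scal0 mul0r.
Qed.

Lemma pb_coef_mulr x d i :
  pb_coef b x (d * bq_vertex D i) = (pb_src b x == i)%:R * pb_coef b x d.
Proof.
apply: (pb_coefE (c := fun x => (pb_src b x == i)%:R * pb_coef b x d)).
rewrite {1}(pb_expand b d) mulr_suml; apply: eq_bigr => y _.
rewrite -mulrA -{1}(pb_vec_src b y) -mulrA bq_vertexM; case: eqP => _.
  by rewrite pb_vec_src mul1r.
by rewrite !mul0r !mulr0 scal0 mul0r.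
Qed.

Lemma pb_coef_mull x d i :
  pb_coef b x (bq_vertex D i * d) = (i == pb_tgt b x)%:R * pb_coef b x d.
Proof.
apply: (pb_coefE (c := fun x => (i == pb_tgt b x)%:R * pb_coef b x d)).
rewrite {1}(pb_expand b d) mulr_sumr; apply: eq_bigr => y _.
have -> : bq_vertex D i * (scal (pb_coef b y d) * pb_vec b y)
    = scal (pb_coef b y d) * (bq_vertex D i * pb_vec b y) by rewrite !mulrA -scal_comm.
rewrite -{1}(pb_vec_tgt b y) [bq_vertex D i * _]mulrA bq_vertexM; case: eqP => [->|_].
  by rewrite pb_vec_tgt mul1r.
by rewrite !mul0r mulr0 scal0 mul0r.
Qed.

(** The coefficient at a vertex of the basis is the coefficient [vcoef], which is
    multiplicative and vanishes on arrows. *)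
Lemma pb_coef_arrow (arD : rel_in_arrow_ideal D) i (a : arrow D) d :
  pb_coef b (inl i) (bq_arrow a * d) = 0.
Proof.
have H e : vcoef i e = pb_coef b (inl i) e.
  rewrite {1}(pb_expand b e) (big_morph _ (vcoefD arD i) (vcoef0 arD i)).
  rewrite (bigD1 (inl i)) //= pb_vecl vcoefM // vcoef_scal // vcoef_vertex // eqxx mulr1.
  rewrite big1 ?addr0 // => -[j|k] ne; rewrite vcoefM //.
    rewrite pb_vecl vcoef_vertex // [i == j](_ : _ = false) ?mulr0 //.
    by apply: contraNF ne => /eqP->.
  by have [a' [y ->]] := pb_arrow b k; rewrite vcoefM // vcoef_arrow // mul0r mulr0.
by rewrite -H vcoefM // vcoef_arrow // mul0r.
Qed.

End PathBasisTheory.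

(** K-linear endomorphisms are taken in the sense of [endalg], which requires the
    scalars to form a K-algebra. *)
Definition regK (K : fieldType) : Type := K.
HB.instance Definition _ (K : fieldType) := GRing.ComPzRing.copy (regK K) K.
Section RegK.
Variable K : fieldType.
Fact regK_zmod : zmod_morphism (id : K -> regK K). Proof. by []. Qed.
Fact regK_monoid : monoid_morphism (id : K -> regK K). Proof. by []. Qed.
Fact regK_comm (c : K) (x : regK K) : (c : regK K) * x = x * c.
Proof. exact: mulrC. Qed.
HB.instance Definition _ := isPzAlgebra.Build K (regK K) regK_zmod regK_monoid regK_comm.
End RegK.

(** * Induced modules *)

Section ActionModule.
Variables (K : fieldType) (S : pzAlgType K) (Z : lmodType (regK K)).
Variable h : {rmorphism S -> endalg Z}.
(** As for [resm], the type mentions h for the sake of inference. *)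
Definition actm : Type := let _ := h in Z.
HB.instance Definition _ := GRing.Zmodule.copy actm Z.
Definition actm_scale (s : S) (z : actm) : actm := h s (z : Z).
Fact actm_scalerA a b u : actm_scale a (actm_scale b u) = actm_scale (a * b) u.
Proof. by rewrite /actm_scale rmorphM. Qed.
Fact actm_scale1r : left_id 1 actm_scale.
Proof. by move=> u; rewrite /actm_scale rmorph1. Qed.
Fact actm_scalerDr : right_distributive actm_scale +%R.
Proof. by move=> a u v; rewrite /actm_scale endD. Qed.
Fact actm_scalerDl u : {morph actm_scale^~ u : a b / a + b}.
Proof. by move=> a b; rewrite /actm_scale rmorphD. Qed.
HB.instance Definition _ := GRing.Zmodule_isLmodule.Build S actm
  actm_scalerA actm_scale1r actm_scalerDr actm_scalerDl.
End ActionModule.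

Section Induced.
Variables (K : fieldType) (n : nat) (B D : bound_quiver K n).
Hypothesis arB : rel_in_arrow_ideal B.
Hypothesis arD : rel_in_arrow_ideal D.
Variable b : path_basis D.
Local Notation I := ('I_n + 'I_(pb_size b))%type.
Local Notation st := (pb_src b).
Local Notation en := (pb_tgt b).
Local Notation eB := (bq_vertex B).

Section Carrier.
Variable M : lmodType (bq_alg B).

(** The family m stands for the sum of the x (x) m_x in D (x)_S M, x ranging over
    the basis of D; the condition says that m_x lies in e_(src x) M. *)
Definition in_ind : pred {ffun I -> M} :=
  fun m => [forall x, eB (st x) *: m x == m x].
Record indk := IndK { indk_val :> {ffun I -> M}; _ : in_ind indk_val }.
HB.instance Definition _ := [isSub for indk_val].
HB.instance Definition _ := [Choice of indk by <:].
Fact in_ind_zmod_closed : zmod_closed in_ind.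
Proof.
split=> [|u v]; first by apply/forallP => x; rewrite ffunE scaler0.
move=> /forallP hu /forallP hv; apply/forallP => x.
by rewrite !ffunE scalerDr scalerN (eqP (hu x)) (eqP (hv x)).
Qed.
HB.instance Definition _ := GRing.isZmodClosed.Build {ffun I -> M} in_ind in_ind_zmod_closed.
HB.instance Definition _ := [SubChoice_isSubZmodule of indk by <:].

Implicit Types m : indk.

Lemma indk_eqP m m' : (forall x, m x = m' x) -> m = m'.
Proof. by move=> E; apply/val_inj/ffunP. Qed.
Lemma indk_addE m m' x : (m + m') x = m x + m' x.
Proof. by rewrite [LHS]ffunE. Qed.
Lemma indk_oppE m x : (- m) x = - m x.
Proof. by rewrite [LHS]ffunE. Qed.
Lemma indk_zeroE x : (0 : indk) x = 0.
Proof. by rewrite [LHS]ffunE. Qed.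
Lemma indkP m x : eB (st x) *: m x = m x.
Proof. by apply/eqP; case: m x => m hm x; apply: (forallP hm). Qed.
Lemma indkPn m x i : i != st x -> eB i *: m x = 0.
Proof. by move=> /negbTE h; rewrite -indkP scalerA bq_vertexM h scale0r. Qed.

Fact mkInd_subproof (f : I -> M) (hf : forall x, eB (st x) *: f x = f x) :
  in_ind [ffun x => f x].
Proof. by apply/forallP => x; rewrite ffunE hf. Qed.
Definition mkInd f hf := IndK (@mkInd_subproof f hf).
Lemma mkIndE f hf x : @mkInd f hf x = f x. Proof. exact: ffunE. Qed.

Fact indk_scale_subproof (c : regK K) m x :
  eB (st x) *: ((scal (c : K) : bq_alg B) *: m x) = (scal (c : K) : bq_alg B) *: m x.
Proof. by rewrite scalerA -scal_comm -scalerA indkP. Qed.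
Definition indk_scale (c : regK K) m : indk := mkInd (indk_scale_subproof c m).
Lemma indk_scale_funE c m x :
  indk_scale c m x = (scal (c : K) : bq_alg B) *: m x.
Proof. exact: mkIndE. Qed.
Fact indk_scalerA c d m : indk_scale c (indk_scale d m) = indk_scale (c * d) m.
Proof.
apply: indk_eqP => x; by rewrite !indk_scale_funE scalerA -scalM.
Qed.
Fact indk_scale1r : left_id 1 indk_scale.
Proof. by move=> m; apply: indk_eqP => x; rewrite indk_scale_funE scal1 scale1r. Qed.
Fact indk_scalerDr : right_distributive indk_scale +%R.
Proof.
by move=> c m m'; apply: indk_eqP => x; rewrite indk_addE !indk_scale_funE indk_addE scalerDr.
Qed.
Fact indk_scalerDl m : {morph indk_scale^~ m : c d / c + d}.
Proof.
move=> c d; apply: indk_eqP => x; rewrite indk_addE !indk_scale_funE -scalerDl.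
by rewrite scalD.
Qed.
HB.instance Definition _ := GRing.Zmodule_isLmodule.Build (regK K) indk
  indk_scalerA indk_scale1r indk_scalerDr indk_scalerDl.
Lemma indk_scaleE (c : regK K) m x : (c *: m) x = (scal (c : K) : bq_alg B) *: m x.
Proof. exact: mkIndE. Qed.

Fact indD_subproof (d : bq_alg D) m y :
  eB (st y) *: (\sum_x (scal (pb_coef b y (d * pb_vec b x)) : bq_alg B) *: m x)
  = \sum_x (scal (pb_coef b y (d * pb_vec b x)) : bq_alg B) *: m x.
Proof.
rewrite scaler_sumr; apply: eq_bigr => x _; rewrite scalerA -scal_comm -scalerA.
rewrite -pb_vec_src mulrA pb_coef_mulr; case: eqP => [->|_].
  by rewrite indkP.
by rewrite mul0r scal0 !scale0r.
Qed.
Definition indD_fun d m : indk := mkInd (indD_subproof d m).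
Lemma indD_funE d m y : indD_fun d m y =
  \sum_x (scal (pb_coef b y (d * pb_vec b x)) : bq_alg B) *: m x.
Proof. exact: mkIndE. Qed.
Fact indD_linear d : linear (indD_fun d).
Proof.
move=> c m m'; apply: indk_eqP => y; rewrite indk_addE indk_scaleE !indD_funE.
rewrite scaler_sumr -big_split; apply: eq_bigr => x _.
by rewrite indk_addE indk_scaleE scalerDr !scalerA [X in X *: _ + _]scal_comm.
Qed.
Definition indD (d : bq_alg D) : endalg indk := mkEnd (indD_linear d).
Lemma indDE d m y :
  indD d m y = \sum_x (scal (pb_coef b y (d * pb_vec b x)) : bq_alg B) *: m x.
Proof. exact: mkIndE. Qed.

Fact indD_zmod : zmod_morphism indD.
Proof.
move=> d d'; apply: endP => m; apply: indk_eqP => y.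
rewrite [RHS](_ : _ = (indD d m - indD d' m) y) // indk_addE indk_oppE !indDE -sumrB.
apply: eq_bigr => x _; rewrite -scalerBl -scalB.
congr (scal _ *: _); apply/eqP; rewrite eq_sym subr_eq -pb_coefD -mulrDl subrK //.
Qed.
Fact indD_scal c : indD (scal c) = scal c.
Proof.
apply: endP => m; apply: indk_eqP => y.
rewrite [RHS](_ : _ = ((c : regK K) *: m) y) // indk_scaleE indDE.
rewrite (bigD1 y) //= big1 ?addr0 => [|x /negbTE xy].
  by rewrite pb_coefZ pb_coef_vec eqxx mulr1.
by rewrite pb_coefZ pb_coef_vec eq_sym xy mulr0 scal0 scale0r.
Qed.
Fact indD_monoid : monoid_morphism indD.
Proof.
split; first by rewrite -[1 in LHS]scal1 indD_scal rmorph1.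
move=> d d'; apply: endP => m; apply: indk_eqP => y.
rewrite [RHS](_ : _ = indD d (indD d' m) y) // !indDE.
under [RHS]eq_bigr do rewrite indDE scaler_sumr.
rewrite exchange_big; apply: eq_bigr => x _.
under eq_bigr do rewrite scalerA -scalM.
rewrite -scaler_suml -(raddf_sum (@scal K (bq_alg B))); congr (scal _ *: _).
rewrite -mulrA {1}(pb_expand b (d' * pb_vec b x)) mulr_sumr pb_coef_sum.
by apply: eq_bigr => z _; rewrite mulrA -scal_comm -mulrA pb_coefZ mulrC.
Qed.
HB.instance Definition _ := GRing.isZmodMorphism.Build _ _ indD indD_zmod.
HB.instance Definition _ := GRing.isMonoidMorphism.Build _ _ indD indD_monoid.

Definition ind_top m : M := \sum_i m (inl i).
Lemma ind_topD m m' : ind_top (m + m') = ind_top m + ind_top m'.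
Proof. by rewrite -big_split; apply: eq_bigr => i _; rewrite indk_addE. Qed.
Lemma ind_topZ (c : regK K) m : ind_top (c *: m) = (scal (c : K) : bq_alg B) *: ind_top m.
Proof. by rewrite scaler_sumr; apply: eq_bigr => i _; rewrite indk_scaleE. Qed.
Lemma ind_top_vertex m i : eB i *: ind_top m = m (inl i).
Proof.
rewrite scaler_sumr (bigD1 i) //= big1 ?addr0; first by rewrite -[RHS]indkP pb_srcl.
by move=> j ji; rewrite indkPn // pb_srcl eq_sym.
Qed.

(** D (x)_S M is the direct sum of M and J (x)_S M.  On the first summand B acts
    as on M; on the second one its arrows act by zero, because of the mixed
    relations, and its vertices through the end of x. *)
Definition indB_coord (c : bq_alg B) m (x : I) : M :=
  match x with
  | inl i => (eB i * c) *: ind_top m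
  | inr k => (scal (vcoef (en (inr k)) c) : bq_alg B) *: m (inr k)
  end.
Fact indB_subproof c m x : eB (st x) *: indB_coord c m x = indB_coord c m x.
Proof.
case: x => [i|k] /=; first by rewrite pb_srcl scalerA mulrA bq_vertexM eqxx.
by rewrite scalerA -scal_comm -scalerA indkP.
Qed.
Definition indB_fun c m : indk := mkInd (indB_subproof c m).
Lemma indB_funE c m x : indB_fun c m x = indB_coord c m x.
Proof. exact: mkIndE. Qed.
Fact indB_linear c : linear (indB_fun c).
Proof.
move=> a m m'; apply: indk_eqP => -[i|k]; rewrite indk_addE indk_scaleE !indB_funE /indB_coord.
  by rewrite ind_topD ind_topZ scalerDr; congr (_ + _); rewrite !scalerA scal_comm.
by rewrite indk_addE indk_scaleE scalerDr !scalerA [X in X *: _ + _]scal_comm.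
Qed.
Definition indB (c : bq_alg B) : endalg indk := mkEnd (indB_linear c).
Lemma indBE c m x : indB c m x = indB_coord c m x.
Proof. exact: mkIndE. Qed.

Fact indB_zmod : zmod_morphism indB.
Proof.
move=> d d'; apply: endP => m; apply: indk_eqP => y.
rewrite [RHS](_ : _ = (indB d m - indB d' m) y) // indk_addE indk_oppE !indBE.
case: y => [i|k] /=; first by rewrite mulrBr scalerBl.
by rewrite vcoefB // scalB scalerBl.
Qed.
Fact indB_scal c : indB (scal c) = scal c.
Proof.
apply: endP => m; apply: indk_eqP => y.
rewrite [RHS](_ : _ = ((c : regK K) *: m) y) // indk_scaleE indBE.
case: y => [i|k] /=; last by rewrite vcoef_scal.
by rewrite -scal_comm -scalerA ind_top_vertex.
Qed.
Fact indB_monoid : monoid_morphism indB.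
Proof.
split; first by rewrite -[1 in LHS]scal1 indB_scal rmorph1.
move=> d d'; apply: endP => m; apply: indk_eqP => y.
rewrite [RHS](_ : _ = indB d (indB d' m) y) // !indBE.
case: y => [i|k] /=; last by rewrite indBE /= vcoefM // scalerA scalM.
rewrite /ind_top; under [in RHS]eq_bigr do rewrite indBE /= -scalerA.
by rewrite -scaler_suml bq_vertex_sum scale1r !scalerA mulrA.
Qed.
HB.instance Definition _ := GRing.isZmodMorphism.Build _ _ indB indB_zmod.
HB.instance Definition _ := GRing.isMonoidMorphism.Build _ _ indB indB_monoid.

(** An arrow of D takes values in J (x)_S M, where the arrows of B act by zero,
    so the two actions satisfy the mixed relations. *)
Lemma ind_action_ex : exists h : {rmorphism bq_alg (dual_ext B D) -> endalg indk},
  [/\ kalg_morph h, forall c, h (bq_inl D c) = indB c & forall d, h (bq_inr B d) = indD d].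
Proof.
apply: dual_ext_rmorph_ex.
- exact: indB_scal.
- exact: indD_scal.
- move=> v; apply: endP => m; apply: indk_eqP => y; rewrite indBE indDE.
  rewrite (bigD1 y) //= big1 ?addr0; last first.
    move=> x /negbTE xy; rewrite pb_coef_mull pb_coef_vec [y == x]eq_sym xy mulr0.
    by rewrite scal0 scale0r.
  rewrite pb_coef_mull pb_coef_vec eqxx mulr1; case: y => [i|k] /=.
    rewrite bq_vertexM pb_tgtl eq_sym; case: eqP => _.
      by rewrite ind_top_vertex scal1 scale1r.
    by rewrite scal0 !scale0r.
  by rewrite vcoef_vertex // eq_sym.
move=> a d; apply: endP => m; apply: indk_eqP => y.
rewrite [LHS](_ : _ = indB (bq_arrow a) (indD (bq_arrow d) m) y) // indBE.
rewrite [RHS](_ : _ = (0 : indk) y) // indk_zeroE; case: y => [i|k] /=.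
  rewrite /ind_top big1 ?scaler0 // => j _; rewrite indDE big1 // => x _.
  by rewrite pb_coef_arrow // scal0 scale0r.
by rewrite vcoef_arrow // scal0 scale0r.
Qed.

Definition ind_action := projT1 (cid ind_action_ex).

End Carrier.

End Induced.


(** * Adjunction between induction and restriction *)

Section InducedModule.
Variables (K : fieldType) (n : nat) (B D : bound_quiver K n).
Hypothesis arB : rel_in_arrow_ideal B.
Hypothesis arD : rel_in_arrow_ideal D.
Variable b : path_basis D.
Local Notation I := ('I_n + 'I_(pb_size b))%type.
Local Notation st := (pb_src b).
Local Notation en := (pb_tgt b).
Local Notation eB := (bq_vertex B).
Local Notation Lam := (bq_alg (dual_ext B D)).
Local Notation th := (bq_inl D : {rmorphism bq_alg B -> Lam}).

Definition ind (M : lmodType (bq_alg B)) : lmodType Lam :=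
  actm (ind_action arB arD b M).

Definition ind_coord (M : lmodType (bq_alg B)) (m : ind M) (x : I) : M :=
  (m : indk b M) x.

(** Every arrow of B kills x, as x is a multiple of an arrow of D. *)
Lemma inl_nontriv c k : bq_inl D c * bq_inr B (pb_vec b (inr k))
  = scal (vcoef (en (inr k)) c) * bq_inr B (pb_vec b (inr k)).
Proof.
apply: (@act_killed K n B arB Lam th (Lam^o) (bq_inr B (pb_vec b (inr k)) : Lam^o)
  (en (inr k))) => [|a|].
- exact: bq_inl_scal.
- have [a' [y ->]] := pb_arrow b k.
  change (bq_inl D (bq_arrow a) * bq_inr B (bq_arrow a' * y) = 0).
  by rewrite bq_inrM mulrA bq_inl_inr_arrow mul0r.
change (bq_inl D (eB (en (inr k))) * bq_inr B (pb_vec b (inr k)) = bq_inr B (pb_vec b (inr k))).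
rewrite bq_inl_vertex -bq_inr_vertex -bq_inrM.
by rewrite pb_vec_tgt.
Qed.

Section OneModule.
Variable M : lmodType (bq_alg B).
Implicit Types m : ind M.

Lemma ind_coord_inj m m' : (forall x, ind_coord m x = ind_coord m' x) -> m = m'.
Proof. exact: indk_eqP. Qed.

Lemma ind_coordD m m' x : ind_coord (m + m') x = ind_coord m x + ind_coord m' x.
Proof. exact: indk_addE. Qed.

Lemma ind_coord0 x : ind_coord (0 : ind M) x = 0.
Proof. exact: indk_zeroE. Qed.

Lemma ind_coord_sum J (r : seq J) P (F : J -> ind M) x :
  ind_coord (\sum_(k <- r | P k) F k) x = \sum_(k <- r | P k) ind_coord (F k) x.
Proof. by elim/big_rec2: _ => [|k u v _ <-]; rewrite ?ind_coord0 ?ind_coordD. Qed.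

Lemma ind_coord_src m x : eB (st x) *: ind_coord m x = ind_coord m x.
Proof. exact: indkP. Qed.

Lemma ind_inr d m y : ind_coord (bq_inr B d *: m) y
  = \sum_x (scal (pb_coef b y (d * pb_vec b x)) : bq_alg B) *: ind_coord m x.
Proof.
rewrite [LHS](_ : _ = (ind_action arB arD b M (bq_inr B d) (m : indk b M)) y) //.
rewrite /ind_action; case: cid => h /= [_ _ ->]; exact: indDE.
Qed.

Lemma ind_inl_triv c m i : ind_coord (bq_inl D c *: m) (inl i)
  = (eB i * c) *: \sum_j ind_coord m (inl j).
Proof.
rewrite [LHS](_ : _ = (ind_action arB arD b M (bq_inl D c) (m : indk b M)) (inl i)) //.
rewrite /ind_action; case: cid => h /= [_ -> _]; exact: indBE.
Qed.

Lemma ind_inl_nontriv c m k : ind_coord (bq_inl D c *: m) (inr k)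
  = (scal (vcoef (en (inr k)) c) : bq_alg B) *: ind_coord m (inr k).
Proof.
rewrite [LHS](_ : _ = (ind_action arB arD b M (bq_inl D c) (m : indk b M)) (inr k)) //.
rewrite /ind_action; case: cid => h /= [_ -> _]; exact: indBE.
Qed.

Lemma ind_scal (c : K) m x :
  ind_coord ((scal c : Lam) *: m) x = (scal c : bq_alg B) *: ind_coord m x.
Proof.
rewrite -(bq_inl_scal B D c); case: x => [i|k]; last by rewrite ind_inl_nontriv vcoef_scal.
rewrite ind_inl_triv -scal_comm -scalerA; congr (_ *: _).
rewrite scaler_sumr (bigD1 i) //= big1 ?addr0.
  by rewrite -[RHS]ind_coord_src pb_srcl.
by move=> j ji; apply: indkPn; rewrite pb_srcl eq_sym.
Qed.

(** The map m |-> 1 (x) m, with 1 the sum of the vertices. *)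
Definition eta_coord (u : M) (x : I) : M := match x with inl i => eB i *: u | inr _ => 0 end.
Fact eta_subproof u x : eB (st x) *: eta_coord u x = eta_coord u x.
Proof. by case: x => [i|k] /=; rewrite ?scaler0 // pb_srcl scalerA bq_vertexM eqxx. Qed.
Definition eta_fun (u : M) : ind M := mkInd (eta_subproof u).
Lemma eta_coordE u x : ind_coord (eta_fun u) x = eta_coord u x.
Proof. exact: mkIndE. Qed.

Lemma eta_top u : \sum_j ind_coord (eta_fun u) (inl j) = u.
Proof.
under eq_bigr do rewrite eta_coordE.
by rewrite -scaler_suml bq_vertex_sum scale1r.
Qed.

Fact eta_linear : linear (eta_fun : M -> resm th (ind M)).
Proof.
move=> c u v; apply: ind_coord_inj => x; rewrite ind_coordD resm_scaleE.
case: x => [i|k]; rewrite ?ind_inl_triv ?ind_inl_nontriv ?eta_top !eta_coordE /=.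
  by rewrite scalerDr scalerA.
by rewrite scaler0 addr0.
Qed.
Definition eta : {linear M -> resm th (ind M)} := mklin eta_linear.

Lemma ind_gen m : m = \sum_x bq_inr B (pb_vec b x) *: (eta (ind_coord m x) : ind M).
Proof.
apply: ind_coord_inj => y; rewrite ind_coord_sum (bigD1 y) //= big1 ?addr0.
  rewrite ind_inr sum_sumE [X in _ + X]big1 ?addr0 => [|k _]; last first.
    by rewrite eta_coordE scaler0.
  under eq_bigr do rewrite eta_coordE /= pb_vecl pb_coef_mulr pb_coef_vec eqxx mulr1.
  rewrite (bigD1 (st y)) //= eqxx scal1 scale1r ind_coord_src.
  rewrite big1 ?addr0 // => i /negbTE h.
  by rewrite eq_sym h scal0 scale0r.
move=> x /negbTE xy; rewrite ind_inr big1 // => z _; rewrite eta_coordE.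
case: z => [i|k] /=; last by rewrite scaler0.
by rewrite pb_vecl pb_coef_mulr pb_coef_vec [y == x]eq_sym xy mulr0
  scal0 scale0r.
Qed.

Lemma ind_lin_eq (U : lmodType Lam) (F G : {linear ind M -> U}) :
  (forall u, F (eta u) = G (eta u)) -> F =1 G.
Proof.
move=> E m; rewrite (ind_gen m) !linear_sum; apply: eq_bigr => x _.
by rewrite !linearZ_LR E.
Qed.

(** The extension of f sends x (x) m to x f(m).  Linearity is checked on D and on
    B separately; over B the nontrivial x use [inl_nontriv]. *)
Lemma ind_adj_ex (U : lmodType Lam) (f : {linear M -> resm th U}) :
  exists F : {linear ind M -> U}, forall u, F (eta u) = f u.
Proof.
pose g m : U := \sum_x bq_inr B (pb_vec b x) *: (f (ind_coord m x) : U).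
have fZ c u : (f (c *: u) : U) = bq_inl D c *: (f u : U) by exact: (linearZ_LR f).
have gD m m' : g (m + m') = g m + g m'.
  rewrite /g -big_split; apply: eq_bigr => x _.
  by rewrite ind_coordD linearD scalerDr.
have g0 : g 0 = 0 by apply: (addrI (g 0)); rewrite -gD !addr0.
have gr d m : g (bq_inr B d *: m) = bq_inr B d *: g m.
  rewrite /g; under eq_bigr => y _.
    rewrite ind_inr linear_sum scaler_sumr.
    under eq_bigr => x _ do rewrite fZ bq_inl_scal scalerA -scal_comm
      -(bq_inr_scal B D) -bq_inrM.
    over.
  rewrite exchange_big scaler_sumr; apply: eq_bigr => x _ /=.
  by rewrite -scaler_suml scalerA -!rmorphM -rmorph_sum -pb_expand.
have gl c m : g (bq_inl D c *: m) = bq_inl D c *: g m.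
  rewrite /g !sum_sumE scalerDr !scaler_sumr; congr (_ + _).
    under eq_bigr do rewrite ind_inl_triv fZ scalerA pb_vecl bq_inr_vertex bq_inlM
       mulrA bq_inl_vertex bq_vertexM eqxx -scalerA.
    rewrite -scaler_suml bq_vertex_sum scale1r linear_sum scaler_sumr.
    apply: eq_bigr => j _; congr (_ *: _).
    rewrite -[in LHS]ind_coord_src fZ pb_srcl pb_vecl bq_inr_vertex.
    by rewrite bq_inl_vertex.
  apply: eq_bigr => k _; rewrite ind_inl_nontriv fZ bq_inl_scal !scalerA.
  by rewrite inl_nontriv scal_comm.
have gZ : forall (l : Lam) m, g (l *: m) = l *: g m.
  elim/dual_ext_ind => [|u v Eu Ev|d c] m.
  - by rewrite !scale0r.
  - by rewrite !scalerDl gD Eu Ev.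
  by rewrite -!scalerA gr gl.
have gl' : linear g by move=> c m m'; rewrite gD gZ.
exists (mklin gl') => u; rewrite /= /g sum_sumE [X in _ + X]big1 ?addr0.
  under eq_bigr do rewrite eta_coordE /= fZ scalerA pb_vecl bq_inr_vertex bq_inl_vertex
    bq_vertexM eqxx.
  by rewrite -scaler_suml bq_vertex_sum scale1r.
by move=> k _; rewrite eta_coordE /= linear0 scaler0.
Qed.

Definition ind_adj (U : lmodType Lam) (f : {linear M -> resm th U}) :
  {linear ind M -> U} := projT1 (cid (ind_adj_ex f)).
Lemma ind_adjE (U : lmodType Lam) (f : {linear M -> resm th U}) u :
  ind_adj f (eta u) = f u.
Proof. by rewrite /ind_adj; case: cid. Qed.

(** Induction is left adjoint to restriction, which preserves surjections. *)
Lemma ind_projective : projective M -> projective (ind M).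
Proof.
move=> hM U V g f gs.
pose f' : {linear M -> resm th V} := res_lin th f \o eta.
have [h hE] := hM _ _ (res_lin th g) f' gs.
exists (ind_adj h) => m.
have := @ind_lin_eq _ (g \o ind_adj h) f; apply=> u.
by rewrite /= ind_adjE; exact: hE.
Qed.

End OneModule.

Arguments eta {M}.

Section Functor.
Variables (M M' : lmodType (bq_alg B)) (f : {linear M -> M'}).
Definition ind_map : {linear ind M -> ind M'} := ind_adj (@eta M' \o f).
Lemma ind_map_eta u : ind_map (eta u) = eta (f u).
Proof. exact: ind_adjE. Qed.
Lemma ind_map_coord m x : ind_coord (ind_map m) x = f (ind_coord m x).
Proof.
have hf y : eB (st y) *: f (ind_coord m y) = f (ind_coord m y).
  by rewrite -linearZ_LR ind_coord_src.
pose m' : ind M' := mkInd hf.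
have m'E y : ind_coord m' y = f (ind_coord m y) by exact: mkIndE.
rewrite -m'E; congr (ind_coord _ x); rewrite {1}(ind_gen m) linear_sum (ind_gen m').
by apply: eq_bigr => y _; rewrite linearZ_LR ind_map_eta m'E.
Qed.
End Functor.

End InducedModule.


Lemma qmod_lin_ex (R : pzRingType) (M N : lmodType R) (G : M -> Prop)
    (f : {linear M -> N}) : (forall x, G x -> f x = 0) ->
  exists F : {linear qmod G -> N}, forall x, F (qmod_pi G x) = f x.
Proof.
move=> fG; have fs x : spanned G x -> f x = 0.
  elim=> {x} [|//|x y _ Ex _ Ey|a x _ Ex]; first exact: linear0.
    by rewrite linearD Ex Ey addr0.
  by rewrite linearZ_LR Ex scaler0.
pose F (u : qmod G) : N := f (qmod_repr u).
have FE x : F (qmod_pi G x) = f x.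
  apply/eqP; rewrite -subr_eq0 -linearB; apply/eqP/fs/asboolP/qmod_eqP.
  by rewrite qmod_reprK.
have lF : linear F.
  move=> a u v; case: (qmod_pi_surj u) (qmod_pi_surj v) => x <- [y <-].
  by rewrite -linearP !FE linearP.
by exists (mklin lF).
Qed.

(** * Standard modules are induced from simple modules *)

Section StandardModules.
Variables (K : fieldType) (n : nat) (B D : bound_quiver K n).
Hypothesis arB : rel_in_arrow_ideal B.
Hypothesis arD : rel_in_arrow_ideal D.
Hypothesis incB : forall a : arrow B, (src a < tgt a)%N.
Variable b : path_basis D.
Local Notation I := ('I_n + 'I_(pb_size b))%type.
Local Notation st := (pb_src b).
Local Notation en := (pb_tgt b).
Local Notation eB := (bq_vertex B).
Local Notation BD := (dual_ext B D).
Local Notation Lam := (bq_alg BD).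
Local Notation th := (bq_inl D : {rmorphism bq_alg B -> Lam}).
Local Notation L := (simple_sum B).
Local Notation Delta := (standard_sum BD).
Local Notation Ind := (ind arB arD b).
Local Notation eta := (eta arB arD b).

Section Killed.
Variables (U : lmodType Lam) (w : 'I_n -> U).
Hypothesis w_arrow : forall i a, bq_inl D (bq_arrow a) *: w i = 0.
Hypothesis w_vertex : forall i, bq_vertex BD i *: w i = w i.

Lemma killed_act i c : bq_inl D c *: w i = (scal (vcoef i c) : Lam) *: w i.
Proof.
apply: (@act_killed K n B arB Lam th U) => [|a|]; first exact: bq_inl_scal.
- exact: w_arrow.
- by rewrite [X in X *: _](bq_inl_vertex B D).
Qed.

Fact killed_linear :
  linear (fun m : L => \sum_i (scal (scoef i m) : Lam) *: w i : resm th U).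
Proof.
move=> c m m'; rewrite resm_scaleE scaler_sumr -big_split; apply: eq_bigr => i _.
rewrite scoefD // scoefZ // scalD scalerDl.
congr (_ + _); rewrite [RHS]scalerA -[in RHS]scal_comm -[RHS]scalerA killed_act.
by rewrite scalerA -scalM mulrC.
Qed.
(** A vector at i killed by the arrows of B spans a quotient of L(i), so the
    images of the generators of L can be prescribed among such vectors. *)
Definition killed_hom : {linear L -> resm th U} := mklin killed_linear.
Lemma killed_homE m : killed_hom m = \sum_i (scal (scoef i m) : Lam) *: w i :> U.
Proof. by []. Qed.
Lemma killed_hom_svec i : killed_hom (svec B i) = w i.
Proof.
rewrite killed_homE (bigD1 i) //= scoef_svec // eqxx scal1 scale1r.
rewrite big1 ?addr0 // => j /negbTE ji.
by rewrite scoef_svec // ji scal0 scale0r.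
Qed.
End Killed.

Definition dvec i : Delta := dsum_id i (fun j => qmod_pi _ (proj_top BD j)).

Lemma dvec_vertex i : bq_vertex BD i *: dvec i = dvec i.
Proof.
apply: dsum_eqP => j.
rewrite [LHS](_ : _ = bq_vertex BD i *: (if j == i then qmod_pi _ (proj_top BD j) else 0)) //.
rewrite [RHS](_ : _ = if j == i then qmod_pi _ (proj_top BD j) else 0) //.
case: eqP => [->|_]; last by rewrite scaler0.
rewrite -linearZ; congr qmod_pi; apply: val_inj => /=.
by rewrite [LHS]bq_vertexM eqxx.
Qed.

(** An arrow of B leaving i ends at some j > i, and right multiplication by it is
    a map P(j) -> P(i) whose image contains the arrow. *)
Lemma dvec_arrow i a : bq_inl D (bq_arrow a) *: dvec i = 0.
Proof.
apply: dsum_eqP => j.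
rewrite [LHS](_ : _ = bq_inl D (bq_arrow a) *: (if j == i then qmod_pi _ (proj_top BD j) else 0)) //.
rewrite [RHS](_ : _ = 0) //; case: eqP => [_|_]; last by rewrite scaler0.
rewrite -linearZ -[RHS](linear0 (qmod_pi (@trace_gen K n BD j))).
apply/qmod_eqP/asboolP; rewrite subr0.
have aE : bq_inl D (bq_arrow a) * bq_vertex BD j =
    if j == src a then bq_inl D (bq_arrow a) else 0.
  by rewrite -(bq_inl_vertex B D) -bq_inlM bq_arrow_vertex; case: eqP; rewrite ?rmorph0.
move: aE; case: eqP => [js|_] aE; last first.
  rewrite [_ *: _](_ : _ = 0); first exact: spanned0.
  by apply: val_inj; rewrite /= -[RHS]aE.
apply: spannedG; exists (tgt a); first by rewrite js; exact: incB.
have hr (x : proj_mod BD (tgt a)) :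
    in_lideal (bq_vertex BD j) ((lideal_val x : Lam) * bq_inl D (bq_arrow a)).
  by rewrite /in_lideal -mulrA aE.
have lr : linear (fun x : proj_mod BD (tgt a) => LIdeal (hr x) : proj_mod BD j).
  by move=> c x y; apply: val_inj; rewrite /= mulrDl -mulrA.
exists (mklin lr), (proj_top BD (tgt a)); apply: val_inj => /=.
rewrite [LHS]aE -(bq_inl_vertex B D) -bq_inlM bq_vertex_arrow eqxx //.
Qed.

Lemma delta_expand (m : Delta) :
  m = \sum_i (lideal_val (qmod_repr (m i)) : Lam) *: dvec i.
Proof.
apply: dsum_eqP => j; rewrite dsum_sumE (bigD1 j) //= big1 ?addr0.
  rewrite [RHS](_ : _ = (lideal_val (qmod_repr (m j)) : Lam) *:
    (if j == j then qmod_pi (@trace_gen K n BD j) (proj_top BD j) else 0)) // eqxx.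
  rewrite -(linearZ_LR (qmod_pi (@trace_gen K n BD j))) -proj_mod_top.
  exact: esym (qmod_reprK _).
move=> i /negbTE ij; rewrite [LHS](_ : _ = (lideal_val (qmod_repr (m i)) : Lam) *:
    (if j == i then qmod_pi (@trace_gen K n BD j) (proj_top BD j) else 0)) //.
by rewrite eq_sym ij scaler0.
Qed.

Lemma delta_lin_eq (U : lmodType Lam) (F G : {linear Delta -> U}) :
  (forall i, F (dvec i) = G (dvec i)) -> F =1 G.
Proof.
move=> E m; rewrite (delta_expand m) !linear_sum; apply: eq_bigr => i _.
by rewrite !linearZ_LR E.
Qed.

Definition iota : {linear L -> resm th Delta} := killed_hom dvec_arrow dvec_vertex.
Lemma iota_svec i : iota (svec B i) = dvec i. Proof. exact: killed_hom_svec. Qed.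

Lemma ind_vertex (M : lmodType (bq_alg B)) j (m : Ind M) y :
  ind_coord (bq_vertex BD j *: m) y = if j == en y then ind_coord m y else 0.
Proof.
rewrite -(bq_inr_vertex B D) ind_inr (bigD1 y) //= big1 ?addr0.
  rewrite pb_coef_mull pb_coef_vec eqxx mulr1.
  by case: eqP => _; rewrite ?scal1 ?scal0 ?scale1r ?scale0r.
move=> x /negbTE xy; rewrite pb_coef_mull pb_coef_vec [y == x]eq_sym xy mulr0.
by rewrite scal0 scale0r.
Qed.

Lemma ind_inr_svec d i y : ind_coord (bq_inr B d *: (eta L (svec B i) : Ind L)) y
  = (scal (pb_coef b y (d * bq_vertex D i)) : bq_alg B) *: svec B i.
Proof.
rewrite ind_inr sum_sumE [X in _ + X]big1 ?addr0 => [|k _]; last first.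
  by rewrite eta_coordE scaler0.
rewrite (bigD1 i) //= big1 ?addr0 => [|j /negbTE ji].
  rewrite eta_coordE /= pb_vecl svec_act // vcoef_vertex // eqxx.
  by rewrite scal1 scale1r.
rewrite eta_coordE /= svec_act // vcoef_vertex // eq_sym ji.
by rewrite scal0 scale0r scaler0.
Qed.

Lemma eta_svec_arrow i a : bq_inl D (bq_arrow a) *: (eta L (svec B i) : Ind L) = 0.
Proof.
have := linearZ_LR (eta L) (bq_arrow a) (svec B i); rewrite resm_scaleE => <-.
rewrite svec_act // vcoef_arrow // scal0 scale0r.
exact: linear0.
Qed.

Lemma eta_svec_vertex i : bq_vertex BD i *: (eta L (svec B i) : Ind L) = eta L (svec B i).
Proof.
rewrite -[bq_vertex BD i](bq_inl_vertex B D).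
have := linearZ_LR (eta L) (eB i) (svec B i); rewrite resm_scaleE => <-.
rewrite svec_act // vcoef_vertex // eqxx.
by rewrite scal1 scale1r.
Qed.

Lemma eta_svec_src (l : Lam) i y : st y != i ->
  ind_coord (l *: (eta L (svec B i) : Ind L)) y = 0.
Proof.
move=> yi; elim/dual_ext_ind: l => [|u v Eu Ev|d c].
- by rewrite scale0r ind_coord0.
- by rewrite scalerDl ind_coordD Eu Ev addr0.
rewrite -scalerA (killed_act eta_svec_arrow eta_svec_vertex) scalerA -scal_comm -scalerA.
rewrite ind_scal ind_inr_svec pb_coef_mulr (negbTE yi) mul0r.
by rewrite scal0 scale0r scaler0.
Qed.

Lemma pb_le y : (en y <= st y)%N.
Proof. by case: y => [i|k]; [rewrite pb_tgtl pb_srcl | exact/ltnW/pb_lt]. Qed.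

(** The map P(i) -> D (x)_S L sending e_i to 1 (x) l_i kills the trace: its image
    D e_i (x) l_i has no component at a vertex j > i, because D descends. *)
Lemma delta_to_ind_ex : exists F : {linear Delta -> Ind L},
  forall i, F (dvec i) = eta L (svec B i).
Proof.
have lf i : linear (fun x : proj_mod BD i =>
    (lideal_val x : Lam) *: (eta L (svec B i) : Ind L)).
  by move=> a x y; rewrite [X in X *: _](_ : _ =
    a * (lideal_val x : Lam) + lideal_val y) // scalerDl scalerA.
have ex i : exists F : {linear standard_mod BD i -> Ind L},
    forall x, F (qmod_pi _ x) = mklin (lf i) x.
  apply: qmod_lin_ex => y [j ij [g [x ->]]] /=.
  rewrite [x]proj_mod_top linearZ_LR.
  set z := lideal_val (g (proj_top BD j)) : Lam.
  have ez : z = bq_vertex BD j * z.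
    rewrite /z -{1}[proj_top BD j]/(proj_top BD j).
    rewrite {1}[proj_top BD j]proj_mod_top linearZ_LR //.
  rewrite [X in X *: _](_ : _ = (lideal_val x : Lam) * z) // -scalerA ez -scalerA.
  rewrite [X in _ *: X](_ : _ = 0) ?scaler0 //; apply: ind_coord_inj => y'.
  rewrite ind_vertex ind_coord0; case: eqP => // jy; apply: eta_svec_src.
  by apply: contraTneq ij => <-; rewrite -leqNgt jy pb_le.
pose F i := projT1 (cid (ex i)).
have FE i x : F i (qmod_pi _ x) = mklin (lf i) x := projT2 (cid (ex i)) x.
have lF : linear (fun m : Delta => \sum_i F i (m i)).
  move=> a m m'; rewrite scaler_sumr -big_split; apply: eq_bigr => i _.
  exact: linearP.
exists (mklin lF) => i; rewrite /= (bigD1 i) //= big1 ?addr0 /dvec /dsum_id ?eqxx.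
  by rewrite FE; exact: eta_svec_vertex.
by move=> j /negbTE ji; rewrite ji linear0.
Qed.

Definition delta_to_ind : {linear Delta -> Ind L} := projT1 (cid delta_to_ind_ex).
Lemma delta_to_ind_dvec i : delta_to_ind (dvec i) = eta L (svec B i).
Proof. by rewrite /delta_to_ind; case: cid. Qed.

Definition ind_to_delta : {linear Ind L -> Delta} := ind_adj arB arD b iota.

Lemma ind_to_delta_eta m : ind_to_delta (eta L m) = iota m.
Proof. exact: ind_adjE. Qed.

Lemma delta_to_indK : cancel delta_to_ind ind_to_delta.
Proof.
apply: (@delta_lin_eq _ (ind_to_delta \o delta_to_ind) idfun) => i /=.
by rewrite delta_to_ind_dvec ind_to_delta_eta iota_svec.
Qed.

Lemma ind_to_deltaK : cancel ind_to_delta delta_to_ind.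
Proof.
apply: (@ind_lin_eq _ _ _ _ _ _ _ _ _ (delta_to_ind \o ind_to_delta) idfun) => u /=.
have E : eta L u = \sum_i (scal (scoef i u) : bq_alg B) *: eta L (svec B i).
  by rewrite {1}(simple_expand arB u) linear_sum; apply: eq_bigr => i _; rewrite linearZ_LR.
rewrite ind_to_delta_eta [iota u]killed_homE linear_sum; apply: (etrans _ (esym E)).
apply: eq_bigr => i _; rewrite linearZ_LR delta_to_ind_dvec.
rewrite [RHS](_ : _ = bq_inl D (scal (scoef i u)) *: (eta L (svec B i) : Ind L)) //.
by rewrite bq_inl_scal.
Qed.

Lemma delta_hom_ex (U : lmodType Lam) (w : 'I_n -> U) :
  (forall i a, bq_inl D (bq_arrow a) *: w i = 0) ->
  (forall i, bq_vertex BD i *: w i = w i) ->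
  exists F : {linear Delta -> U}, forall i, F (dvec i) = w i.
Proof.
move=> wa wv; exists (ind_adj arB arD b (killed_hom wa wv) \o delta_to_ind) => i /=.
by rewrite delta_to_ind_dvec ind_adjE killed_hom_svec.
Qed.

(** The coordinate of m in D, seen as Delta, with respect to the basis of paths. *)
Definition mu (x : I) (m : Delta) : K := scoef (st x) (ind_coord (delta_to_ind m) x).

Lemma muD x : {morph mu x : m m' / m + m'}.
Proof. by move=> m m'; rewrite /mu linearD ind_coordD scoefD. Qed.

Lemma mu0 x : mu x 0 = 0.
Proof. by rewrite /mu linear0 ind_coord0 scoef0. Qed.

Lemma mu_sum x J (r : seq J) P (F : J -> Delta) :
  mu x (\sum_(k <- r | P k) F k) = \sum_(k <- r | P k) mu x (F k).
Proof. exact: (big_morph _ (muD x) (mu0 x)). Qed.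

Lemma muZ x c (m : Delta) : mu x ((scal c : Lam) *: m) = c * mu x m.
Proof. by rewrite /mu linearZ_LR ind_scal scoefZ // vcoef_scal. Qed.

Lemma mu_inl x c (m : Delta) : mu x (bq_inl D c *: m) = vcoef (en x) c * mu x m.
Proof.
rewrite /mu linearZ_LR; case: x => [i|k]; last by rewrite ind_inl_nontriv scoefZ // vcoef_scal.
rewrite ind_inl_triv scoefZ // vcoefM // vcoef_vertex // pb_srcl pb_tgtl eqxx mul1r.
rewrite scoef_sum // (bigD1 i) //= big1 ?addr0 // => j ji.
rewrite -ind_coord_src scoefZ // pb_srcl vcoef_vertex // eq_sym.
by rewrite (negbTE ji) mul0r.
Qed.

Lemma mu_inr_dvec x d i : mu x (bq_inr B d *: dvec i) = pb_coef b x (d * bq_vertex D i).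
Proof.
rewrite /mu linearZ_LR delta_to_ind_dvec ind_inr_svec scoefZ // vcoef_scal // scoef_svec //.
by rewrite pb_coef_mulr; case: eqP; rewrite ?mulr1 // mul0r mulr0.
Qed.

Definition bvec x : Delta := bq_inr B (pb_vec b x) *: dvec (st x).

Lemma mu_bvec x y : mu x (bvec y) = (x == y)%:R.
Proof. by rewrite /bvec mu_inr_dvec pb_vec_src pb_coef_vec. Qed.

Lemma mu_expand m : m = \sum_x (scal (mu x m) : Lam) *: bvec x.
Proof.
rewrite -[LHS]delta_to_indK [delta_to_ind m]ind_gen linear_sum; apply: eq_bigr => x _.
rewrite linearZ_LR ind_to_delta_eta killed_homE (bigD1 (st x)) //= big1 ?addr0.
  by rewrite scalerA -scal_comm -scalerA.
move=> i ix; rewrite -ind_coord_src scoefZ // vcoef_vertex // (negbTE ix) mul0r.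
by rewrite scal0 scale0r.
Qed.

Lemma delta_eqP m m' : (forall x, mu x m = mu x m') -> m = m'.
Proof.
by move=> E; rewrite [m]mu_expand [m']mu_expand; apply: eq_bigr => x _; rewrite E.
Qed.

Lemma delta_arrow (a : arrow B) (m : Delta) : bq_inl D (bq_arrow a) *: m = 0.
Proof. by apply: delta_eqP => x; rewrite mu_inl vcoef_arrow // mul0r mu0. Qed.

Lemma mu_vertex x i (m : Delta) : mu x (bq_vertex BD i *: m) = (en x == i)%:R * mu x m.
Proof. by rewrite -(bq_inl_vertex B D) mu_inl vcoef_vertex. Qed.

Lemma bvec_tgt x : bq_vertex BD (en x) *: bvec x = bvec x.
Proof. by rewrite /bvec scalerA -(bq_inr_vertex B D) -bq_inrM pb_vec_tgt. Qed.

Lemma bvec_triv i : bvec (inl i) = dvec i.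
Proof. by rewrite /bvec pb_vecl bq_inr_vertex pb_srcl dvec_vertex. Qed.

Lemma end_of_ex (w : 'I_n -> Delta) : (forall i, bq_vertex BD i *: w i = w i) ->
  exists u : endalg Delta, forall i, u (dvec i) = w i.
Proof.
move=> wv; have [F FE] := delta_hom_ex (fun i a => delta_arrow a (w i)) wv.
have lF : linear (F : Delta -> Delta) by move=> a x y; rewrite linearP.
by exists (mkEnd lF).
Qed.

Lemma end_delta_eq (u v : endalg Delta) : (forall i, u (dvec i) = v (dvec i)) -> u = v.
Proof.
move=> E; apply: endP.
exact: (@delta_lin_eq _ (mklin (end_linear u)) (mklin (end_linear v)) E).
Qed.

(** Right multiplication by x on Delta = D. *)
Lemma end_basis_ex x : exists u : endalg Delta,
  forall i, u (dvec i) = if i == en x then bvec x else 0.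
Proof.
apply: end_of_ex => i; case: eqP => [->|_]; last by rewrite scaler0.
exact: bvec_tgt.
Qed.
Definition end_basis x := projT1 (cid (end_basis_ex x)).
Lemma end_basisE x i : end_basis x (dvec i) = if i == en x then bvec x else 0.
Proof. by rewrite /end_basis; case: cid. Qed.

Fact dsum_id_end_subproof i : linear (@dsum_id Lam n (standard_mod BD) i).
Proof. exact: dsum_id_linear. Qed.
Definition end_id i : endalg Delta := mkEnd (dsum_id_end_subproof i).

Lemma end_id_dvec i j : end_id i (dvec j) = if j == i then dvec j else 0.
Proof.
apply: dsum_eqP => k; rewrite [LHS]/(dsum_id i (dvec j) k) /dsum_id /dvec /dsum_id.
by case: (eqVneq j i) => [->|/negbTE ji]; case: eqP => // ->; rewrite ?eqxx // eq_sym ji.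
Qed.

Lemma end_basis_triv i : end_basis (inl i) = end_id i.
Proof.
apply: end_delta_eq => j; rewrite end_basisE end_id_dvec pb_tgtl bvec_triv.
by case: eqP => // ->.
Qed.

Lemma end_sumE J (r : seq J) P (F : J -> endalg Delta) m :
  (\sum_(k <- r | P k) F k) m = \sum_(k <- r | P k) F k m.
Proof. by elim/big_rec2: _ => // k x y _ <-. Qed.

Lemma end_scalE c (u : endalg Delta) m : (scal c * u) m = (scal c : Lam) *: u m.
Proof. by []. Qed.

Lemma end_expand (u : endalg Delta) :
  u = \sum_x scal (mu x (u (dvec (en x)))) * end_basis x.
Proof.
apply: end_delta_eq => i; rewrite end_sumE [LHS]mu_expand.
apply: eq_bigr => x _; rewrite end_scalE end_basisE; case: eqP => [->//|ix].
rewrite scaler0 -(dvec_vertex i) endZ mu_vertex; case: eqP => [e|_].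
  by case: ix.
by rewrite mul0r scal0 scale0r.
Qed.

Definition delta_proj_fun (x : I) (m : resm th Delta) : L :=
  (scal (mu x m) : bq_alg B) *: svec B (en x).
Fact delta_proj_linear x : linear (delta_proj_fun x).
Proof.
move=> c m m'; rewrite /delta_proj_fun resm_scaleE muD mu_inl scalD scalerDl scalM.
congr (_ + _); rewrite [RHS]scalerA -[in RHS]scal_comm -[RHS]scalerA.
by rewrite [c *: _]svec_act // scalerA scal_comm.
Qed.
(** The arrows of B act by zero on Delta, so each basis element x spans a
    B-submodule isomorphic to the simple module at the end of x; this is the
    projection onto it. *)
Definition delta_proj x : {linear resm th Delta -> L} := mklin (delta_proj_linear x).
Lemma delta_projE x m : delta_proj x m = (scal (mu x m) : bq_alg B) *: svec B (en x).
Proof. by []. Qed.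

Lemma iotaE m : iota m = \sum_i (scal (scoef i m) : Lam) *: dvec i :> Delta.
Proof. by []. Qed.

Lemma end_basis_iota x m :
  end_basis x (iota m) = (scal (scoef (en x) m) : Lam) *: bvec x.
Proof.
have := linear_sum (mklin (end_linear (end_basis x))); rewrite /= => E.
rewrite [X in end_basis x X](iotaE m) E (bigD1 (en x)) //= endZ end_basisE eqxx big1 ?addr0 // => i ix.
by rewrite endZ end_basisE (negbTE ix) scaler0.
Qed.

Lemma delta_split m : \sum_x end_basis x (iota (delta_proj x m)) = m.
Proof.
rewrite [RHS]mu_expand; apply: eq_bigr => x _.
by rewrite end_basis_iota delta_projE scoefZ // vcoef_scal // scoef_svec // eqxx mulr1.
Qed.

Lemma delta_proj_basis x y m :
  delta_proj y (end_basis x (iota m)) = if x == y then dsum_id (en x) m else 0.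
Proof.
rewrite end_basis_iota delta_projE muZ mu_bvec; case: (eqVneq x y) => [->|_].
  rewrite mulr1; apply: (simple_eqP arB) => i.
  rewrite scoefZ // vcoef_scal // scoef_svec // scoef_dsum_id //.
  by case: eqP => [->|_]; rewrite ?mulr1 ?mul1r // mulr0 mul0r.
by rewrite mulr0 scal0 scale0r.
Qed.

(** Lift the generator of Delta at src x to p in P_0.  As x is a multiple of an
    arrow of D, the vector x p is killed by the arrows of B even though p need not
    be, so it defines a map from Delta. *)
Lemma end_basis_factor (P : proj_resolution Delta) k :
  exists F : {linear Delta -> P 0%N}, forall m, res_aug P (F m) = end_basis (inr k) m.
Proof.
have [p pE] := res_aug_surj P (dvec (st (inr k))).
(* The images of the generators of Delta: x p for the one at the end of x, where
   x = pb_vec b (inr k), and zero for the others. *)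
pose w i : P 0%N := if i == en (inr k) then bq_inr B (pb_vec b (inr k)) *: p else 0.
have wa i a : bq_inl D (bq_arrow a) *: w i = 0.
  rewrite /w; case: eqP => _; last by rewrite scaler0.
  by rewrite scalerA inl_nontriv // vcoef_arrow // scal0 mul0r scale0r.
have wv i : bq_vertex BD i *: w i = w i.
  rewrite /w; case: eqP => [->|_]; last by rewrite scaler0.
  by rewrite scalerA -(bq_inr_vertex B D) -bq_inrM pb_vec_tgt.
have [F FE] := delta_hom_ex wa wv; exists F.
apply: (@delta_lin_eq _ (res_aug P \o F) (mklin (end_linear (end_basis (inr k))))) => i.
rewrite /= FE /w end_basisE; case: eqP => _; last exact: linear0.
by rewrite linearZ_LR pE.
Qed.

End StandardModules.


(** * Shapiro's isomorphism *)

Section ComparisonMaps.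
Variables (K : pzRingType) (R : pzAlgType K) (M : lmodType R).

Lemma comparison_ex (P Q : proj_resolution M) : exists s : forall i, {linear P i -> Q i},
  (forall i x, res_d Q i (s i.+1 x) = s i (res_d P i x)) /\
  (forall x, res_aug Q (s 0%N x) = res_aug P x).
Proof.
pose c i : {linear P i -> M} := match i with 0 => res_aug P | _ => \0 end.
have [|f [f0 fd _ _]] := @lift_ex _ _ _ P (res_of Q) c.
  by case=> [|i] x //=; rewrite res_augd.
by exists (fun i => f i i); split=> [i x|x]; [exact: fd | exact: f0].
Qed.

(** The difference s - 1 has a single diagonal; multiplying by the unit of the
    algebra of chain endomorphisms writes it as a matrix without transporting
    along equalities of indices. *)
Lemma self_homotopy (P : proj_resolution M) (s : forall i, {linear P i -> P i}) :
  (forall i x, res_d P i (s i.+1 x) = s i (res_d P i x)) ->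
  (forall x, res_aug P (s 0%N x) = res_aug P x) ->
  exists h : forall i, {linear P i -> P i.+1},
    (forall x, s 0%N x - x = res_d P 0 (h 0%N x)) /\
    (forall i x, s i.+1 x - x = res_d P i.+1 (h i.+1 x) + h i (res_d P i x)).
Proof.
move=> sd s0.
have [lc ct _ cd] := chain_endP (1 : chain_end P).
have lf i j : linear (fun x => (1 : chain_end P) i j (s i x - x)).
  by move=> a x y; rewrite -lc linearP scalerBr opprD addrACA.
pose f i j : {linear P i -> P j} := mklin (lf i j).
have fE i x : f i i x = s i x - x.
  by rewrite /= [LHS](chain_scal_funE 1 (s i x - x)) scal1 scale1r.
have [|||i x|h [_ h0 hS]] := @homotopy_ex _ _ _ P (res_of P) f (fun _ => \0).
- by move=> i j x ij; exact: ct.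
- by move=> i j x; rewrite /= cd linearB sd.
- by move=> x; rewrite fE linearB [X in X - _]s0 subrr.
- rewrite /= [X in res_aug P X](@chain_scal_fun_neq _ _ _ P 1 i.+1 0 _) //.
  exact: linear0.
exists (fun i => h i i.+1); split=> [x|i x]; rewrite -fE; [exact: h0 | exact: hS].
Qed.

End ComparisonMaps.

Section Shapiro.
Variables (K : fieldType) (n : nat) (B D : bound_quiver K n).
Hypothesis arB : rel_in_arrow_ideal B.
Hypothesis arD : rel_in_arrow_ideal D.
Hypothesis incB : forall a : arrow B, (src a < tgt a)%N.
Variable b : path_basis D.
Local Notation BD := (dual_ext B D).
Local Notation Lam := (bq_alg BD).
Local Notation th := (bq_inl D : {rmorphism bq_alg B -> Lam}).
Local Notation L := (simple_sum B).
Local Notation Delta := (standard_sum BD).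
Local Notation Ind := (ind arB arD b).
Local Notation eta := (eta arB arD b).
Local Notation iota := (iota D arB incB).
Local Notation st := (pb_src b).
Variables (T : proj_resolution L) (P : proj_resolution Delta).

(** Induction acts componentwise, and M |-> e_i M is exact. *)
Lemma ind_map_exact (M M' M'' : lmodType (bq_alg B)) (f : {linear M -> M'})
    (g : {linear M' -> M''}) :
  (forall v, g v = 0 -> exists u, v = f u) ->
  forall m : Ind M', ind_map arB arD b g m = 0 -> exists m', m = ind_map arB arD b f m'.
Proof.
move=> ex m m0.
have ex' x : exists u, ind_coord m x = f u.
  by apply: ex; rewrite -(ind_map_coord g) m0 ind_coord0.
have [u uE] := choice ex'.
have hu x : bq_vertex B (st x) *: (bq_vertex B (st x) *: u x) = bq_vertex B (st x) *: u x.
  by rewrite scalerA bq_vertexM eqxx.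
exists (mkInd hu : Ind M); apply: ind_coord_inj => x; rewrite ind_map_coord.
by rewrite [ind_coord (mkInd hu : Ind M) x](mkIndE hu) linearZ_LR -uE ind_coord_src.
Qed.

Lemma ind_map_comp0 (M M' M'' : lmodType (bq_alg B)) (f : {linear M -> M'})
    (g : {linear M' -> M''}) (m : Ind M) : (forall u, g (f u) = 0) ->
  ind_map arB arD b g (ind_map arB arD b f m) = 0.
Proof.
by move=> gf; apply: ind_coord_inj => x; rewrite !ind_map_coord gf ind_coord0.
Qed.

Local Notation Theta := (ind_to_delta arB arD incB b).
Local Notation Xi := (delta_to_ind arB arD b).

Definition ind_aug : {linear Ind (T 0%N) -> Delta} := Theta \o ind_map arB arD b (res_aug T).

Fact ind_aug_surj y : exists x, ind_aug x = y.
Proof.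
have [||x xE] := @ind_map_exact _ _ L (res_aug T) \0 _ (Xi y).
- by move=> v _; have [u <-] := res_aug_surj T v; exists u.
- by apply: ind_coord_inj => x; rewrite ind_map_coord ind_coord0.
by exists x; rewrite /= -xE delta_to_indK.
Qed.

Fact ind_exact0 x : ind_aug x = 0 <-> exists y, x = ind_map arB arD b (res_d T 0) y.
Proof.
split=> [x0|[y ->]]; last first.
  by rewrite /= ind_map_comp0 ?linear0 // => u; exact: res_augd.
apply: (@ind_map_exact _ _ _ _ (res_aug T)) => [v|]; first by move/res_exact0.
by rewrite -[LHS](ind_to_deltaK incB) [X in Xi X]x0 linear0.
Qed.

Fact ind_exact k x : ind_map arB arD b (res_d T k) x = 0 <->
  exists y, x = ind_map arB arD b (res_d T k.+1) y.
Proof.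
split=> [x0|[y ->]]; last by apply: ind_map_comp0 => u; exact: res_dd.
by apply: ind_map_exact x0 => v; move/res_exact.
Qed.

Definition ind_resolution : proj_resolution Delta :=
  @ProjResolution Lam Delta (fun k => Ind (T k)) (fun k => ind_map arB arD b (res_d T k))
    ind_aug (fun k => @ind_projective K n B D arB arD b (T k) (@res_proj _ _ T k)) ind_aug_surj ind_exact0 ind_exact.
Local Notation Q := ind_resolution.

Lemma ind_res_d k u : res_d Q k (eta _ u) = eta _ (res_d T k u).
Proof. exact: ind_map_eta. Qed.

Lemma ind_res_aug u : res_aug Q (eta _ u) = iota (res_aug T u).
Proof. by rewrite [LHS]/= ind_map_eta ind_to_delta_eta. Qed.

(** The induced resolution Q and P are homotopy equivalent, through s : Q -> P and
    r : P -> Q; sg is s restricted to 1 (x) T.  A cocycle c on T extends to Q by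
    the adjunction and is carried to P by r; the homotopies r s ~ 1 and s r ~ 1
    respectively give surjectivity and injectivity on cohomology. *)
Lemma shapiro : exists sg : forall i, {linear T i -> resm th (P i)},
  [/\ forall i x, res_d P i (sg i.+1 x) = sg i (res_d T i x),
      forall x, res_aug P (sg 0%N x) = iota (res_aug T x),
      forall c : forall i, {linear P i -> Delta}, cocycle (fun i => c i) ->
        @coboundary _ _ T (resm th Delta) (fun i x => c i (sg i x)) ->
        coboundary (fun i => c i)
    & forall c : forall i, {linear T i -> resm th Delta}, cocycle (fun i => c i) ->
        exists c' : forall i, {linear P i -> Delta},
        [/\ cocycle (fun i => c' i),
            forall i, (forall x, c i x = 0) -> forall x, c' i x = 0
          & @coboundary _ _ T (resm th Delta)
              (fun i x => (c' i (sg i x) : resm th Delta) - c i x)]].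
Proof.
have [s [sd s0]] := comparison_ex Q P.
have [r [rd r0]] := comparison_ex P Q.
have [||h [h0 hS]] := @self_homotopy _ _ _ P (fun i => s i \o r i).
- by move=> i x; rewrite /= sd rd.
- by move=> x; rewrite /= s0 r0.
have [||k [k0 kS]] := @self_homotopy _ _ _ Q (fun i => r i \o s i).
- by move=> i x; rewrite /= rd sd.
- by move=> x; rewrite [LHS]r0 s0.
exists (fun i => res_lin th (s i) \o eta (T i)); split.
- by move=> i x; rewrite [LHS]sd ind_res_d.
- by move=> x; rewrite [LHS]s0 ind_res_aug.
- move=> c cd [e [e0 eS]].
  have lb i : linear (fun x => ind_adj arB arD b (e i) (r i x) - c i.+1 (h i x)).
    by move=> a x y; rewrite !linearP scalerDr addrACA.
  have c0 x : c 0%N (s 0%N x) = 0.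
    by apply: (@ind_lin_eq _ _ _ _ _ _ _ _ _ (c 0%N \o s 0%N) \0) => u; exact: e0.
  have cS i x : c i.+1 (s i.+1 x) = ind_adj arB arD b (e i) (res_d Q i x).
    apply: (@ind_lin_eq _ _ _ _ _ _ _ _ _ (c i.+1 \o s i.+1)
      (ind_adj arB arD b (e i) \o res_d Q i)) => u.
    by rewrite [RHS]/= ind_map_eta ind_adjE -eS.
  exists (fun i => mklin (lb i)); split=> [x|i x].
    by have := congr1 (c 0%N) (h0 x); rewrite linearB cd [X in X - _]c0 sub0r => /eqP;
       rewrite oppr_eq0 => /eqP.
  have := congr1 (c i.+1) (hS i x); rewrite linearB linearD cd add0r [X in X - _]cS rd => E.
  by rewrite /= -E opprB addrC subrK.
move=> c cd; pose ct i := ind_adj arB arD b (c i).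
have ctd i x : ct i (res_d Q i x) = 0.
  apply: (@ind_lin_eq _ _ _ _ _ _ _ _ _ (ct i \o res_d Q i) \0) => u.
  by rewrite [LHS]/= ind_map_eta ind_adjE cd.
have ct0 i : (forall x, c i x = 0) -> forall x, ct i x = 0.
  move=> z; apply: (@ind_lin_eq _ _ _ _ _ _ _ _ _ (ct i) \0) => u.
  by rewrite ind_adjE z.
exists (fun i => ct i \o r i); split=> [i x|i z x|].
- by rewrite /= -rd ctd.
- exact: ct0.
exists (fun i => res_lin th (ct i.+1 \o k i) \o eta (T i)); split=> [x|i x].
  have := congr1 (ct 0%N) (k0 (eta _ x)); rewrite ctd linearB ind_adjE => E.
  exact: E.
have := congr1 (ct i.+1) (kS i (eta _ x)); rewrite linearB linearD ctd add0r ind_adjE.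
by rewrite ind_res_d => E; exact: E.
Qed.

End Shapiro.


Lemma rmorph_inv_ex (K : pzRingType) (A B : pzAlgType K) (h : {rmorphism A -> B}) :
  alg_iso h -> exists f : {rmorphism B -> A},
    [/\ alg_iso f, cancel h f & cancel f h].
Proof.
move=> [[f hf fh] hs].
have fB : zmod_morphism f by move=> x y; apply: (can_inj hf); rewrite rmorphB !fh.
have fM : monoid_morphism f.
  split; first by apply: (can_inj hf); rewrite fh rmorph1.
  by move=> x y; apply: (can_inj hf); rewrite rmorphM !fh.
pose mB := GRing.isZmodMorphism.Build _ _ f fB.
pose mM := GRing.isMonoidMorphism.Build _ _ f fM.
exists (HB.pack f mB mM : {rmorphism B -> A}); split=> //; split; first by exists h.
by move=> c; apply: (can_inj hf); rewrite hs fh.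
Qed.

Lemma bq_homog0_all (K : fieldType) n (H : bound_quiver K n) (x : bq_alg H) :
  bq_homog (fun=> 0%N) 0 x.
Proof.
have [p <-] := qalg_pi_surj x; exists p => // i s _.
by rewrite big1.
Qed.

(** * The Ext algebra of the standard modules *)

Section MainIso.
Variables (K : fieldType) (n : nat) (B D : bound_quiver K n).
Hypothesis arB : rel_in_arrow_ideal B.
Hypothesis arD : rel_in_arrow_ideal D.
Hypothesis incB : forall a : arrow B, (src a < tgt a)%N.
Variable b : path_basis D.
Local Notation BD := (dual_ext B D).
Local Notation Lam := (bq_alg BD).
Local Notation th := (bq_inl D : {rmorphism bq_alg B -> Lam}).
Local Notation L := (simple_sum B).
Local Notation Delta := (standard_sum BD).
Local Notation iota := (iota D arB incB).
Local Notation st := (pb_src b).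
Local Notation en := (pb_tgt b).
Variables (T : proj_resolution L) (P : proj_resolution Delta).
Variables (X : bound_quiver K n) (w : arrow X -> nat)
  (phi : {rmorphism bq_alg X -> ext_alg T}).
Hypothesis arX : rel_in_arrow_ideal X.
Hypothesis phi_iso : graded_iso (bq_homog w) (ext_homog T) phi.
Hypothesis phi_vertex : forall i, ext_of_hom T (dsum_id i) (phi (bq_vertex X i)).
Variables (H : bound_quiver K n) (psi : {rmorphism bq_alg H -> endalg Delta}).
Hypothesis arH : rel_in_arrow_ideal H.
Hypothesis psi_iso : alg_iso psi.
Hypothesis psi_vertex : forall i x, psi (bq_vertex H i) x = dsum_id i x.

Local Notation u := (@end_basis K n B D arB arD incB b).
Local Notation idx := ('I_n + 'I_(pb_size b))%type.
Local Notation proj := (@delta_proj K n B D arB arD b).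
Local Notation piP := (qalg_pi (@null_homotopic K Lam Delta P)).
Local Notation piT := (qalg_pi (@null_homotopic K (bq_alg B) L T)).

Lemma psi_vertexE i : psi (bq_vertex H i) = end_id B D i.
Proof. by apply: endP => m; rewrite psi_vertex. Qed.

Lemma end_basis_ends (x : idx) : u x = end_id B D (st x) * u x * end_id B D (en x).
Proof.
apply: end_delta_eq => i.
rewrite [RHS](_ : _ = end_id B D (st x) (u x (end_id B D (en x) (dvec B D i)))) //.
rewrite end_basisE end_id_dvec; case: (eqVneq i (en x)) => [->|ix].
  by rewrite end_basisE eqxx /bvec endZ end_id_dvec eqxx.
by rewrite !end0.
Qed.

Lemma dsum_id_iota i m : dsum_id i (iota m : Delta) = iota (dsum_id i m).
Proof.
have := @end_basis_iota K n B D arB arD incB b (inl i) m.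
rewrite end_basis_triv pb_tgtl bvec_triv => E.
rewrite [LHS]E iotaE (bigD1 i) //= scoef_dsum_id // eqxx mul1r big1 ?addr0 // => j ji.
by rewrite scoef_dsum_id // (negbTE ji) mul0r scal0 scale0r.
Qed.

(** I is the map Ext_B(L, L) -> Ext_Lambda(Delta, Delta) given by [transfer_ex], J
    the embedding of End Delta as the classes of degree 0, and h, below, the
    morphism induced by I and J on the dual extension. *)
Variables (sg : forall i, {linear T i -> resm th (P i)}).
Hypothesis sg_d : forall i x, res_d P i (sg i.+1 x) = sg i (res_d T i x).
Hypothesis sg_aug : forall x, res_aug P (sg 0%N x) = iota (res_aug T x).
Hypothesis sh_inj : forall c : forall i, {linear P i -> Delta},
  cocycle (fun i => c i) ->
  @coboundary _ _ T (resm th Delta) (fun i x => c i (sg i x)) -> coboundary (fun i => c i).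

Local Notation transf := (transfers sg iota).
Hypothesis tr_total : forall f : chain_end T, exists g : chain_end P, transf f g /\
  forall k, chain_homog k f -> chain_homog k g.
Variable I : {rmorphism ext_alg T -> ext_alg P}.
Hypothesis I_scal : kalg_morph I.
Hypothesis I_tr : forall f g, transf f g -> I (piT f) = piP g.
Variable J : {rmorphism endalg Delta -> ext_alg P}.
Hypothesis J_scal : kalg_morph J.
Hypothesis J_hom : forall v x, ext_of_hom P (end_fun v) x -> J v = x.

Definition lifts (v : endalg Delta) (g : chain_end P) :=
  chain_homog 0 g /\ forall y, res_aug P (g 0%N 0%N y) = v (res_aug P y).

Lemma lifts_ex v : exists2 g, J v = piP g & lifts v g.
Proof.
have [x [g [hg gv xE]]] := hom_ext_total P v; exists g.
  by rewrite -xE; apply: J_hom; exists g; split.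
by split=> // i j y; rewrite addn0; exact: hg.
Qed.

Lemma lifts_mul v g f i y : lifts v g ->
  res_aug P ((g * f : chain_end P) i 0%N y) = v (res_aug P (f i 0%N y)).
Proof.
move=> [hg gv]; rewrite chain_mulE big_ord_recl linearD gv big1 ?linear0 ?addr0 //.
by move=> j _; rewrite hg.
Qed.

Lemma I_J_vertex i : I (phi (bq_vertex X i)) = J (psi (bq_vertex H i)).
Proof.
have [f [hf fv ->]] := phi_vertex i.
have [g -> [hg gv]] := lifts_ex (psi (bq_vertex H i)).
apply: I_tr; apply: coboundary0 => -[|k] x; last first.
  by rewrite hg // hf // !linear0 addr0.
by rewrite gv fv sg_aug psi_vertex dsum_id_iota subrr.
Qed.

(** A class of degree 0 is an endomorphism of L.  It preserves each e_i L, which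
    is one-dimensional, so it is a combination of the projections. *)
Lemma ext_deg0 x : ext_homog T 0 x ->
  exists c : 'I_n -> K, x = \sum_i scal (c i) * phi (bq_vertex X i).
Proof.
move=> [f hf ->].
have tex i : exists t, res_aug T t = svec B i by exact: res_aug_surj.
have [t tE] := choice tex.
pose c i := scoef i (res_aug T (f 0%N 0%N (t i))).
exists c; have [e eE] := choice (fun i => let: ex_intro e he := phi_vertex i in ex_intro _ e he).
transitivity (piT (\sum_i scal (c i) * e i)); last first.
  rewrite qalg_pi_sum; apply: eq_bigr => i _; rewrite qalg_piM.
  by have [_ _ ->] := eE i.
have augsum k y : res_aug T ((\sum_i scal (c i) * e i : chain_end T) k 0%N y) =
    \sum_i (scal (c i) : bq_alg B) *: res_aug T (e i k 0%N y).
  by rewrite aug_sumE; apply: eq_bigr => i _; rewrite chain_scalE linearZ_LR.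
apply: ext_eq => -[|k] y; rewrite augsum; last first.
  rewrite hf // linear0 big1 // => i _; have [he _ _] := eE i.
  by rewrite he // linear0 scaler0.
pose z := \sum_i (scal (scoef i (res_aug T y)) : bq_alg B) *: t i.
have augz : res_aug T z = res_aug T y.
  rewrite linear_sum [RHS](simple_expand arB); apply: eq_bigr => i _.
  by rewrite linearZ_LR tE.
have : res_aug T (y - z) = 0 by rewrite linearB augz subrr.
case/res_exact0 => y' yz.
have : res_aug T (f 0%N 0%N (y - z)) = 0 by rewrite yz -chain_comm res_augd.
have fB : f 0%N 0%N (y - z) = f 0%N 0%N y - f 0%N 0%N z by exact: (linearB (chain_lin f 0 0)).
rewrite fB linearB => /eqP; rewrite subr_eq0 => /eqP ->.
have -> : f 0%N 0%N z = \sum_i (scal (scoef i (res_aug T y)) : bq_alg B) *: f 0%N 0%N (t i).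
  by rewrite chain_sum; apply: eq_bigr => i _; rewrite chainZ.
rewrite linear_sum; apply: eq_bigr => i _; have [_ -> _] := eE i.
rewrite linearZ_LR; apply: (simple_eqP arB) => j.
have tti : bq_vertex B i *: res_aug T (f 0%N 0%N (t i)) = res_aug T (f 0%N 0%N (t i)).
  rewrite -linearZ_LR -chainZ.
  have : res_aug T (bq_vertex B i *: t i - t i) = 0.
    rewrite linearB linearZ_LR tE svec_act // vcoef_vertex // eqxx.
    by rewrite scal1 scale1r subrr.
  case/res_exact0 => s ts.
  have : res_aug T (f 0%N 0%N (bq_vertex B i *: t i - t i)) = 0.
    by rewrite ts -chain_comm res_augd.
  have fB' : f 0%N 0%N (bq_vertex B i *: t i - t i) =
    f 0%N 0%N (bq_vertex B i *: t i) - f 0%N 0%N (t i) by exact: (linearB (chain_lin f 0 0)).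
  by rewrite fB' linearB => /eqP; rewrite subr_eq0 => /eqP.
rewrite !scoefZ // !vcoef_scal // scoef_dsum_id // -tti scoefZ // vcoef_vertex //.
rewrite /c; case: eqP => [->|_]; last by rewrite !mul0r !mulr0.
by rewrite !mul1r mulrC.
Qed.

(** The arrow is a combination of vertices by [ext_deg0], and no relation of X
    involves a vertex, so the coefficients vanish. *)
Lemma weight0_arrow a : w a = 0%N -> bq_arrow a = 0 :> bq_alg X.
Proof.
move=> wa; have [[phi_bij phi_scal] phi_gr] := phi_iso.
have /ext_deg0 [c cE] : ext_homog T 0 (phi (bq_arrow a)).
  by apply/phi_gr; rewrite -wa; exact: bq_homog_arrow.
have aE : bq_arrow a = \sum_i scal (c i) * bq_vertex X i.
  apply: (bij_inj phi_bij); rewrite cE rmorph_sum; apply: eq_bigr => i _.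
  by rewrite rmorphM phi_scal.
rewrite aE big1 // => j _; have := vcoef_arrow arX j a; rewrite aE.
rewrite (big_morph _ (vcoefD arX j) (vcoef0 arX j)) (bigD1 j) //= big1 ?addr0.
  by rewrite vcoefM // vcoef_scal // vcoef_vertex // eqxx mulr1 => ->; rewrite scal0 mul0r.
by move=> i ij; rewrite vcoefM // vcoef_vertex // eq_sym (negbTE ij) mulr0.
Qed.

(** In the expansion of the arrow on the basis of End Delta, the coefficient at a
    vertex is its value under [vcoef], because a nontrivial basis element has
    different ends.  This value is zero, as [vcoef] vanishes on arrows. *)
Lemma psi_arrow (d : arrow H) : exists c : 'I_(pb_size b) -> K,
  psi (bq_arrow d) = \sum_k scal (c k) * u (inr k).
Proof.
have [psi' [[psi'_bij psi'_scal] psiK psi'K]] := rmorph_inv_ex psi_iso.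
pose c (x : idx) := mu arB arD x (psi (bq_arrow d) (dvec B D (en x))).
have dE : bq_arrow d = \sum_x scal (c x) * psi' (u x).
  rewrite -[LHS]psiK (end_expand arB arD incB b (psi (bq_arrow d))) rmorph_sum.
  by apply: eq_bigr => x _; rewrite rmorphM psi'_scal.
have id' i : psi' (end_id B D i) = bq_vertex H i by rewrite -psi_vertexE psiK.
have c0 i : c (inl i) = 0.
  have := vcoef_arrow arH i d; rewrite dE.
  rewrite (big_morph _ (vcoefD arH i) (vcoef0 arH i)) sum_sumE [X in _ + X]big1 ?addr0.
    rewrite (bigD1 i) //= big1 ?addr0.
      by rewrite end_basis_triv id' vcoefM // vcoef_scal // vcoef_vertex // eqxx mulr1.
    move=> j ji; rewrite end_basis_triv id' vcoefM // vcoef_vertex // eq_sym.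
    by rewrite (negbTE ji) mulr0.
  move=> k _; rewrite end_basis_ends !rmorphM !id' !vcoefM // !vcoef_vertex //.
  have := pb_lt b k; case: (eqVneq i (st (inr k))) => [->|_]; last by rewrite !mul0r mulr0.
  by case: eqVneq => [->|_]; rewrite ?ltnn // !mulr0.
exists (fun k => c (inr k)).
rewrite [LHS](end_expand arB arD incB b) sum_sumE big1 ?add0r // => i _.
by rewrite -/(c (inl i)) c0 scal0 mul0r.
Qed.

(** The radical endomorphism factors through P_0, so it lifts to a chain map with a
    single component P_0 -> P_0; a chain map of positive degree vanishes there. *)
Lemma pos_degree_after_radical (f : chain_end P) m k : chain_homog m.+1 f -> piP f * J (u (inr k)) = 0.
Proof.
move=> hf; have [F FE] := @end_basis_factor K n B D arB arD incB b P k.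
pose g i j (x : P i) : P j :=
  (match i, j return P i -> P j with 0, 0 => fun x => F (res_aug P x) | _, _ => fun=> 0 end) x.
have hg : is_chain_end g.
  split.
  - by move=> [|i] [|j] a x y /=; rewrite ?scaler0 ?addr0 // !linearP.
  - by move=> [|i] [|j].
  - by exists 0%N => -[|i] [|j].
  by move=> [|i] [|j] x /=; rewrite ?res_augd !linear0.
have -> : J (u (inr k)) = piP (mkChain hg).
  apply: J_hom; exists (mkChain hg); split=> // [[|i] [|j] //|y].
  by rewrite [LHS]FE.
rewrite -rmorphM; apply/ext_eq0/coboundary0 => i x.
rewrite aug_cocycleE chain_mulE big1 ?linear0 // => j _.
have -> : (mkChain hg) i j x = g i j x by [].
case: i j x => [|i] [[|j] ij] x //; first by rewrite hf.
  by rewrite /g chain0.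
by rewrite /g chain0.
Qed.

Lemma I_J_arrow a d : I (phi (bq_arrow a)) * J (psi (bq_arrow d)) = 0.
Proof.
case E: (w a) => [|m]; first by rewrite weight0_arrow // !rmorph0 mul0r.
have [_ phi_gr] := phi_iso.
have [f hf ->] : ext_homog T m.+1 (phi (bq_arrow a)).
  by apply/phi_gr; rewrite -E; exact: bq_homog_arrow.
have [g [tg /(_ _ hf) hg]] := tr_total f; rewrite (I_tr tg).
have [c ->] := psi_arrow d; rewrite rmorph_sum mulr_sumr big1 // => k _.
by rewrite rmorphM J_scal mulrA -scal_comm -mulrA (pos_degree_after_radical _ hg) mulr0.
Qed.

Variable h : {rmorphism bq_alg (dual_ext X H) -> ext_alg P}.
Hypothesis h_scal : kalg_morph h.
Hypothesis h_inl : forall x, h (bq_inl H x) = I (phi x).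
Hypothesis h_inr : forall y, h (bq_inr X y) = J (psi y).

Lemma h_homog k x : bq_homog (dual_ext_weight X H w) k x -> ext_homog P k (h x).
Proof.
apply: bq_homog_map => //; first exact: ext_homog_graded.
  move=> i; rewrite -(bq_inr_vertex X H) h_inr.
  by have [g -> [hg _]] := lifts_ex (psi (bq_vertex H i)); exists g.
case=> [a|d]; last first.
  rewrite -(bq_inr_arrow X) h_inr.
  by have [g -> [hg _]] := lifts_ex (psi (bq_arrow d)); exists g.
rewrite -(bq_inl_arrow H) h_inl; have [_ phi_gr] := phi_iso.
have /phi_gr [f hf ->] := bq_homog_arrow w a.
by have [g [/I_tr -> hg]] := tr_total f; exists g => //; exact: hg.
Qed.

Lemma psi_surj v : exists y, psi y = v.
Proof. by have [[g _ gK] _] := psi_iso; exists (g v). Qed.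
Lemma phi_surj x : exists y, phi y = x.
Proof. by have [[[g _ gK] _] _] := phi_iso; exists (g x). Qed.

Lemma psi_basis_ex : exists vH : idx -> bq_alg H, forall x, psi (vH x) = u x.
Proof. by have [v vE] := choice (fun x : idx => psi_surj (u x)); exists v. Qed.

Lemma dual_ext_normal_form (vH : idx -> bq_alg H) y : (forall x, psi (vH x) = u x) ->
  exists z : idx -> bq_alg X, y = \sum_x bq_inr X (vH x) * bq_inl H (z x).
Proof.
move=> vHE; elim/dual_ext_ind: y => [|y y' [z ->] [z' ->]|a c].
- by exists (fun=> 0); rewrite big1 // => x _; rewrite rmorph0 mulr0.
- exists (fun x => z x + z' x); rewrite -big_split; apply: eq_bigr => x _.
  by rewrite rmorphD mulrDr.
pose e x := mu arB arD x (psi a (dvec B D (en x))).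
have aE : a = \sum_x scal (e x) * vH x.
  have [psi_bij psi_scal] := psi_iso; apply: (bij_inj psi_bij).
  rewrite [LHS](end_expand arB arD incB b) rmorph_sum; apply: eq_bigr => x _.
  by rewrite rmorphM psi_scal vHE.
exists (fun x => scal (e x) * c); rewrite {1}aE bq_inr_sum mulr_suml.
apply: eq_bigr => x _; rewrite bq_inlM bq_inrM bq_inl_scal bq_inr_scal.
by rewrite mulrA -scal_comm.
Qed.

(** On cocycles over B, the product u_x I(c_x) is u_x iota c_x. *)
Lemma sum_transfer (ft : idx -> chain_end T) (gt ge : idx -> chain_end P) :
  (forall x, transf (ft x) (gt x)) -> (forall x, lifts (u x) (ge x)) ->
  @coboundary _ _ T (resm th Delta) (fun i y =>
    (res_aug P ((\sum_x ge x * gt x : chain_end P) i 0%N (sg i y)) : resm th Delta)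
    - \sum_x u x (iota (res_aug T (ft x i 0%N y)))).
Proof.
move=> tr le.
have H1 x := coboundary_comp (res_lin th (mklin (end_linear (u x)))) (tr x).
apply: coboundary_ext (coboundary_sum (index_enum _) H1) => i y.
rewrite aug_sumE -sumrB; apply: eq_bigr => x _.
rewrite (@lifts_mul _ _ _ _ _ (le x)).
exact: (linearB (mklin (end_linear (u x)))).
Qed.

(** The cocycle of f, restricted to T, takes values in Delta over B; its component
    along the summand of x is a cocycle with values in L, hence the class of some
    z_x. *)
Lemma ext_class_decomposition (f : chain_end P) : exists y, piP f = h y /\
  forall k, chain_homog k f -> bq_homog (dual_ext_weight X H w) k y.
Proof.
have [vH vHE] := psi_basis_ex.
have [[phi_bij phi_scal] phi_gr] := phi_iso.
pose c i : {linear T i -> resm th Delta} := res_lin th (aug_cocycle f i) \o sg i.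
have cE i y : c i y = res_aug P (f i 0%N (sg i y)) by [].
have cd i y : c i (res_d T i y) = 0 by rewrite cE -sg_d -chain_comm res_augd.
have ex x : exists t : chain_end T, (forall i y, res_aug T (t i 0%N y) = proj x (c i y)) /\
    forall k, chain_homog k f -> chain_homog k t.
  have [||t [tE th']] := @chain_of_cocycle _ _ _ T (fun i => proj x \o c i).
  - by move=> i y; exact: etrans (congr1 (proj x) (cd i y)) (linear0 _).
  - have [_ _ [N fN] _] := chain_endP f; exists N => i y Ni.
    have c0 : c i y = 0 by rewrite cE fN ?linear0.
    exact: etrans (congr1 (proj x) c0) (linear0 _).
  exists t; split=> // k hf; apply: th' => i y ik.
  have c0 : c i y = 0 by rewrite cE hf ?linear0.
  exact: etrans (congr1 (proj x) c0) (linear0 _).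
have [ft ftE] := choice ex.
have [z zE] := choice (fun x => phi_surj (piT (ft x))).
have [gt gtE] := choice (fun x => tr_total (ft x)).
have lex x : exists g, J (u x) = piP g /\ lifts (u x) g.
  by have [g gE lg] := lifts_ex (u x); exists g.
have [ge geE] := choice lex.
exists (\sum_x bq_inr X (vH x) * bq_inl H (z x)); split; last first.
  move=> k hf; have [z0 zD zZ zM] := bq_homog_graded (dual_ext_weight X H w).
  apply: (big_ind (bq_homog _ k)) => // [x y|x _]; first exact: zD.
  rewrite -[k]add0n; apply: zM.
    apply: (@bq_homog_map K n H (fun=> 0%N) _ _ (bq_inr X)) (bq_homog0_all _).
    - exact: bq_homog_graded.
    - exact: bq_inr_scal.
    - by move=> i; have := bq_homog_vertex (dual_ext_weight X H w) i; rewrite -(bq_inr_vertex X H).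
    by move=> d; have := bq_homog_arrow (dual_ext_weight X H w) (inr d); rewrite -(bq_inr_arrow X).
  apply: (@bq_homog_map K n X w _ _ (bq_inl H)).
  - exact: bq_homog_graded.
  - exact: bq_inl_scal.
  - by move=> i; have := bq_homog_vertex (dual_ext_weight X H w) i; rewrite -(bq_inl_vertex X H).
  - by move=> d; have := bq_homog_arrow (dual_ext_weight X H w) (inl d); rewrite -(bq_inl_arrow H).
  by apply/phi_gr; rewrite zE; exists (ft x) => //; exact: (ftE x).2.
rewrite rmorph_sum; transitivity (piP (\sum_x ge x * gt x)); last first.
  rewrite qalg_pi_sum; apply: eq_bigr => x _; rewrite qalg_piM rmorphM h_inl h_inr vHE zE.
  by rewrite (geE x).1 (I_tr (gtE x).1).
apply/eqP; rewrite -subr_eq0 -rmorphB; apply/eqP/ext_eq0/sh_inj; first exact: aug_cocycleP.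
have := coboundaryN (sum_transfer (fun x => (gtE x).1) (fun x => (geE x).2)).
apply: coboundary_ext => i y; rewrite aug_cocycleE chain_subE opprB [RHS]linearB; congr (_ - _).
transitivity (\sum_x u x (iota (proj x (c i y)))); last by rewrite delta_split.
by apply: eq_bigr => x _; rewrite (ftE x).1.
Qed.

(** If the sum of the u_x I(z_x) vanishes, then projecting the cocycle to the
    summand of x shows that the part of z_x ending at the vertex of that summand is
    a coboundary; the remaining part of z_x is killed by u_x. *)
Lemma h_inj : injective h.
Proof.
suff ker y : h y = 0 -> y = 0.
  by move=> y y' E; apply/eqP; rewrite -subr_eq0; apply/eqP/ker; rewrite rmorphB E subrr.
have [vH vHE] := psi_basis_ex.
have [[phi_bij phi_scal] phi_gr] := phi_iso.
have [psi_bij psi_scal] := psi_iso.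
have [z ->] := dual_ext_normal_form y vHE => hy.
have [ft ftE] := choice (fun x => qalg_pi_surj (phi (z x))).
have [gt gtE] := choice (fun x => tr_total (ft x)).
have lex x : exists g, J (u x) = piP g /\ lifts (u x) g.
  by have [g gE lg] := lifts_ex (u x); exists g.
have [ge geE] := choice lex.
have : piP (\sum_x ge x * gt x) = 0.
  rewrite -hy qalg_pi_sum rmorph_sum; apply: eq_bigr => x _.
  by rewrite qalg_piM rmorphM h_inl h_inr vHE -ftE (geE x).1 (I_tr (gtE x).1).
case/ext_eq0 => e [e0 eS].
have cob : @coboundary _ _ T (resm th Delta) (fun i y =>
    (res_aug P ((\sum_x ge x * gt x : chain_end P) i 0%N (sg i y)) : resm th Delta)).
  exists (fun i => res_lin th (e i) \o sg i); split=> [x|i x]; first exact: e0.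
  by rewrite /= -sg_d -eS.
have cob' := coboundaryB cob (sum_transfer (fun x => (gtE x).1) (fun x => (geE x).2)).
apply: big1 => x _.
(* u_x starts at the vertex en x, so it only sees the part of z_x ending there. *)
suff zx : bq_vertex X (en x) * z x = 0.
  have -> : vH x = vH x * bq_vertex H (en x).
    have idid i : end_id B D i * end_id B D i = end_id B D i.
      by rewrite -psi_vertexE -rmorphM bq_vertexM eqxx.
    apply: (bij_inj psi_bij); rewrite rmorphM psi_vertexE vHE.
    by rewrite {1 2}end_basis_ends -[RHS]mulrA idid.
  by rewrite bq_inrM bq_inr_vertex -(bq_inl_vertex X H) -mulrA -bq_inlM zx rmorph0 mulr0.
apply: (bij_inj phi_bij); rewrite rmorph0 rmorphM -ftE.
have [f [hf fv ->]] := phi_vertex (en x); rewrite -qalg_piM; apply/ext_eq0.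
apply: coboundary_ext (coboundary_comp (proj x) cob') => i y'.
rewrite aug_cocycleE chain_mulE big_ord_recl [RHS]linearD fv [X in _ = _ + res_aug T X]big1 ?linear0 ?addr0; last first.
  by move=> j _; rewrite hf.
rewrite opprB addrC subrK linear_sum (bigD1 x) // big1 ?addr0.
  rewrite [LHS]addr0 [LHS](@delta_proj_basis K n B D arB arD incB b x x) eqxx //.
move=> x' /negbTE xx.
by rewrite [LHS](@delta_proj_basis K n B D arB arD incB b x' x) xx.
Qed.

Lemma ext_alg_iso : exists f : {rmorphism ext_alg P -> bq_alg (dual_ext X H)},
  graded_iso (ext_homog P) (bq_homog (dual_ext_weight X H w)) f.
Proof.
have hb : alg_iso h.
  split=> //; have hs x : exists y, h y = x.
    by have [f <-] := qalg_pi_surj x; have [y [-> _]] := ext_class_decomposition f; exists y.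
  have [g gE] := choice hs; exists g => // y; apply: h_inj; exact: gE.
have [f [fi hK fK]] := rmorph_inv_ex hb; exists f; split=> // k x; split.
  by case=> e he ->; have [y [-> hy]] := ext_class_decomposition e; rewrite hK; exact: hy.
by move/h_homog; rewrite fK.
Qed.

End MainIso.


(** * Functoriality of the dual extension *)

Section DualExtensionFunctor.
Variables (K : fieldType) (n : nat) (X H A : bound_quiver K n) (w : arrow X -> nat).
Hypothesis arA : rel_in_arrow_ideal A.
Variable ka : {rmorphism bq_alg H -> bq_alg A}.
Hypothesis ka_scal : kalg_morph ka.
Hypothesis ka_vertex : forall i, ka (bq_vertex H i) = bq_vertex A i.
Hypothesis ka_arrow : forall d i, vcoef i (ka (bq_arrow d)) = 0.

(** The defining relations say that arrow times arrow is zero; this extends to the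
    whole arrow ideal, and so does not depend on the choice of the arrows of A. *)
Lemma inl_arrow_inr (a : arrow X) (y : bq_alg A) :
  bq_inl A (bq_arrow a) * bq_inr X y = scal (vcoef (src a) y) * bq_inl A (bq_arrow a).
Proof.
elim/bq_alg_ind: y => [|p q Ep Eq|c p Ep|j|d p Ep].
- by rewrite vcoef0 // scal0 rmorph0 mulr0 mul0r.
- by rewrite vcoefD // scalD rmorphD mulrDr mulrDl Ep Eq.
- rewrite vcoefM // vcoef_scal // scalM bq_inrM bq_inr_scal [LHS]mulrA -scal_comm.
  by rewrite -[LHS]mulrA Ep mulrA.
- rewrite bq_inr_vertex -(bq_inl_vertex X A) -bq_inlM bq_arrow_vertex vcoef_vertex //.
  by rewrite eq_sym; case: eqP => _; rewrite ?scal1 ?scal0 ?mul1r ?mul0r ?rmorph0.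
by rewrite bq_inrM mulrA bq_inl_inr_arrow mul0r vcoefM // vcoef_arrow // mul0r scal0 mul0r.
Qed.

Lemma dual_ext_map_ex : exists g : {rmorphism bq_alg (dual_ext X H) -> bq_alg (dual_ext X A)},
  [/\ kalg_morph g, forall x, g (bq_inl H x) = bq_inl A x,
      forall y, g (bq_inr X y) = bq_inr X (ka y)
    & forall k x, bq_homog (dual_ext_weight X H w) k x ->
        bq_homog (dual_ext_weight X A w) k (g x)].
Proof.
pose f2 : {rmorphism bq_alg H -> bq_alg (dual_ext X A)} := bq_inr X \o ka.
have [|||a d|g [gs gl gr]] := @dual_ext_rmorph_ex K n X H _ (bq_inl A) f2.
- exact: bq_inl_scal.
- by move=> c; rewrite /= ka_scal bq_inr_scal.
- by move=> i; rewrite /= ka_vertex [RHS]bq_inr_vertex; exact: bq_inl_vertex.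
- by rewrite [LHS]inl_arrow_inr ka_arrow scal0 mul0r.
exists g; split=> //; apply: bq_homog_map => //; first exact: bq_homog_graded.
  move=> i; rewrite -(bq_inl_vertex X H) gl.
  by have := bq_homog_vertex (dual_ext_weight X A w) i; rewrite -(bq_inl_vertex X A).
case=> [a|d].
  rewrite -(bq_inl_arrow H) gl.
  by have := bq_homog_arrow (dual_ext_weight X A w) (inl a); rewrite -(bq_inl_arrow A).
rewrite -(bq_inr_arrow X) gr.
apply: (@bq_homog_map K n A (fun=> 0%N) _ _ (bq_inr X)) (bq_homog0_all _).
- exact: bq_homog_graded.
- exact: bq_inr_scal.
- by move=> i; have := bq_homog_vertex (dual_ext_weight X A w) i; rewrite -(bq_inr_vertex X A).
by move=> e; have := bq_homog_arrow (dual_ext_weight X A w) (inr e); rewrite -(bq_inr_arrow X).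
Qed.
End DualExtensionFunctor.

(** A dual extension depends on its second algebra only through the vertices and
    the arrow ideal, which an isomorphism preserves under the last two hypotheses. *)
Lemma dual_ext_iso (K : fieldType) n (X H A : bound_quiver K n) (w : arrow X -> nat)
    (ka : {rmorphism bq_alg H -> bq_alg A}) :
  rel_in_arrow_ideal H -> rel_in_arrow_ideal A -> alg_iso ka ->
  (forall i, ka (bq_vertex H i) = bq_vertex A i) ->
  (forall d i, vcoef i (ka (bq_arrow d)) = 0) ->
  (forall y a i, ka y = bq_arrow a -> vcoef i y = 0) ->
  exists g : {rmorphism bq_alg (dual_ext X H) -> bq_alg (dual_ext X A)},
    graded_iso (bq_homog (dual_ext_weight X H w)) (bq_homog (dual_ext_weight X A w)) g.
Proof.
move=> arH arA ka_iso kv ka1 ka2.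
have [al [[_ al_scal] kaK alK]] := rmorph_inv_ex ka_iso.
have [_ ka_scal] := ka_iso.
have [g [gs gl gr gh]] := dual_ext_map_ex w arA ka_scal kv ka1.
have av i : al (bq_vertex A i) = bq_vertex H i by rewrite -kv kaK.
have aa d i : vcoef i (al (bq_arrow d)) = 0 by apply: (ka2 _ d); rewrite alK.
have [f [fs fl fr fh]] := dual_ext_map_ex w arH al_scal av aa.
have gK : cancel g f.
  apply: (@dual_ext_rmorph_eq K n X H _ (f \o g) idfun) => [c|//|x|y] /=.
  - by rewrite gs fs.
  - by rewrite gl fl.
  by rewrite gr fr kaK.
have fK : cancel f g.
  apply: (@dual_ext_rmorph_eq K n X A _ (g \o f) idfun) => [c|//|x|y] /=.
  - by rewrite fs gs.
  - by rewrite fl gl.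
  by rewrite fr gr alK.
exists g; split=> [|k x]; first by split=> //; exists f.
by split=> [|/fh]; [exact: gh | rewrite gK].
Qed.

(** * Opposite quivers *)

Section OppositePaths.
Variables (K : fieldType) (n : nat) (Q : quiver n).
Local Notation Qop := (op_quiver Q).
Implicit Types p q : pathalg K Q.

Lemma op_pathE p i s : path_op p i s =
  if @is_path n Qop i s then p (@path_end n Qop i s) (rev s) else 0.
Proof. by []. Qed.

Lemma rev_path i (s : seq (arrow Q)) : is_path i s ->
  @is_path n Qop (path_end i s) (rev s) /\ @path_end n Qop (path_end i s) (rev s) = i.
Proof.
elim: s i => [|a s IH] i //= /andP[/eqP <- /IH [h1 h2]].
rewrite rev_cons -cats1 is_path_cat path_end_cat.
by rewrite [path_end (src a) _](_ : _ = path_end (tgt a) s) // h1 h2 /= eqxx.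
Qed.

Lemma rev_path_op i (s : seq (arrow Q)) : @is_path n Qop i s ->
  is_path (@path_end n Qop i s) (rev s) /\ path_end (@path_end n Qop i s) (rev s) = i.
Proof.
elim: s i => [|a s IH] i //= /andP[/eqP <- /IH [h1 h2]].
rewrite rev_cons -cats1 is_path_cat path_end_cat.
rewrite [@path_end n Qop (tgt a) _](_ : _ = @path_end n Qop (src a) s) //.
by rewrite h1 h2 /= eqxx.
Qed.

Lemma path_op_elt i (s : seq (arrow Q)) : is_path i s ->
  path_op (path_elt K i s) = @path_elt K n Qop (path_end i s) (rev s).
Proof.
move=> hs; have [h1 h2] := rev_path hs.
apply: pathP => j t; rewrite op_pathE !coef_elt h1 hs /=.
case: ifP => [ht|ht].
  congr (nat_of_bool _)%:R; apply/andP/andP => [[/eqP e /eqP st]|[/eqP -> /eqP ->]].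
    by have [_ e'] := rev_path_op ht; rewrite -st revK -e e' !eqxx.
  by rewrite h2 revK !eqxx.
by case: andP => // -[/eqP e1 /eqP e2]; rewrite e1 e2 h1 in ht.
Qed.

Fact path_op_zmod : zmod_morphism (@path_op K n Q).
Proof.
by move=> p q; apply: pathP => i s; rewrite op_pathE [RHS](_ : _ = path_op p i s - path_op q i s) //
  !op_pathE; case: ifP; rewrite ?subr0.
Qed.
HB.instance Definition _ := GRing.isZmodMorphism.Build _ _ (@path_op K n Q) path_op_zmod.

Lemma path_opZ c p : path_op (scal c * p) = scal c * path_op p.
Proof.
by apply: pathP => i s; rewrite coef_scal !op_pathE coef_scal; case: ifP; rewrite ?mulr0.
Qed.

Lemma path_opD p q : path_op (p + q) = path_op p + path_op q.
Proof. exact: raddfD. Qed.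

Lemma path_opM p q : path_op (p * q) = path_op q * path_op p.
Proof.
apply: (@path_span_ind _ _ _ (fun p => path_op (p * q) = path_op q * path_op p))
  => [|{}p p' IH IH'|i s hs _].
- by rewrite mul0r raddf0 mulr0.
- by rewrite mulrDl !path_opD mulrDr IH IH'.
rewrite -mulrA !path_opZ mulrA -scal_comm -mulrA; congr (_ * _).
apply: (@path_span_ind _ _ _ (fun q => path_op (path_elt K i s * q)
  = path_op q * path_op (path_elt K i s))) => [|{}q q' IH IH'|j t ht _].
- by rewrite mulr0 raddf0 mul0r.
- by rewrite mulrDr !path_opD mulrDl IH IH'.
rewrite mulrA -scal_comm -mulrA !path_opZ -mulrA; congr (_ * _).
have [h1 h2] := rev_path hs; have [g1 g2] := rev_path ht.
rewrite path_eltM !path_op_elt // path_eltM h2.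
case: (eqVneq (path_end j t) i) => [e|_]; last exact: raddf0.
have hts : is_path j (t ++ s) by rewrite is_path_cat ht e.
by rewrite path_op_elt // rev_cat path_end_cat e.
Qed.

Lemma path_op_surj (r : pathalg K Qop) : exists p, r = path_op p.
Proof.
apply: (@path_span_ind K n Qop (fun r => exists p, r = path_op p)) => [|_ _ [p ->] [q ->]|i s hs _].
- by exists 0; rewrite raddf0.
- by exists (p + q); rewrite path_opD.
have [h1 h2] := rev_path_op hs.
exists (scal (r i s) * @path_elt K n Q (@path_end n Qop i s) (rev s)).
by rewrite path_opZ path_op_elt // h2 revK.
Qed.

Lemma path_op_inj : injective (@path_op K n Q).
Proof.
move=> p q E; apply: pathP => i s; have [hs|hs] := boolP (is_path i s); last first.
  by rewrite !coef_npath.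
have [h1 h2] := rev_path hs.
have := congr1 (fun r : pathalg K Qop => r (path_end i s) (rev s)) E.
by rewrite !op_pathE h1 h2 revK.
Qed.

Lemma path_op_vertex i : path_op (path_vertex K Q i) = path_vertex K Qop i.
Proof. by rewrite -path_elt_nil path_op_elt // -path_elt_nil. Qed.

Lemma path_op_arrow (a : arrow Q) : path_op (path_arrow K a) = @path_arrow K n Qop a.
Proof.
rewrite -path_elt_arrow path_op_elt //= ?eqxx //.
by rewrite -(@path_elt_arrow K n Qop).
Qed.

End OppositePaths.

Section OppositeAlgebra.
Variables (K : fieldType) (n : nat) (A : bound_quiver K n).

Lemma op_ideal (r : pathalg K (op_quiver A)) : ideal_gen (bq_rel (op_bq A)) r ->
  exists2 p, ideal_gen (bq_rel A) p & r = path_op p.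
Proof.
elim=> {r} [|_ [p Ap ->]|_ _ _ [p Ap ->] _ [q Aq ->]|a _ c _ [p Ap ->]].
- by exists 0; [exact: ideal_gen0 | rewrite raddf0].
- by exists p => //; exact: ideal_genG.
- by exists (p + q); [exact: ideal_genD | rewrite path_opD].
have [a' ->] := path_op_surj a; have [c' ->] := path_op_surj c.
by exists (c' * p * a'); [exact: ideal_genM | rewrite !path_opM mulrA].
Qed.

Lemma op_ideal_iff p :
  ideal_gen (bq_rel (op_bq A)) (path_op p) <-> ideal_gen (bq_rel A) p.
Proof.
split=> [/op_ideal [q Aq /path_op_inj ->] //|].
elim=> {p} [|p Ap|p q _ IHp _ IHq|a p c _ IHp].
- by rewrite raddf0; exact: ideal_gen0.
- by apply: ideal_genG; exists p.
- by rewrite path_opD; exact: ideal_genD.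
by rewrite !path_opM mulrA; exact: ideal_genM.
Qed.

Lemma op_rel_in_arrow_ideal : rel_in_arrow_ideal A -> rel_in_arrow_ideal (op_bq A).
Proof.
move=> arA r /op_ideal [p /arA Ap ->] i s; case: s => // _.
by rewrite op_pathE /=; exact: Ap.
Qed.

End OppositeAlgebra.

(** * Endomorphisms of the standard modules *)

Section EndDelta.
Variables (K : fieldType) (n : nat) (B A : bound_quiver K n).
Local Notation D := (op_bq A).
Hypothesis arB : rel_in_arrow_ideal B.
Hypothesis arD : rel_in_arrow_ideal D.
Hypothesis incB : forall a : arrow B, (src a < tgt a)%N.
Variable b : path_basis D.
Local Notation BD := (dual_ext B D).
Local Notation Lam := (bq_alg BD).
Local Notation Delta := (standard_sum BD).
Local Notation idx := ('I_n + 'I_(pb_size b))%type.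
Local Notation muD := (@mu K n B D arB arD b).
Local Notation id_ := (end_id B D).
Local Notation piD := (qalg_pi (bq_rel D)).

Definition dsumvec : Delta := \sum_i dvec B D i.

Lemma dsumvec_vertex i : bq_vertex BD i *: dsumvec = dvec B D i.
Proof.
rewrite scaler_sumr (bigD1 i) //= big1 ?addr0 ?dvec_vertex // => j ji.
by rewrite -(dvec_vertex B D j) scalerA bq_vertexM eq_sym (negbTE ji) scale0r.
Qed.

Lemma end_eq_dsumvec (u v : endalg Delta) : u dsumvec = v dsumvec -> u = v.
Proof. by move=> E; apply: end_delta_eq => i; rewrite -dsumvec_vertex !endZ E. Qed.

Lemma mu_dsumvec (x : idx) d : muD x (bq_inr B d *: dsumvec) = pb_coef b x d.
Proof.
rewrite scaler_sumr mu_sum (eq_bigr (fun i => pb_coef b x (d * bq_vertex D i))).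
  by rewrite -pb_coef_sum -mulr_sumr bq_vertex_sum mulr1.
by move=> i _; rewrite mu_inr_dvec.
Qed.

(** An arrow a acts on Delta = D as right multiplication by the opposite arrow.  An
    endomorphism is determined by the image of 1, the sum of the generators, and
    the image of 1 under the path p is the opposite of p. *)
Lemma end_of_A_ex : exists chi : {rmorphism bq_alg A -> endalg Delta},
  [/\ alg_iso chi, forall i, chi (bq_vertex A i) = id_ i
    & forall p, chi (qalg_pi (bq_rel A) p) dsumvec = bq_inr B (piD (path_op p)) *: dsumvec].
Proof.
have ex (a : arrow A) : exists v : endalg Delta, forall i, v (dvec B D i) =
    if i == src a then bq_inr B (bq_arrow (a : arrow D)) *: dvec B D (tgt a) else 0.
  apply: (end_of_ex arB arD incB b) => i; case: eqP => [->|_]; last by rewrite scaler0.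
  by rewrite scalerA -(bq_inr_vertex B D) -bq_inrM (bq_vertex_arrow (B := D)) eqxx.
have [v vE] := choice ex.
have id_orth i j : id_ i * id_ j = if i == j then id_ i else 0.
  apply: end_delta_eq => k; rewrite [LHS](_ : _ = id_ i (id_ j (dvec B D k))) // end_id_dvec.
  case: (eqVneq k j) => [->|kj].
    by rewrite end_id_dvec eq_sym; case: eqP => // ->; rewrite end_id_dvec eqxx.
  rewrite end0; case: (eqVneq i j) => [->|//].
  by rewrite end_id_dvec (negbTE kj).
have id_sum : \sum_i id_ i = 1.
  by apply: endP => m; rewrite end_sumE; exact: esym (dsum_expand m).
have [|||| F [Fs Fv Fa]] := @path_rmorph_ex K n A (endalg Delta) id_ v.
- exact: id_orth.
- exact: id_sum.
- move=> a; apply: end_delta_eq => k; rewrite [LHS](_ : _ = id_ (tgt a) (v a (dvec B D k))) //.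
  rewrite vE; case: eqP => _; last exact: end0.
  by rewrite endZ end_id_dvec eqxx.
- move=> a; apply: end_delta_eq => k; rewrite [LHS](_ : _ = v a (id_ (src a) (dvec B D k))) //.
  rewrite end_id_dvec; case: (eqVneq k (src a)) => [//|ks].
  by rewrite end0 vE (negbTE ks).
have FE p : F p dsumvec = bq_inr B (piD (path_op p)) *: dsumvec.
  elim/path_alg_ind: p => [|p q Ep Eq|c p Ep|i|a p Ep].
  - by rewrite !raddf0 scale0r.
  - by rewrite rmorphD path_opD qalg_piD rmorphD scalerDl -Ep -Eq.
  - rewrite rmorphM Fs path_opZ qalg_piM bq_inrM.
    rewrite [bq_inr B (piD (scal c))](bq_inr_scal B D c) -scalerA -Ep.
    exact: end_scalE.
  - rewrite Fv path_op_vertex [bq_inr B _](bq_inr_vertex B D) dsumvec_vertex.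
    rewrite [LHS](_ : _ = mklin (end_linear (id_ i)) dsumvec) // linear_sum (bigD1 i) //=.
    rewrite end_id_dvec eqxx big1 ?addr0 // => j ji.
    by rewrite end_id_dvec (negbTE ji).
  rewrite rmorphM Fa path_opM path_op_arrow qalg_piM bq_inrM -scalerA.
  rewrite [LHS](_ : _ = v a (F p dsumvec)) // Ep endZ; congr (_ *: _).
  rewrite [LHS](_ : _ = mklin (end_linear (v a)) dsumvec) // linear_sum (bigD1 (src a)) //=.
  rewrite vE eqxx big1 ?addr0 => [|j ji]; last by rewrite vE (negbTE ji).
  rewrite -dsumvec_vertex scalerA -(bq_inr_vertex B D).
  by rewrite -[bq_inr B _ * _]bq_inrM (bq_arrow_vertex (B := D)) eqxx.
have [|chi chiE] := @qalg_rmorph_ex K _ (bq_rel A) _ F.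
  move=> p Ap; apply: end_eq_dsumvec; rewrite FE.
  rewrite (proj2 (qalg_pi_eq0 _ _)) ?rmorph0 ?scale0r //.
  by apply: ideal_genG; exists p.
have chi_inj : injective chi.
  suff ker y : chi y = 0 -> y = 0.
    by move=> y y' E; apply/eqP; rewrite -subr_eq0; apply/eqP/ker; rewrite rmorphB E subrr.
  have [p <-] := qalg_pi_surj y; rewrite chiE => F0.
  have E0 : bq_inr B (piD (path_op p)) *: dsumvec = 0 by rewrite -FE F0.
  apply/qalg_pi_eq0/op_ideal_iff/qalg_pi_eq0.
  rewrite (pb_expand b (piD (path_op p))) big1 // => x _.
  by rewrite -mu_dsumvec E0 mu0 scal0 mul0r.
have chi_surj u : exists y, chi y = u.
  pose d := \sum_x scal (muD x (u dsumvec)) * pb_vec b x.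
  have dE : bq_inr B d *: dsumvec = u dsumvec.
    apply: (@delta_eqP K n B D arB arD incB b) => x; rewrite mu_dsumvec.
    exact: (pb_coefE (c := fun x => muD x (u dsumvec))).
  have [r rE] := qalg_pi_surj d; have [p pE] := path_op_surj r.
  exists (qalg_pi (bq_rel A) p); rewrite chiE; apply: end_eq_dsumvec.
  by rewrite FE -pE rE.
exists chi; split=> [|i|p]; last by rewrite chiE.
  split; last by move=> c; rewrite -(Fs c) -chiE.
  by have [f fE] := choice chi_surj; exists f => // y; apply: chi_inj.
by rewrite -(Fv i) -chiE.
Qed.

End EndDelta.


(** * The Ext algebra as a dual extension *)

Lemma directed_rel (K : fieldType) n (B : bound_quiver K n) :
  directed B -> rel_in_arrow_ideal B.
Proof. by move=> [_ [adm _]] p /adm h i s; case: s => // _; apply: h. Qed.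

Theorem theorem10 (K : closedFieldType) (n : nat) (B A : bound_quiver K n)
    (dirB : directed B) (dirA : directed A) :
  let Lam := dual_ext B (op_bq A) in
  let Delta := standard_sum Lam in
  let L := simple_sum B in
  forall (P : proj_resolution Delta) (T : proj_resolution L),
  (* X presents Ext_B(L, L) as a graded quotient of a path algebra *)
  forall (X : bound_quiver K n) (w : arrow X -> nat)
    (phi : {rmorphism bq_alg X -> ext_alg T}),
    rel_in_arrow_ideal X ->
    graded_iso (bq_homog w) (ext_homog T) phi ->
    (forall i, ext_of_hom T (dsum_id i) (phi (bq_vertex X i))) ->
  (* H presents Hom_Lam(Delta, Delta) as a quotient of a path algebra *)
  forall (H : bound_quiver K n)
    (psi : {rmorphism bq_alg H -> endalg Delta}),
    rel_in_arrow_ideal H ->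
    alg_iso psi ->
    (forall i x, psi (bq_vertex H i) x = dsum_id i x) ->
  (exists f : {rmorphism ext_alg P -> bq_alg (dual_ext X H)},
     graded_iso (ext_homog P)
                (bq_homog (dual_ext_weight X H w)) f) /\
  (exists g : {rmorphism bq_alg (dual_ext X H) -> bq_alg (dual_ext X A)},
     graded_iso (bq_homog (dual_ext_weight X H w))
                (bq_homog (dual_ext_weight X A w)) g).

Proof.
move=> Lam Delta L P T X w phi arX phi_iso phi_vertex H psi arH psi_iso psi_vertex.
have arB := directed_rel dirB; have [incB _] := dirB.
have arA := directed_rel dirA; have [incA _] := dirA.
have arD := op_rel_in_arrow_ideal arA.
have [b] := @path_basis_ex K n (op_bq A) arD incA.
have [sg [sg_d sg_aug sh_inj sh_surj]] := shapiro arB arD incB b T P.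
have thK : kalg_morph (bq_inl (op_bq A) : {rmorphism bq_alg B -> bq_alg Lam}).
  exact: bq_inl_scal.
have [I [I_scal I_tr]] := transfer_ex thK sg_d sg_aug sh_inj sh_surj.
have tr_total := transfers_total (iota (op_bq A) arB incB) sh_surj.
have [J [J_scal J_hom]] := hom_ext_ex P.
have IJv i : I (phi (bq_vertex X i)) = J (psi (bq_vertex H i)).
  exact: (I_J_vertex arD b phi_vertex psi_vertex sg_aug I_tr J_hom).
split.
  pose f1 : {rmorphism bq_alg X -> ext_alg P} := I \o phi.
  pose f2 : {rmorphism bq_alg H -> ext_alg P} := J \o psi.
  have [[_ phi_scal] _] := phi_iso; have [_ psi_scal] := psi_iso.
  have [|||a d|h [h_scal h_inl h_inr]] := @dual_ext_rmorph_ex K n X H _ f1 f2.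
  - by move=> c; rewrite /= phi_scal I_scal.
  - by move=> c; rewrite /= psi_scal J_scal.
  - exact: IJv.
  - exact: (I_J_arrow arD b arX phi_iso phi_vertex arH psi_iso psi_vertex tr_total I_tr J_scal J_hom).
  exact: (ext_alg_iso arD b phi_iso phi_vertex psi_iso psi_vertex sg_d sh_inj tr_total I_tr J_hom
    h_scal h_inl h_inr).
have [chi [chi_iso chi_v _]] := end_of_A_ex arB arD incB b.
have [al [[_ al_scal] chiK alK]] := rmorph_inv_ex chi_iso.
have al_id i : al (end_id B (op_bq A) i) = bq_vertex A i by rewrite -chi_v chiK.
pose ka : {rmorphism bq_alg H -> bq_alg A} := al \o psi.
have kaE y : ka y = al (psi y) by [].
have ka_iso : alg_iso ka.
  have [[psi' psiK psi'K] psi_scal] := psi_iso; split; last first.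
    by move=> c; rewrite kaE psi_scal al_scal.
  by exists (psi' \o chi) => y; rewrite /= ?chiK ?alK ?psiK ?psi'K ?chiK.
have ka_vertex i : ka (bq_vertex H i) = bq_vertex A i.
  by rewrite kaE (psi_vertexE psi_vertex) al_id.
apply: (dual_ext_iso w arH arA ka_iso ka_vertex) => [d i|y a i ya].
  have [c cE] := psi_arrow arB arD incB b arH psi_iso psi_vertex d.
  rewrite kaE cE rmorph_sum (big_morph _ (vcoefD arA i) (vcoef0 arA i)) big1 // => k _.
  rewrite (end_basis_ends arB arD incB) !rmorphM !al_id !vcoefM // !vcoef_vertex //.
  have := pb_lt b k; case: (eqVneq i (pb_src b (inr k))) => [->|_]; last by rewrite !mul0r mulr0.
  by case: eqVneq => [->|_]; rewrite ?ltnn // !mulr0.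
have -> : y = bq_vertex H (tgt a) * y * bq_vertex H (src a).
  have [[ka' kaK _] _] := ka_iso; apply: (can_inj kaK).
  by rewrite !rmorphM ya !ka_vertex bq_vertex_arrow eqxx bq_arrow_vertex eqxx.
rewrite !vcoefM // !vcoef_vertex //; have := incA a.
case: (eqVneq i (tgt a)) => [->|_]; last by rewrite !mul0r.
by case: eqVneq => [->|_]; rewrite ?ltnn // mulr0.
Qed.
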